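(* Let $(B,\nu_B)$ be a strictly unital $A_\infty$-algebra over the commutative ring $k$. (1) Let $q:(\Pi A,\nu_A^1)\to(\Pi B,\nu_B^1)$ be a surjective semiprojective resolution of the complex underlying $(B,\nu_B)$, and assume that $A$ has a split element $1\in A_0$ with $\nu_A^1([1])=0$ and $q([1])=[1]$. Then there exists $\nu_A\in CC^\bullet(A,A)_{-1}$, extending $\nu_A^1$ (i.e. with tensor degree one component $\nu_A^1$), such that $(A,1,\nu_A)$ is an $A_\infty$-algebra with split unit and $q$ is a strict morphism $(A,\nu_A)\to(B,\nu_B)$. If $(B,\nu_B)$ is augmented, then $\nu_A$ can be chosen such that $(A,\nu_A)$ is augmented. (2) Let $q:(A,\nu_A)\to(B,\nu_B)$ and $\alpha:(C,\nu_C)\to(B,\nu_B)$ be strictly unital morphisms of strictly unital $A_\infty$-algebras. Assume that $(C,1,\nu_C)$ is an $A_\infty$-algebra with split unit such that $(\Pi C,\nu_C^1)$ is a semiprojective complex, and that $q=q^1$ is strict, with $q^1:(\Pi A,\nu_A^1)\to(\Pi B,\nu_B^1)$ a surjective quasi-isomorphism of complexes. Assume further that there is a morphism of chain complexes $\delta^1:(\Pi C,\nu_C^1)\to(\Pi A,\nu_A^1)$ such that $\delta^1[1]=[1]$ and $q^1\delta^1=\alpha^1$. Then there exists a strictly unital morphism of $A_\infty$-algebras $\delta:(C,\nu_C)\to(A,\nu_A)$ such that $q\delta=\alpha$. (3) In the setting of (2), if $H_0\big(CC^{n+1}(\overline C,A),d_{\overline C A}\big)=0$ for all $n\ge 1$,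 and $\delta,\delta':(C,\nu_C)\to(A,\nu_A)$ are two strictly unital morphisms with $q\delta=\alpha=q\delta'$, then $\delta$ and $\delta'$ are homotopic by a strictly unital homotopy. In particular, in the setting of (1) (with $q:(\Pi A,\nu_A^1)\to(\Pi B,\nu^1_B)$ and $1\in A_0$ as there), if $H_0\big(CC^{n+1}(\overline A,A),d_{\overline A A}\big)=0$ for all $n\ge1$, then any two elements $\nu_A,\widetilde\nu_A\in CC^\bullet(A,A)_{-1}$ extending $\nu_A^1$, such that $(A,1,\nu_A)$ and $(A,1,\widetilde\nu_A)$ are $A_\infty$-algebras with split units and $q$ is a strict morphism from each of them to $(B,\nu_B)$, are homotopy equivalent via strictly unital homotopies.
   Context: Conventions. $k$ is a fixed commutative ring; modules, complexes and maps are over $k$; complexes are unbounded with differentials of degree $-1$. For graded modules, $\mathrm{Hom}(M,N)_n=\prod_i\mathrm{Hom}(M_i,N_{i+n})$ and $(M\otimes N)_n=\bigoplus_i M_i\otimes N_{n-i}$, with $(f\otimes g)(x\otimes y)=(-1)^{|g||x|}f(x)\otimes g(y)$. For complexes, the differential on $\mathrm{Hom}(M,N)$ is $f\mapsto\delta_Nf-(-1)^{|f|}f\delta_M$, and that on $M\otimes N$ is $\delta_M\otimes1+1\otimes\delta_N$. $\Pi$ is the shift $(\Pi M)_n=M_{n-1}$, $s:M\to\Pi M$, $s(x)=[x]$, the degree one identity map, $[x_1|\dots|x_n]=sx_1\otimes\cdots\otimes sx_n$. A complex $P$ is semiprojective if for every surjective quasi-isomorphism of complexes $f$, $\mathrm{Hom}(P,f)$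 is a surjective quasi-isomorphism. A semiprojective resolution of $M$ is a quasi-isomorphism $P\to M$ with $P$ semiprojective. Hochschild cochains. For graded modules $A,B$: $CC^l(A,B)=\mathrm{Hom}((\Pi A)^{\otimes l},\Pi B)$ (graded), $CC^\bullet(A,B)=\prod_{l\ge1}CC^l(A,B)$; elements are written $f=(f^l)$ with $f^l$ the tensor degree $l$ component; a subscript $i$, as in $CC^\bullet(A,B)_i$, denotes the degree $i$ part. Products: - Gerstenhaber product: $(\mu\circ\nu)^l=\sum_{1\le i\le l,\,0\le j\le i-1}\mu^i(1^{\otimes j}\otimes\nu^{l-i+1}\otimes1^{\otimes i-j-1})$, for $\mu\in CC^\bullet(A,B)$, $\nu\in CC^\bullet(A,A)$; - $*$-product: $(\nu*\alpha)^l=\sum_{i_1+\dots+i_j=l}\nu^j(\alpha^{i_1}\otimes\cdots\otimes\alpha^{i_j})$, for $\alpha\in CC^\bullet(A,B)_0$; - homotopy $*$-product, for $\alpha,\beta\in CC^\bullet(A,B)_0$, $r\in CC^\bullet(A,B)_1$, $\nu\in CC^\bullet(B,B)_{-1}$: $(\nu\,{}_\alpha{*}_\beta\,r)^l=\sum\nu^i(\alpha^{j_1}\otimes\cdots\otimes\alpha^{j_{m-1}}\otimes r^{j_m}\otimes\beta^{j_{m+1}}\otimes\cdots\otimes\beta^{j_i})$, summed over $1\le m\le i\le l$, $j_1+\dots+j_i=l$. $A_\infty$-objects. A nonunital $A_\infty$-algebra is a pair $(A,\nu)$ with $\nu\in CC^\bullet(A,A)_{-1}$ and $\nu\circ\nu=0$;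 in particular $(\Pi A,\nu^1)$ is a complex, the underlying complex. A morphism $(A,\nu_A)\to(B,\nu_B)$ is $\alpha\in CC^\bullet(A,B)_0$ with $\nu_B*\alpha=\alpha\circ\nu_A$. It is strict if $\alpha^l=0$ for $l\ge2$ (and is then identified with $\alpha^1$). The composite of $\alpha$ followed by $\beta$ is $(\beta\alpha)^l=\sum\beta^j(\alpha^{i_1}\otimes\cdots\otimes\alpha^{i_j})$; so for $q$ strict, $(q\delta)^l=q^1\delta^l$. A homotopy between morphisms $\alpha,\beta:(A,\nu_A)\to(B,\nu_B)$ is $r\in CC^\bullet(A,B)_1$ with $\alpha-\beta=\nu_B\,{}_\alpha{*}_\beta\,r+r\circ\nu_A$. Strict units. Given $1\in A_0$, $1\in B_0$: $\nu\in CC^\bullet(A,A)_{-1}$ is strictly unital if $\nu^2[1|a]=[a]=(-1)^{|a|}\nu^2[a|1]$ for all $a\in A$, and $\nu^l$ for $l\ne2$ vanishes whenever one of its arguments is $[1]$. $\alpha\in CC^\bullet(A,B)_0$ is strictly unital if $\alpha^1[1]=[1]$ and $\alpha^l$, $l\ge2$, vanishes whenever one argument is $[1]$. $r\in CC^\bullet(A,B)_1$ is strictly unital if every $r^l$, $l\ge1$, vanishes whenever one argument is $[1]$. An $A_\infty$-algebra, morphism between strictly unital algebras, or homotopy between strictly unital morphisms is strictly unital if the defining element is. Two strictly unital $A_\infty$-algebras are homotopy equivalent via strictly unital homotopies if there are strictly unital morphisms in both directions whose two composites are homotopic to the identities by strictly unital homotopies. Split units. A split element of a graded module $A$ is an element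 $1\in A_0$ generating a rank one free submodule, together with a fixed splitting $A\to k$ of the inclusion $k\to A$, $1\mapsto1$. An $A_\infty$-algebra with split unit $(A,1,\nu)$ is a graded module with split element $(A,1)$ and an $A_\infty$-structure $\nu$ that is strictly unital with respect to $1$. Put $\overline A=A/(k\cdot1)$; via $A\to\overline A$, $CC^n(\overline A,B)$ is the submodule of $CC^n(A,B)$ of maps vanishing whenever one argument is $[1]$. A strictly unital $A_\infty$-algebra $(B,\nu_B)$ is augmented if there is a strictly unital morphism $(B,\nu_B)\to(k,\mu_{\mathrm{su}})$, where $k$ is in degree $0$ and $\mu_{\mathrm{su}}$ has only the component $\mu_{\mathrm{su}}^2[x|y]=[xy]$. The differential $d_{\overline C A}$ on $CC^{n+1}(\overline C,A)$ is $d_{\overline C A}(f)=\nu_A^1f-(-1)^{|f|}f\circ\nu^1_{\overline C}$, where $\nu^1_{\overline C}:\Pi\overline C\to\Pi\overline C$ is induced by $\nu_C^1$ (i.e. the Hom-complex differential from $(\Pi\overline C)^{\otimes n+1}$ to $\Pi A$). Likewise $d_{\overline AA}$ is defined using $\nu_A^1$. *)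

(* Defs.v *)
From HB Require Import structures.
From mathcomp Require Import all_boot all_order all_algebra generic_quotient.
From mathcomp Require Import boolp zify.

Set Implicit Arguments.
Unset Strict Implicit.
Unset Printing Implicit Defensive.

Import GRing.Theory.
Local Open Scope ring_scope.
Local Open Scope quotient_scope.

(* (-1)^n for n : int; the library's integer powers require a ring with inverses. *)
Definition ksign (k : comPzRingType) (n : int) : k := (-1) ^+ `|n|%N.

Definition gmod (k : comPzRingType) := int -> lmodType k.

Definition Pi (k : comPzRingType) (M : gmod k) : gmod k := fun n => M (n - 1).

(* The base ring, concentrated in degree 0. *)
Definition gk (k : comPzRingType) : gmod k :=
  fun n => if n is Posz 0 then k^o : lmodType k else 'M[k]_(0, 0) : lmodType k.

(* Hom(M, N)_d = prod_i Hom(M_i, N_{i+d}).  The component M_i -> N_{i+d} is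
   recorded as [f i j : M i -> N j] with j a free index and [f i j = 0] unless
   j = i + d; this avoids transports along equalities of integers. *)
Record ghom (k : comPzRingType) (M N : gmod k) (d : int) := GHom {
  ghom_fun :> forall i j, M i -> N j;
  ghom_linear : forall i j (a : k) (x y : M i),
    @ghom_fun i j (a *: x + y) = a *: @ghom_fun i j x + @ghom_fun i j y;
  ghom_shape : forall i j (x : M i), j != i + d -> @ghom_fun i j x = 0 }.
Arguments ghom_fun {k M N d} _ i j x.

Section GHomModule.
Variables (k : comPzRingType) (M N : gmod k) (d : int).
Implicit Types f g h : ghom M N d.

Lemma ghomP f g : (forall i j x, f i j x = g i j x) -> f = g.
Proof.
case: f g => [f f1 f2] [g g1 g2] /= fg.
have E : f = g.
  apply: functional_extensionality_dep => i.
  apply: functional_extensionality_dep => j; apply: funext => x; exact: fg.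
by subst g; congr GHom; apply: Prop_irrelevance.
Qed.

Lemma ghomD f i j : {morph f i j : x y / x + y}.
Proof. by move=> x y; have := ghom_linear f j 1 x y; rewrite !scale1r. Qed.

Lemma ghom0 f i j : f i j 0 = 0.
Proof. by apply: (addrI (f i j 0)); rewrite -ghomD !addr0. Qed.

Lemma ghomZ f i j a : {morph f i j : x / a *: x}.
Proof. by move=> x; have := ghom_linear f j a x 0; rewrite !addr0 ghom0 addr0. Qed.

HB.instance Definition _ := gen_eqMixin (ghom M N d).
HB.instance Definition _ := gen_choiceMixin (ghom M N d).

Program Definition ghom_zero : ghom M N d := @GHom k M N d (fun i j x => 0) _ _.
Next Obligation. by rewrite scaler0 addr0. Qed.

Program Definition ghom_add f g : ghom M N d :=
  @GHom k M N d (fun i j x => f i j x + g i j x) _ _.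
Next Obligation. by rewrite !ghom_linear scalerDr addrACA. Qed.
Next Obligation. by rewrite !ghom_shape ?addr0. Qed.

Program Definition ghom_opp f : ghom M N d :=
  @GHom k M N d (fun i j x => - f i j x) _ _.
Next Obligation. by rewrite ghom_linear opprD scalerN. Qed.
Next Obligation. by rewrite ghom_shape ?oppr0. Qed.

Program Definition ghom_scale (a : k) f : ghom M N d :=
  @GHom k M N d (fun i j x => a *: f i j x) _ _.
Next Obligation. by rewrite ghom_linear scalerDr !scalerA mulrC. Qed.
Next Obligation. by rewrite ghom_shape ?scaler0. Qed.

Fact ghom_addA : associative ghom_add.
Proof. by move=> f g h; apply: ghomP => i j x /=; rewrite addrA. Qed.
Fact ghom_addC : commutative ghom_add.
Proof. by move=> f g; apply: ghomP => i j x /=; rewrite addrC. Qed.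
Fact ghom_add0 : left_id ghom_zero ghom_add.
Proof. by move=> f; apply: ghomP => i j x /=; rewrite add0r. Qed.
Fact ghom_addN : left_inverse ghom_zero ghom_opp ghom_add.
Proof. by move=> f; apply: ghomP => i j x /=; rewrite addNr. Qed.
HB.instance Definition _ := GRing.isZmodule.Build (ghom M N d)
  ghom_addA ghom_addC ghom_add0 ghom_addN.

Fact ghom_scaleA a b f : ghom_scale a (ghom_scale b f) = ghom_scale (a * b) f.
Proof. by apply: ghomP => i j x /=; rewrite scalerA. Qed.
Fact ghom_scale1 : left_id 1 ghom_scale.
Proof. by move=> f; apply: ghomP => i j x /=; rewrite scale1r. Qed.
Fact ghom_scaleDr : right_distributive ghom_scale +%R.
Proof. by move=> a f g; apply: ghomP => i j x /=; rewrite scalerDr. Qed.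
Fact ghom_scaleDl f : {morph ghom_scale^~ f : a b / a + b}.
Proof. by move=> a b; apply: ghomP => i j x /=; rewrite scalerDl. Qed.
HB.instance Definition _ := GRing.Zmodule_isLmodule.Build k (ghom M N d)
  ghom_scaleA ghom_scale1 ghom_scaleDr ghom_scaleDl.

End GHomModule.

Definition gHom (k : comPzRingType) (M N : gmod k) : gmod k :=
  fun d => ghom M N d : lmodType k.

Definition gid_fun (k : comPzRingType) (M : gmod k) i j (x : M i) : M j :=
  match @eqP _ i j with
  | ReflectT e => eq_rect i (fun n => M n : Type) x j e
  | ReflectF _ => 0
  end.

Program Definition gid (k : comPzRingType) (M : gmod k) : ghom M M 0 :=
  @GHom k M M 0 (@gid_fun k M) _ _.
Next Obligation.
rewrite /gid_fun; case: eqP => [e|_]; last by rewrite scaler0 addr0.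
by case: _ / e.
Qed.
Next Obligation.
by move: H; rewrite /gid_fun addr0 eq_sym; case: (@eqP _ i j).
Qed.

Record differential (k : comPzRingType) (M : gmod k) := Differential {
  diff_hom :> ghom M M (-1);
  diff_sq0 : forall i j l (x : M i), diff_hom j l (diff_hom i j x) = 0 }.

Definition chain_map (k : comPzRingType) (M N : gmod k)
    (dM : differential M) (dN : differential N) (f : ghom M N 0) : Prop :=
  forall i j (x : M i), f j j (dM i j x) = dN i j (f i i x).

Definition surjective (k : comPzRingType) (M N : gmod k) (f : ghom M N 0) : Prop :=
  forall n (y : N n), exists x : M n, f n n x = y.

Definition cycle (k : comPzRingType) (M : gmod k) (d : differential M) n (x : M n) :=
  d n (n - 1) x = 0.

Definition boundary (k : comPzRingType) (M : gmod k) (d : differential M) n (x : M n) :=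
  exists y : M (n + 1), d (n + 1) n y = x.

(* H_n(f) is injective and surjective for every n. *)
Definition quasi_iso (k : comPzRingType) (M N : gmod k)
    (dM : differential M) (dN : differential N) (f : ghom M N 0) : Prop :=
  [/\ chain_map dM dN f,
      forall n (x : M n), cycle dM x -> boundary dN (f n n x) -> boundary dM x
    & forall n (y : N n), cycle dN y ->
        exists2 x : M n, cycle dM x & boundary dN (f n n x - y)].

Section HomComplex.
Variables (k : comPzRingType) (P X Y : gmod k).
Variables (dP : differential P) (dX : differential X).

Program Definition hom_bnd n m (g : ghom P X n) : ghom P X m :=
  @GHom k P X m (fun i j x =>
    if m == n - 1 then
      dX (j + 1) j (g i (j + 1) x) - ksign k n *: g (i - 1) j (dP i (i - 1) x)
    else 0) _ _.
Next Obligation.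
case: ifP => _; last by rewrite scaler0 addr0.
by rewrite !ghom_linear !(scalerDr, scalerN) opprD addrACA !scalerA [a * _]mulrC.
Qed.
Next Obligation.
case: ifP => // /eqP Em; rewrite Em in H.
rewrite [g i _ x]ghom_shape; last first.
  by apply: contraNneq H => E; rewrite addrA -E addrK.
rewrite ghom0 [g _ _ _]ghom_shape ?scaler0 ?subr0 //.
by apply: contraNneq H => ->; rewrite addrA addrAC.
Qed.

Program Definition hom_bnd_hom : ghom (gHom P X) (gHom P X) (-1) :=
  @GHom k (gHom P X) (gHom P X) (-1) hom_bnd _ _.
Next Obligation.
apply: ghomP => p q u /=; case: ifP => _; last by rewrite scaler0 addr0.
by rewrite ghom_linear !(scalerDr, scalerN) opprD addrACA !scalerA [a * _]mulrC.
Qed.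
Next Obligation. by apply: ghomP => p q u /=; rewrite (negPf H). Qed.

(* The complex Hom(P, X), with differential
   g |-> delta_X g - (-1)^|g| g delta_P. *)
Program Definition hom_diff : differential (gHom P X) :=
  @Differential k (gHom P X) hom_bnd_hom _.
Next Obligation.
apply: ghomP => p q u /=; case: ifP => // _.
case: ifP => [/eqP ->|_]; last by rewrite ghom0 scaler0 subr0.
rewrite [dX _ _ (_ - _)]ghomD -scaleN1r !ghomZ diff_sq0 add0r.
rewrite diff_sq0 ghom0 scaler0 subr0 scaleN1r.
have -> : ksign k (i - 1) = - ksign k i.
  rewrite /ksign; case: i {x} => [[|n]|n].
  - by rewrite sub0r expr1 expr0.
  - by rewrite -addn1 PoszD addrK /= addn1 exprS mulN1r opprK.
  - have -> : (Negz n - 1 = Negz n.+1) by rewrite !NegzE -opprD -PoszD addn1.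
    by rewrite /= [in LHS]exprS mulN1r.
by rewrite scaleNr opprK addNr.
Qed.

Program Definition hom_post_fun (f : ghom X Y 0) n m (g : ghom P X n) : ghom P Y m :=
  @GHom k P Y m (fun i j x => if m == n then f j j (g i j x) else 0) _ _.
Next Obligation.
by case: ifP => _; rewrite ?scaler0 ?addr0 // !ghom_linear.
Qed.
Next Obligation.
by case: ifP => // /eqP E; rewrite [g _ _ _]ghom_shape ?ghom0 -?E.
Qed.

Program Definition hom_post (f : ghom X Y 0) : ghom (gHom P X) (gHom P Y) 0 :=
  @GHom k (gHom P X) (gHom P Y) 0 (hom_post_fun f) _ _.
Next Obligation.
by apply: ghomP => p q u /=; case: ifP => _; rewrite ?scaler0 ?addr0 // ghom_linear.
Qed.
Next Obligation.
by apply: ghomP => p q u /=; rewrite addr0 in H; rewrite (negPf H).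
Qed.

End HomComplex.

Definition semiprojective (k : comPzRingType) (P : gmod k) (dP : differential P) : Prop :=
  forall (X Y : gmod k) (dX : differential X) (dY : differential Y) (f : ghom X Y 0),
    quasi_iso dX dY f -> surjective f ->
    quasi_iso (hom_diff dP dX) (hom_diff dP dY) (hom_post P f) /\
    surjective (hom_post P f).

Definition homog (k : comPzRingType) (M : gmod k) := {i : int & M i}.

Definition hel (k : comPzRingType) (M : gmod k) i (x : M i) : homog M :=
  existT (fun i => M i : Type) i x.

Definition degs (k : comPzRingType) (M : gmod k) (w : seq (homog M)) : int :=
  \sum_(x <- w) projT1 x.

Section TensorPower.
Variables (k : comPzRingType) (M : gmod k) (l : nat) (n : int).

Definition fsum := seq (k * seq (homog M)).

Definition fscale (a : k) (u : fsum) : fsum := [seq (a * p.1, p.2) | p <- u].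

(* (M^{(x) l})_n by generators and relations: formal k-linear combinations of
   words of homogeneous elements of M, modulo multilinearity.  Rather than
   restricting the generators, [teq_supp] kills the words whose length is not
   l or whose total degree is not n. *)
Inductive teq : fsum -> fsum -> Prop :=
| teq_refl u : teq u u
| teq_sym u v : teq u v -> teq v u
| teq_trans u v w : teq u v -> teq v w -> teq u w
| teq_cat u u' v v' : teq u u' -> teq v v' -> teq (u ++ v) (u' ++ v')
| teq_scale a u v : teq u v -> teq (fscale a u) (fscale a v)
| teq_comm u v : teq (u ++ v) (v ++ u)
| teq_add a b w : teq [:: (a, w); (b, w)] [:: (a + b, w)]
| teq_zero w : teq [:: (0, w)] [::]
| teq_lin w1 w2 i (a : k) (x y : M i) :
    teq [:: (1, w1 ++ hel (a *: x + y) :: w2)]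
        [:: (a, w1 ++ hel x :: w2); (1, w1 ++ hel y :: w2)]
| teq_supp w : ~~ ((size w == l) && (degs w == n)) -> teq [:: (1, w)] [::].

Definition teqb (u v : fsum) : bool := `[< teq u v >].

Fact teqb_refl : reflexive teqb.
Proof. by move=> u; apply/asboolP; apply: teq_refl. Qed.
Fact teqb_sym : symmetric teqb.
Proof. by move=> u v; apply/asboolP/asboolP; apply: teq_sym. Qed.
Fact teqb_trans : transitive teqb.
Proof. by move=> v u w /asboolP uv /asboolP vw; apply/asboolP; apply: teq_trans vw. Qed.
Canonical teq_equiv := EquivRel teqb teqb_refl teqb_sym teqb_trans.

Definition tmod := {eq_quot teq_equiv}.
HB.instance Definition _ := Choice.on tmod.
HB.instance Definition _ := EqQuotient.on tmod.

Lemma tpiP u v : (\pi_tmod u = \pi_tmod v) <-> teq u v.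
Proof. by split=> [/eqmodP/asboolP|uv] //; apply/eqmodP/asboolP. Qed.

Lemma treprP u : teq (repr (\pi_tmod u)) u.
Proof. by apply/tpiP; rewrite reprK. Qed.

Definition tadd (x y : tmod) : tmod := \pi_tmod (repr x ++ repr y).
Definition tscale (a : k) (x : tmod) : tmod := \pi_tmod (fscale a (repr x)).
Definition topp (x : tmod) : tmod := tscale (-1) x.
Definition tzero : tmod := \pi_tmod [::].

Lemma taddE u v : tadd (\pi_tmod u) (\pi_tmod v) = \pi_tmod (u ++ v).
Proof. by apply/tpiP; apply: teq_cat; apply: treprP. Qed.
Lemma tscaleE a u : tscale a (\pi_tmod u) = \pi_tmod (fscale a u).
Proof. by apply/tpiP; apply: teq_scale; apply: treprP. Qed.

Lemma fscaleDl a b u : teq (fscale (a + b) u) (fscale a u ++ fscale b u).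
Proof.
elim: u => [|[c w] u IH]; first exact: teq_refl.
rewrite /= mulrDl -cat1s.
apply: teq_trans (_ : teq _ ([:: (a * c, w); (b * c, w)] ++ (fscale a u ++ fscale b u))) _.
  by apply: teq_cat => //; apply: teq_sym; apply: teq_add.
apply: (@teq_cat [:: _] [:: _]); first exact: teq_refl.
change (teq (([:: (b * c, w)] ++ fscale a u) ++ fscale b u)
  (fscale a u ++ ([:: (b * c, w)] ++ fscale b u))); rewrite catA.
apply: teq_cat; last exact: teq_refl.
exact: teq_comm.
Qed.

Lemma fscale0 u : teq (fscale 0 u) [::].
Proof.
elim: u => [|[c w] u IH]; first exact: teq_refl.
by rewrite /= mul0r -cat1s -[[::]]cats0; apply: teq_cat => //; apply: teq_zero.
Qed.

Fact tscale1 : left_id 1 tscale.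
Proof.
elim/quotW=> u; rewrite tscaleE; congr (\pi_tmod _).
by rewrite /fscale -[RHS]map_id; apply: eq_map => -[c w] /=; rewrite mul1r.
Qed.

Fact tscaleA a b x : tscale a (tscale b x) = tscale (a * b) x.
Proof.
elim/quotW: x => u; rewrite [tscale b _]tscaleE !tscaleE; congr (\pi_tmod _).
by rewrite /fscale -map_comp; apply: eq_map => -[c w] /=; rewrite mulrA.
Qed.

Fact taddA : associative tadd.
Proof.
elim/quotW=> u; elim/quotW=> v; elim/quotW=> w.
by rewrite [tadd (\pi_tmod v) _]taddE [tadd (\pi_tmod u) (\pi_tmod v)]taddE !taddE catA.
Qed.
Fact taddC : commutative tadd.
Proof.
by elim/quotW=> u; elim/quotW=> v; rewrite !taddE; apply/tpiP; apply: teq_comm.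
Qed.
Fact tadd0 : left_id tzero tadd.
Proof. by elim/quotW=> u; rewrite taddE. Qed.
Fact taddN : left_inverse tzero topp tadd.
Proof.
elim/quotW=> u; rewrite -[X in tadd _ X]tscale1 /topp !tscaleE taddE; apply/tpiP.
apply: teq_trans (fscale0 u); apply: teq_sym.
by rewrite -(addNr 1); apply: fscaleDl.
Qed.
HB.instance Definition _ := GRing.isZmodule.Build tmod taddA taddC tadd0 taddN.

Fact tscaleDr : right_distributive tscale +%R.
Proof.
move=> a; elim/quotW=> u; elim/quotW=> v.
change (tscale a (tadd (\pi_tmod u) (\pi_tmod v)) =
  tadd (tscale a (\pi_tmod u)) (tscale a (\pi_tmod v))).
rewrite [tadd (\pi_tmod u) _]taddE [tscale a (\pi_tmod u)]tscaleE.
by rewrite [tscale a (\pi_tmod v)]tscaleE taddE tscaleE /fscale map_cat.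
Qed.
Fact tscaleDl x : {morph tscale^~ x : a b / a + b}.
Proof.
elim/quotW: x => u a b.
change (tscale (a + b) (\pi_tmod u) =
  tadd (tscale a (\pi_tmod u)) (tscale b (\pi_tmod u))).
by rewrite !tscaleE taddE; apply/tpiP; apply: fscaleDl.
Qed.
HB.instance Definition _ := GRing.Zmodule_isLmodule.Build k tmod
  tscaleA tscale1 tscaleDr tscaleDl.

(* The pure tensor x_1 (x) ... (x) x_l of a word (0 if the word does not have
   length l and degree n). *)
Definition tens (w : seq (homog M)) : tmod := \pi_tmod [:: (1, w)].

Lemma tens_lin w1 w2 i a (x y : M i) :
  tens (w1 ++ hel (a *: x + y) :: w2) =
    a *: tens (w1 ++ hel x :: w2) + tens (w1 ++ hel y :: w2).
Proof.
change (tens (w1 ++ hel (a *: x + y) :: w2) =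
  tadd (tscale a (tens (w1 ++ hel x :: w2))) (tens (w1 ++ hel y :: w2))).
rewrite /tens tscaleE taddE /= mulr1.
by apply/tpiP; apply: teq_lin.
Qed.

Lemma tens_supp w : ~~ ((size w == l) && (degs w == n)) -> tens w = 0.
Proof. by move=> H; apply/tpiP; apply: teq_supp. Qed.

Lemma tens_span u : \pi_tmod u = \sum_(p <- u) p.1 *: tens p.2.
Proof.
elim: u => [|[c w] u IH]; first by rewrite big_nil.
rewrite big_cons -IH.
change (\pi_tmod ((c, w) :: u) = tadd (tscale c (tens w)) (\pi_tmod u)).
by rewrite /tens tscaleE taddE /= mulr1.
Qed.

Section Lift.
Variables (N : lmodType k) (phi : seq (homog M) -> N).
Hypothesis phi_lin : forall w1 w2 i a (x y : M i),
  phi (w1 ++ hel (a *: x + y) :: w2) =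
    a *: phi (w1 ++ hel x :: w2) + phi (w1 ++ hel y :: w2).
Hypothesis phi_supp : forall w, ~~ ((size w == l) && (degs w == n)) -> phi w = 0.

Definition flift (u : fsum) : N := \sum_(p <- u) p.1 *: phi p.2.
Definition tlift (x : tmod) : N := flift (repr x).

Lemma flift_cat u v : flift (u ++ v) = flift u + flift v.
Proof. exact: big_cat. Qed.

Lemma flift_scale a u : flift (fscale a u) = a *: flift u.
Proof.
by rewrite /flift big_map scaler_sumr; apply: eq_bigr => p _; rewrite scalerA.
Qed.

Lemma flift_teq u v : teq u v -> flift u = flift v.
Proof.
elim=> {u v} //=.
- by move=> u v w _ -> _ ->.
- by move=> u u' v v' _ E _ E'; rewrite !flift_cat E E'.
- by move=> a u v _ E; rewrite !flift_scale E.
- by move=> u v; rewrite !flift_cat addrC.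
- by move=> a b w; rewrite /flift !big_cons !big_nil !addr0 scalerDl.
- by move=> w; rewrite /flift big_cons !big_nil addr0 scale0r.
- by move=> w1 w2 i a x y; rewrite /flift !big_cons !big_nil !addr0 !scale1r phi_lin.
- by move=> w H; rewrite /flift big_cons !big_nil addr0 phi_supp ?scaler0.
Qed.

Lemma tliftE u : tlift (\pi_tmod u) = flift u.
Proof. by apply: flift_teq; apply: treprP. Qed.

Lemma tlift_linear a x y : tlift (a *: x + y) = a *: tlift x + tlift y.
Proof.
elim/quotW: x => u; elim/quotW: y => v.
change (tlift (tadd (tscale a (\pi_tmod u)) (\pi_tmod v)) =
  a *: tlift (\pi_tmod u) + tlift (\pi_tmod v)).
rewrite tscaleE taddE !tliftE.
by rewrite flift_cat flift_scale.
Qed.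

Lemma tlift_tens w : tlift (tens w) = phi w.
Proof. by rewrite tliftE /flift big_cons big_nil addr0 scale1r. Qed.

End Lift.
End TensorPower.

Definition tpow (k : comPzRingType) (l : nat) (M : gmod k) : gmod k :=
  fun n => tmod M l n : lmodType k.

Definition CCl (k : comPzRingType) (l : nat) (A B : gmod k) (d : int) :=
  ghom (tpow l (Pi A)) (Pi B) d.

(* CC^*(A, B)_d, the product over tensor degrees l = 1, 2, 3, ... *)
Definition CC (k : comPzRingType) (A B : gmod k) (d : int) :=
  forall l : nat, CCl l.+1 A B d.

(* A cochain is manipulated through its values on the tensors [x_1|...|x_l],
   where the word [:: x_1; ...; x_l] of homogeneous elements of Pi A has any
   length: f s j is the component in (Pi B)_j of f^l(s), for l = size s. *)
Definition cochain (k : comPzRingType) (A B : gmod k) :=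
  seq (homog (Pi A)) -> forall j, Pi B j.

Definition evl (k : comPzRingType) (l : nat) (A B : gmod k) (d : int)
    (f : CCl l A B d) : cochain A B :=
  fun s j => f (degs s) j (tens l (degs s) s).

Definition ev (k : comPzRingType) (A B : gmod k) (d : int) (f : CC A B d) : cochain A B :=
  fun s j => if s is _ :: s' then evl (f (size s')) s j else 0.
Coercion ev : CC >-> cochain.

Lemma evlE (k : comPzRingType) (l : nat) (A B : gmod k) (d : int) (f : CCl l A B d)
  s n j : degs s = n -> evl f s j = f n j (tens l n s).
Proof. by move<-. Qed.

Lemma degs_cat (k : comPzRingType) (M : gmod k) (w1 w2 : seq (homog M)) :
  degs (w1 ++ w2) = degs w1 + degs w2.
Proof. exact: big_cat. Qed.

Lemma degs_cons (k : comPzRingType) (M : gmod k) (x : homog M) w :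
  degs (x :: w) = projT1 x + degs w.
Proof. exact: big_cons. Qed.

Lemma degs_hel (k : comPzRingType) (M : gmod k) (w1 w2 : seq (homog M)) i (x y : M i) :
  degs (w1 ++ hel x :: w2) = degs (w1 ++ hel y :: w2).
Proof. by rewrite !degs_cat !degs_cons. Qed.

(* The functions on words that come from an element of CC^*(A, B)_d. *)
Definition cochain_axiom (k : comPzRingType) (A B : gmod k) (d : int)
    (F : cochain A B) : Prop :=
  [/\ forall j, F [::] j = 0,
      forall s j, j != degs s + d -> F s j = 0
    & forall s1 s2 i j a (x y : Pi A i),
        F (s1 ++ hel (a *: x + y) :: s2) j =
          a *: F (s1 ++ hel x :: s2) j + F (s1 ++ hel y :: s2) j].

Lemma evP (k : comPzRingType) (A B : gmod k) (d : int) (f : CC A B d) :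
  cochain_axiom d (ev f).
Proof.
split=> // [[|x s] j H|s1 s2 i j a x y] //=; first by rewrite /evl ghom_shape.
have E l : evl (f l) (s1 ++ hel (a *: x + y) :: s2) j =
    a *: evl (f l) (s1 ++ hel x :: s2) j + evl (f l) (s1 ++ hel y :: s2) j.
  rewrite (evlE _ _ (degs_hel s1 s2 _ (a *: x + y))) [RHS]/=.
  rewrite (evlE (s := _ ++ hel y :: _) _ _ (degs_hel s1 s2 y (a *: x + y))).
  rewrite (evlE (s := _ ++ hel x :: _) _ _ (degs_hel s1 s2 x (a *: x + y))).
  by rewrite tens_lin ghom_linear.
by case: s1 E => [|z s1] E /=; rewrite E // !size_cat.
Qed.

Section MkCC.
Variables (k : comPzRingType) (A B : gmod k) (d : int) (F : cochain A B).
Hypothesis F_ax : cochain_axiom d F.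

Definition mkphi l n j (w : seq (homog (Pi A))) : Pi B j :=
  if (size w == l) && (degs w == n) then F w j else 0.

Lemma mkphi_lin l n j w1 w2 i a (x y : Pi A i) :
  mkphi l n j (w1 ++ hel (a *: x + y) :: w2) =
    a *: mkphi l n j (w1 ++ hel x :: w2) + mkphi l n j (w1 ++ hel y :: w2).
Proof.
case: F_ax => _ _ F_lin.
rewrite /mkphi !(degs_hel w1 w2 _ x) !size_cat /=.
by case: ifP => _; [exact: F_lin | rewrite scaler0 addr0].
Qed.

Lemma mkphi_supp l n j w : ~~ ((size w == l) && (degs w == n)) -> mkphi l n j w = 0.
Proof. by rewrite /mkphi => /negPf->. Qed.

Program Definition mkCCl l : CCl l A B d :=
  @GHom k (tpow l (Pi A)) (Pi B) d (fun n j x => tlift (mkphi l n j) x) _ _.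
Next Obligation.
exact: (tlift_linear (@mkphi_lin l i j) (@mkphi_supp l i j)).
Qed.
Next Obligation.
rewrite /tlift /flift big1 // => p _; rewrite /mkphi.
case: F_ax => _ F_shape _.
case: ifP => [/andP[_ /eqP E]|_]; last by rewrite scaler0.
by rewrite F_shape ?E ?scaler0.
Qed.

Definition mkCC : CC A B d := fun l => mkCCl l.+1.

Lemma ev_mkCC s j : ev mkCC s j = F s j.
Proof.
case: s => [|x s]; first by case: F_ax.
rewrite /= /evl /= (tlift_tens (@mkphi_lin _ _ _) (@mkphi_supp _ _ _)).
by rewrite /mkphi /= !eqxx.
Qed.

End MkCC.

(* A homogeneous map Pi A -> Pi B as a cochain concentrated in tensor degree 1. *)
Definition strict_fun (k : comPzRingType) (A B : gmod k) (d : int)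
    (f : ghom (Pi A) (Pi B) d) : cochain A B :=
  fun s j => if s is [:: x] then f (projT1 x) j (projT2 x) else 0.

Lemma strict_axiom (k : comPzRingType) (A B : gmod k) (d : int)
  (f : ghom (Pi A) (Pi B) d) : cochain_axiom d (strict_fun f).
Proof.
split=> // [[|x [|y s]] j H|] //=.
  by rewrite ghom_shape //; rewrite /degs big_cons big_nil addr0 in H.
move=> [|u [|v s1]] [|w s2] i j a x y /=; rewrite ?scaler0 ?addr0 //.
exact: ghom_linear.
Qed.

Definition strict (k : comPzRingType) (A B : gmod k) (d : int)
    (f : ghom (Pi A) (Pi B) d) : CC A B d := mkCC (strict_axiom f).

Program Definition linear_part (k : comPzRingType) (A B : gmod k) (d : int)
    (f : CC A B d) : ghom (Pi A) (Pi B) d :=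
  @GHom k (Pi A) (Pi B) d (fun i j x => ev f [:: hel x] j) _ _.
Next Obligation. by case: (evP f) => _ _ L; apply: (L [::] [::]). Qed.
Next Obligation.
by case: (evP f) => _ S _; apply: (S [:: hel x] j); rewrite /degs big_cons big_nil addr0.
Qed.

Definition is_strict (k : comPzRingType) (A B : gmod k) (f : cochain A B) : Prop :=
  forall s j, (2 <= size s)%N -> f s j = 0.

Definition letter (k : comPzRingType) (A B : gmod k) (d : int) (f : cochain A B)
    (w : seq (homog (Pi A))) : homog (Pi B) := hel (f w (degs w + d)).

(* Gerstenhaber product mu o nu, with nu of degree d. *)
Definition gerst (k : comPzRingType) (A B : gmod k) (d : int)
    (mu : cochain A B) (nu : cochain A A) : cochain A B :=
  fun s j => let l := size s in
    \sum_(1 <= i < l.+1) \sum_(0 <= p < i)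
      ksign k (d * degs (take p s)) *:
        mu (take p s ++ letter d nu (take (l - i + 1)%N (drop p s))
              :: drop (p + (l - i + 1))%N s) j.

Definition composition (l : nat) (c : seq nat) : bool :=
  (0%N \notin c) && (sumn c == l).

(* The *-product nu * alpha; for a morphism nu this is also the composite of
   alpha followed by nu. *)
Definition star (k : comPzRingType) (A B C : gmod k)
    (nu : cochain B C) (alpha : cochain A B) : cochain A C :=
  fun s j => let l := size s in
    \sum_(1 <= i < l.+1) \sum_(c : i.-tuple 'I_l.+1 | composition l (map val c))
      nu [seq letter 0 alpha w | w <- reshape (map val c) s] j.

(* The homotopy *-product; moving r, of degree 1, past the first m blocks
   of the word gives the sign. *)
Definition hstar (k : comPzRingType) (A B : gmod k)
    (nu : cochain B B) (alpha beta r : cochain A B) : cochain A B :=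
  fun s j => let l := size s in
    \sum_(1 <= i < l.+1) \sum_(c : i.-tuple 'I_l.+1 | composition l (map val c))
      let ws := reshape (map val c) s in
      \sum_(0 <= m < i)
        ksign k (degs (flatten (take m ws))) *:
          nu (map (letter 0 alpha) (take m ws) ++ letter 1 r (nth [::] ws m)
                :: map (letter 0 beta) (drop m.+1 ws)) j.

Record ainf (k : comPzRingType) (A : gmod k) := AInf {
  ainf_nu :> CC A A (-1);
  ainf_sq0 : forall s j, gerst (-1) ainf_nu ainf_nu s j = 0 }.

Lemma linear_part_sq0 (k : comPzRingType) (A : gmod k) (nu : ainf A) i j l (x : Pi A i) :
  linear_part nu j l (linear_part nu i j x) = 0.
Proof.
have [->|Hj] := eqVneq j (i - 1); last first.
  by rewrite [linear_part nu i j x]ghom_shape // ghom0.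
have := ainf_sq0 nu [:: hel x] l.
rewrite /gerst big_nat1 big_nat1 /= /letter /= {1}/degs big_nil mulr0 scale1r.
rewrite /linear_part /=.
have -> : degs [:: hel x] = i by rewrite /degs big_cons big_nil addr0.
by [].
Qed.

(* The underlying complex (Pi A, nu^1). *)
Definition underlying (k : comPzRingType) (A : gmod k) (nu : ainf A) :
  differential (Pi A) := Differential (linear_part_sq0 nu).

Definition is_morphism (k : comPzRingType) (A B : gmod k)
    (nuA : ainf A) (nuB : ainf B) (alpha : CC A B 0) : Prop :=
  forall s j, star nuB alpha s j = gerst (-1) alpha nuA s j.

Definition is_homotopy (k : comPzRingType) (A B : gmod k)
    (nuA : ainf A) (nuB : ainf B) (alpha beta : cochain A B) (r : CC A B 1) : Prop :=
  forall s j, alpha s j - beta s j = hstar nuB alpha beta r s j + gerst (-1) r nuA s j.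

(* [1], an element of (Pi A)_1 = A_0. *)
Definition bar1 (k : comPzRingType) (A : gmod k) (one : A 0) : homog (Pi A) :=
  @hel k (Pi A) 1 one.

Definition reduced (k : comPzRingType) (A B : gmod k) (one : A 0) (f : cochain A B) :
  Prop := forall s1 s2 j, f (s1 ++ bar1 one :: s2) j = 0.

(* An element x of (Pi A)_n is [a] with |a| = n - 1. *)
Definition strictly_unital (k : comPzRingType) (A : gmod k) (one : A 0)
    (nu : cochain A A) : Prop :=
  (forall n (x : Pi A n), nu [:: bar1 one; hel x] n = x /\
     x = ksign k (n - 1) *: nu [:: hel x; bar1 one] n) /\
  (forall s1 s2 j, size (s1 ++ bar1 one :: s2) != 2%N ->
     nu (s1 ++ bar1 one :: s2) j = 0).

Definition strictly_unital_map (k : comPzRingType) (A B : gmod k)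
    (oneA : A 0) (oneB : B 0) (alpha : cochain A B) : Prop :=
  alpha [:: bar1 oneA] 1 = oneB /\
  (forall s1 s2 j, (2 <= size (s1 ++ bar1 oneA :: s2))%N ->
     alpha (s1 ++ bar1 oneA :: s2) j = 0).

Definition su_homotopic (k : comPzRingType) (A B : gmod k) (oneA : A 0)
    (nuA : ainf A) (nuB : ainf B) (alpha beta : cochain A B) : Prop :=
  exists r : CC A B 1, reduced oneA r /\ is_homotopy nuA nuB alpha beta r.

Definition su_homotopy_equivalent (k : comPzRingType) (A B : gmod k)
    (oneA : A 0) (oneB : B 0) (nuA : ainf A) (nuB : ainf B) : Prop :=
  exists (f : CC A B 0) (g : CC B A 0),
    [/\ is_morphism nuA nuB f /\ strictly_unital_map oneA oneB f,
        is_morphism nuB nuA g /\ strictly_unital_map oneB oneA g,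
        su_homotopic oneA nuA nuA (star g f) (strict (gid (Pi A)))
      & su_homotopic oneB nuB nuB (star f g) (strict (gid (Pi B)))].

(* The splitting A -> k, of degree 0, is determined by its component on A_0. *)
Record split_element (k : comPzRingType) (A : gmod k) := SplitElement {
  split_one :> A 0;
  split_free : injective (fun a : k => a *: split_one);
  split_map : {linear A 0 -> k^o};
  split_mapK : split_map split_one = 1 }.

Section BaseRing.
Variable k : comPzRingType.

Definition scal n : gk k n -> k :=
  match n return gk k n -> k with Posz 0 => fun a => a | _ => fun _ => 0 end.

Definition emb n : k -> gk k n :=
  match n return k -> gk k n with Posz 0 => fun a => a | _ => fun _ => 0 end.

Definition lscal (x : homog (Pi (gk k))) : k := @scal (projT1 x - 1) (projT2 x).

(* mu_su^2[x|y] = [xy] *)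
Definition mu_su_fun : cochain (gk k) (gk k) :=
  fun s j => if s is [:: x; y] then @emb (j - 1) (lscal x * lscal y) else 0.

Lemma scal_lin n a (x y : gk k n) : scal (a *: x + y) = a * scal x + scal y.
Proof. by case: n x y => [[|n]|n] x y //=; rewrite mulr0 addr0. Qed.

Lemma emb_lin n a (x y : k) : emb n (a * x + y) = a *: emb n x + emb n y.
Proof. by case: n => [[|n]|n] //=; rewrite scaler0 addr0. Qed.

Lemma emb0 n : emb n 0 = 0. Proof. by case: n => [[|n]|n]. Qed.

Lemma emb_shape n a : n != 0 -> emb n a = 0. Proof. by case: n => [[|n]|n]. Qed.

Lemma scal_shape n (x : gk k n) : n != 0 -> scal x = 0.
Proof. by case: n x => [[|n]|n]. Qed.

Lemma lscal_lin i a (x y : Pi (gk k) i) :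
  lscal (hel (a *: x + y)) = a * lscal (hel x) + lscal (hel y).
Proof. exact: scal_lin. Qed.

Lemma lscal_shape (x : homog (Pi (gk k))) : projT1 x != 1 -> lscal x = 0.
Proof. by move=> H; apply: scal_shape; rewrite subr_eq0. Qed.

Lemma mu_su_axiom : cochain_axiom (-1) mu_su_fun.
Proof.
split=> // [[|x [|y [|z s]]] j|] //=.
  have [xn1|/lscal_shape-> _] := eqVneq (projT1 x) 1; last by rewrite mul0r emb0.
  have [yn1|/lscal_shape-> _] := eqVneq (projT1 y) 1; last by rewrite mulr0 emb0.
  rewrite /degs !big_cons big_nil xn1 yn1 => H.
  by rewrite emb_shape // subr_eq0.
move=> [|u [|v [|w s1]]] [|w1 [|w2 s2]] i j a x y //=; rewrite ?scaler0 ?addr0 //.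
  by rewrite lscal_lin mulrDl -mulrA emb_lin.
by rewrite lscal_lin mulrDr mulrCA emb_lin.
Qed.

Definition mu_su_cc : CC (gk k) (gk k) (-1) := mkCC mu_su_axiom.

Lemma ev_mu_su : ev mu_su_cc = mu_su_fun.
Proof.
apply: funext => s; apply: functional_extensionality_dep => j; exact: ev_mkCC.
Qed.

Lemma mu_su_fun0 s j : size s != 2%N -> mu_su_fun s j = 0.
Proof. by case: s => [|x [|y [|z s]]]. Qed.

Lemma mu_su_fun_hel0 w1 w2 i j : mu_su_fun (w1 ++ hel (0 : Pi (gk k) i) :: w2) j = 0.
Proof.
case: mu_su_axiom => _ _ /(_ w1 w2 i j (-1) 0 0).
by rewrite scaler0 addr0 scaleN1r addNr.
Qed.

Lemma scal_emb n a : scal (emb n a) = if n == 0 then a else 0.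
Proof. by case: n => [[|n]|n]. Qed.

Lemma lscal_letter (x y : homog (Pi (gk k))) :
  lscal (letter (-1) mu_su_fun [:: x; y]) = lscal x * lscal y.
Proof.
have -> : lscal (letter (-1) mu_su_fun [:: x; y]) =
    scal (emb (degs [:: x; y] + -1 - 1) (lscal x * lscal y)) by [].
rewrite scal_emb.
have [xn1|/lscal_shape->] := eqVneq (projT1 x) 1; last by rewrite mul0r if_same.
have [yn1|/lscal_shape->] := eqVneq (projT1 y) 1; last by rewrite mulr0 if_same.
by rewrite /degs !big_cons big_nil xn1 yn1.
Qed.

Lemma mu_su_sq0 s j : gerst (-1) mu_su_cc mu_su_cc s j = 0.
Proof.
rewrite /gerst ev_mu_su; have [s3|sN3] := eqVneq (size s) 3; last first.
  rewrite big_nat big1 // => i /andP[i_gt0 i_le]; rewrite big_nat big1 // => p p_lt.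
  have [Ei|Ni] := eqVneq (size s - i + 1)%N 2%N.
    rewrite mu_su_fun0 ?scaler0 // size_cat /= size_take size_drop.
    case: ifP => _; lia.
  rewrite /letter [mu_su_fun (take _ (drop _ _)) _]mu_su_fun0.
    by rewrite mu_su_fun_hel0 scaler0.
  by rewrite size_takel // size_drop; lia.
case: s s3 => [|x [|y [|z [|t s]]]] //= _.
do ?[rewrite big_ltn; last by []|rewrite big_geq; last by []].
rewrite /= !scaler0 !add0r !addr0 !lscal_letter.
have [xn1|/lscal_shape->] := eqVneq (projT1 x) 1; last first.
  by rewrite !mul0r !emb0 !scaler0 addr0.
rewrite /degs big_nil big_cons big_nil xn1 mulr0 addr0 mulr1 /ksign /= expr0 expr1.
by rewrite scale1r scaleN1r mulrA subrr.
Qed.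

Definition mu_su : ainf (gk k) := AInf mu_su_sq0.
End BaseRing.

Definition augmented (k : comPzRingType) (B : gmod k) (oneB : B 0) (nuB : ainf B) :
  Prop :=
  exists eps : CC B (gk k) 0,
    is_morphism nuB (mu_su k) eps /\ strictly_unital_map oneB (1 : gk k 0) eps.

(* For f in CC^n(C, A)_d, the cochain nu_A^1 f - (-1)^|f| f o nu_C^1. *)
Definition CC_bnd (k : comPzRingType) (C A : gmod k) (d : int)
    (dC : differential (Pi C)) (dA : differential (Pi A)) (f : cochain C A) :
  cochain C A :=
  fun s j => dA (j + 1) j (f s (j + 1)) - ksign k d *: gerst (-1) f (strict dC) s j.

(* H_0(CC^n(C/k1, A)) = 0; CC^n(C/k1, A) is the subcomplex of CC^n(C, A) of the
   cochains that vanish whenever one of their arguments is [1]. *)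
Definition reduced_H0_vanishes (k : comPzRingType) (n : nat) (C A : gmod k)
    (oneC : C 0) (dC : differential (Pi C)) (dA : differential (Pi A)) : Prop :=
  forall f : CCl n C A 0, reduced oneC (evl f) ->
    (forall s j, CC_bnd 0 dC dA (evl f) s j = 0) ->
    exists2 g : CCl n C A 1, reduced oneC (evl g)
      & forall s j, CC_bnd 1 dC dA (evl g) s j = evl f s j.

(* q : (Pi A, dA) -> (Pi B, nu_B^1) is a surjective semiprojective resolution
   compatible with the units. *)
Definition split_resolution (k : comPzRingType) (A B : gmod k) (oneB : B 0)
    (nuB : ainf B) (u : split_element A) (dA : differential (Pi A))
    (q : ghom (Pi A) (Pi B) 0) : Prop :=
  [/\ semiprojective dA, quasi_iso dA (underlying nuB) q, surjective q,
      dA 1 0 (split_one u) = 0 & q 1 1 (split_one u) = oneB].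

(* nu_A extends dA, has split unit u, and q is a strict morphism to (B, nu_B). *)
Definition split_lift (k : comPzRingType) (A B : gmod k)
    (nuB : ainf B) (u : split_element A) (dA : differential (Pi A))
    (q : ghom (Pi A) (Pi B) 0) (nuA : ainf A) : Prop :=
  [/\ forall i j (x : Pi A i), linear_part nuA i j x = dA i j x,
      strictly_unital u nuA & is_morphism nuA nuB (strict q)].

Definition lifting_problem (k : comPzRingType) (A B C : gmod k)
    (oneA : A 0) (oneB : B 0) (u : split_element C)
    (nuA : ainf A) (nuB : ainf B) (nuC : ainf C)
    (q : CC A B 0) (alpha : CC C B 0) : Prop :=
  [/\ [/\ strictly_unital oneA nuA, strictly_unital oneB nuB & strictly_unital u nuC],
      [/\ is_morphism nuA nuB q, strictly_unital_map oneA oneB q & is_strict q],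
      is_morphism nuC nuB alpha /\ strictly_unital_map u oneB alpha,
      semiprojective (underlying nuC)
    & quasi_iso (underlying nuA) (underlying nuB) (linear_part q) /\
      surjective (linear_part q)] /\
  exists delta1 : ghom (Pi C) (Pi A) 0,
    [/\ chain_map (underlying nuC) (underlying nuA) delta1,
        delta1 1 1 (split_one u) = oneA
      & forall i (x : Pi C i),
          linear_part q i i (delta1 i i x) = linear_part alpha i i x].

Definition is_lift (k : comPzRingType) (A B C : gmod k)
    (oneA : A 0) (u : split_element C) (nuA : ainf A) (nuC : ainf C)
    (q : CC A B 0) (alpha : CC C B 0) (delta : CC C A 0) : Prop :=
  [/\ is_morphism nuC nuA delta, strictly_unital_map u oneA delta
    & forall s j, star q delta s j = ev alpha s j].

(* Main.v *)
From HB Require Import structures.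
From mathcomp Require Import all_boot all_order all_algebra.
From mathcomp Require Import boolp zify ring.
Require Import Defs.

Set Implicit Arguments.
Unset Strict Implicit.
Unset Printing Implicit Defensive.

Import GRing.Theory.
Local Open Scope ring_scope.

(** The bar construction enters by transposition. A coderivation, a morphism, and a
    coderivation along a pair of morphisms of tensor coalgebras act on functions of
    words by [coder nu], [comor alpha] and [bicoder alpha beta d r]. The values of
    these operators at a cochain are the Gerstenhaber product, the star product and
    the homotopy star product ([gerstE], [starE], [hstarE]). The identities of the
    bar construction become identities between operators, proved by induction on
    words: [coder_coder] for the square of a coderivation, [comor_comor] for
    composites, [comor_coder] for the commutator of a morphism with coderivations,
    [bicoder_coder] and [comor_sub] for homotopies.

    Existence of structures, morphisms and homotopies is then obstruction theory,
    by induction on the tensor degree. The obstruction is [nu o nu] for a structure,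
    [nu_A * delta - delta o nu_C] for a morphism [delta], and the difference of the
    two sides of the homotopy equation for a homotopy. If it vanishes below tensor
    degree n, the operator identities show that its component of degree n is a cycle
    of Hom((Pi C)^{(x) n}, Pi A) ([square_cycle], [defect_cycle], [homotopy_cycle]).
    Strict unitality makes it vanish on words through [1] ([coder_self_unitless],
    [defect_unitless], [homotopy_defect_unitless]), so that it is a cycle on the
    reduced tensor power. For structures and morphisms all choices are compatible with
    [q], so that it also has values in the kernel of [q].

    The reduced tensor powers of a semiprojective complex with split unit are
    semiprojective: [rmap_surjective_acyclic] says that Hom from them turns the
    surjective quasi-isomorphism [q] into a surjection with acyclic kernel. Hence the
    obstruction is the boundary of some [g] with q g = 0 ([correct_cochain]), and
    subtracting [g] removes it without changing lower components, unitality or the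
    composite with [q]. The corrected cochains converge ([cochain_limit]). This gives
    [lift_structure] and [lift_morphism]. For homotopies the kernel of [q] is
    available in tensor degree one only, and in higher degrees the vanishing of H_0
    takes its place ([lift_homotopy]).

    Two assertions follow formally. If B is augmented, then so is any structure on A
    for which [q] is a strict morphism, by composition with [q]. Two structures on A over the same [q] are related by
    lifts of [q] in both directions, whose composites are lifts of [q] as well as the
    identities, hence homotopic to them. *)

(** * Signs, words and multilinear functions *)

Lemma ksign_odd (k : comPzRingType) (n : int) : ksign k n = (-1) ^+ odd `|n|%N.
Proof. by rewrite signr_odd. Qed.

Lemma odd_abszD (m n : int) : odd (absz (m + n)) = odd `|m|%N (+) odd `|n|%N.
Proof. lia. Qed.

Lemma ksignD (k : comPzRingType) (m n : int) : ksign k (m + n) = ksign k m * ksign k n.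
Proof. by rewrite !ksign_odd odd_abszD signr_addb. Qed.

Lemma ksignN (k : comPzRingType) (m : int) : ksign k (- m) = ksign k m.
Proof. by rewrite /ksign abszN. Qed.

Lemma ksign0 (k : comPzRingType) : ksign k 0 = 1.
Proof. by []. Qed.

Lemma ksign1 (k : comPzRingType) : ksign k 1 = -1.
Proof. exact: expr1. Qed.

Lemma ksignMM (k : comPzRingType) (m : int) : ksign k m * ksign k m = 1.
Proof. by rewrite -ksignD ksign_odd odd_abszD addbb. Qed.

Section Linear.
Variable (k : comPzRingType).
Implicit Types (V W : lmodType k).

(** Linearity is a predicate on plain functions here, since most of the maps it is
    used for are unnamed, with a value of some letter as argument. *)
Definition lin V W (h : V -> W) := forall a x y, h (a *: x + y) = a *: h x + h y.

Lemma lin_add V W (h : V -> W) : lin h -> forall x y, h (x + y) = h x + h y.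
Proof. by move=> H x y; have := H 1 x y; rewrite !scale1r. Qed.

Lemma lin_zero V W (h : V -> W) : lin h -> h 0 = 0.
Proof. by move=> H; have := H (-1) 0 0; rewrite !scaleN1r !addNr. Qed.

Lemma lin_scale V W (h : V -> W) : lin h -> forall a x, h (a *: x) = a *: h x.
Proof. by move=> H a x; have := H a x 0; rewrite (lin_zero H) !addr0. Qed.

Lemma lin_sub V W (h : V -> W) : lin h -> forall x y, h (x - y) = h x - h y.
Proof. by move=> H x y; rewrite addrC -scaleN1r H scaleN1r addrC. Qed.

End Linear.

Notation word A := (seq (homog (Pi A))).

Section Words.
Variables (k : comPzRingType) (A : gmod k).

(** Multilinearity is tested on triples of words that differ in one letter, given
    as a relation: it is stable under adding letters, and statements about it are
    proved by induction on the relation, with no position to carry along. *)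
Inductive lin3 (a : k) : word A -> word A -> word A -> Prop :=
| lin3_head i (x y : Pi A i) s :
    lin3 a (hel (a *: x + y) :: s) (hel x :: s) (hel y :: s)
| lin3_tail z u v w : lin3 a u v w -> lin3 a (z :: u) (z :: v) (z :: w).

Lemma degs_nil (M : gmod k) : degs ([::] : seq (homog M)) = 0.
Proof. exact: big_nil. Qed.

Lemma degs1 (M : gmod k) (x : homog M) : degs [:: x] = projT1 x.
Proof. by rewrite degs_cons degs_nil addr0. Qed.

Lemma lin3_size a u v w : lin3 a u v w -> size v = size u /\ size w = size u.
Proof. by elim=> // z u' v' w' _ /= [-> ->]. Qed.

Lemma lin3_degs a u v w : lin3 a u v w -> degs v = degs u /\ degs w = degs u.
Proof.
by elim=> [i x y s|z u' v' w' _ [E E']]; rewrite !degs_cons // E E'.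
Qed.

Lemma lin3_cat a s1 i (x y : Pi A i) s2 :
  lin3 a (s1 ++ hel (a *: x + y) :: s2) (s1 ++ hel x :: s2) (s1 ++ hel y :: s2).
Proof. by elim: s1 => [|z s1 IH] /=; constructor. Qed.

Lemma lin3_inv a u v w : lin3 a u v w -> exists s1 i (x y : Pi A i) s2,
  [/\ u = s1 ++ hel (a *: x + y) :: s2, v = s1 ++ hel x :: s2 & w = s1 ++ hel y :: s2].
Proof.
elim=> [i x y s|z u' v' w' _ [s1 [i [x [y [s2 [-> -> ->]]]]]]].
  by exists [::], i, x, y, s.
by exists (z :: s1), i, x, y, s2.
Qed.

Definition mlin (V : lmodType k) (phi : word A -> V) :=
  forall a u v w, lin3 a u v w -> phi u = a *: phi v + phi w.

Lemma mlin_head (V : lmodType k) (phi : word A -> V) i t :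
  mlin phi -> lin (fun x : Pi A i => phi (hel x :: t)).
Proof. by move=> H a x y; apply: H; constructor. Qed.

Lemma mlin_tail (V : lmodType k) (phi : word A -> V) z :
  mlin phi -> mlin (fun t => phi (z :: t)).
Proof. by move=> H a u v w E; apply: H; constructor. Qed.

Lemma mlin_lin (V W : lmodType k) (h : V -> W) (phi : word A -> V) :
  lin h -> mlin phi -> mlin (fun s => h (phi s)).
Proof. by move=> Hh H a u v w E; rewrite (H _ _ _ _ E) Hh. Qed.

Lemma mlin0 (V : lmodType k) (phi : word A -> V) s1 i s2 :
  mlin phi -> phi (s1 ++ hel (0 : Pi A i) :: s2) = 0.
Proof.
move=> H; have := H _ _ _ _ (lin3_cat (-1) s1 (0 : Pi A i) 0 s2).
by rewrite scaler0 addr0 scaleN1r addNr.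
Qed.

Lemma mlin_comb (V : lmodType k) b (phi psi : word A -> V) :
  mlin phi -> mlin psi -> mlin (fun s => b *: phi s + psi s).
Proof.
move=> H H' a u v w E; rewrite (H _ _ _ _ E) (H' _ _ _ _ E).
by rewrite !scalerDr addrACA !scalerA mulrC.
Qed.

End Words.

(** * Sums over the factorizations of a word *)

Section Cut.
Variables (k : comPzRingType) (T : Type).
Implicit Types (V W : lmodType k) (s : seq T).

(** The transpose of deconcatenation. It is defined by recursion on the word so that
    the coalgebra identities below are inductions on words. *)
Fixpoint cut V (psi : seq T -> seq T -> V) s : V :=
  if s is x :: t then psi [::] s + cut (fun a b => psi (x :: a) b) t else psi [::] [::].

Definition cut1 V (psi : seq T -> seq T -> V) s : V :=
  if s is x :: t then cut (fun a b => psi (x :: a) b) t else 0.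

Lemma cutE V (psi : seq T -> seq T -> V) s : cut psi s = psi [::] s + cut1 psi s.
Proof. by case: s => //=; rewrite addr0. Qed.

Lemma eq_cut V (psi psi' : seq T -> seq T -> V) s :
  (forall a b, a ++ b = s -> psi a b = psi' a b) -> cut psi s = cut psi' s.
Proof.
elim: s psi psi' => [|x t IH] psi psi' H /=; first exact: H.
by rewrite H //; congr (_ + _); apply: IH => a b E; apply: H; rewrite /= E.
Qed.

Lemma eq_cut1 V (psi psi' : seq T -> seq T -> V) s :
  (forall a b, a ++ b = s -> a <> [::] -> psi a b = psi' a b) ->
  cut1 psi s = cut1 psi' s.
Proof.
by case: s => // x t H; apply: eq_cut => a b E; apply: H => //=; rewrite E.
Qed.

Lemma cut_push V W (h : V -> W) (psi : seq T -> seq T -> V) s :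
  lin h -> h (cut psi s) = cut (fun a b => h (psi a b)) s.
Proof.
by move=> H; elim: s psi => //= x t IH psi; rewrite (lin_add H) IH.
Qed.

Lemma cut_comb V c (psi psi' : seq T -> seq T -> V) s :
  cut (fun a b => c *: psi a b + psi' a b) s = c *: cut psi s + cut psi' s.
Proof.
by elim: s psi psi' => //= x t IH psi psi'; rewrite IH scalerDr addrACA.
Qed.

Lemma cutD V (psi psi' : seq T -> seq T -> V) s :
  cut (fun a b => psi a b + psi' a b) s = cut psi s + cut psi' s.
Proof.
rewrite -[cut psi s]scale1r -cut_comb.
by apply: eq_cut => a b _; rewrite scale1r.
Qed.

Lemma cut1D V (psi psi' : seq T -> seq T -> V) s :
  cut1 (fun a b => psi a b + psi' a b) s = cut1 psi s + cut1 psi' s.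
Proof. by case: s => [|x t]; rewrite /= ?addr0 // cutD. Qed.

Lemma cut_eq0 V (psi : seq T -> seq T -> V) s :
  (forall a b, a ++ b = s -> psi a b = 0) -> cut psi s = 0.
Proof.
elim: s psi => [|x t IH] psi H /=; first exact: H.
by rewrite H // add0r; apply: IH => a b E; apply: H; rewrite /= E.
Qed.

Lemma cutZ V c (psi : seq T -> seq T -> V) s :
  cut (fun a b => c *: psi a b) s = c *: cut psi s.
Proof. by rewrite cut_push // => a x y; rewrite scalerDr !scalerA mulrC. Qed.

Lemma cut_last V (psi : seq T -> seq T -> V) s :
  (forall a b, a ++ b = s -> b <> [::] -> psi a b = 0) -> cut psi s = psi s [::].
Proof.
elim: s psi => //= x t IH psi H; rewrite H // add0r IH // => a b E.
by apply: H; rewrite /= E.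
Qed.

Lemma cut_first V (psi : seq T -> seq T -> V) s :
  (forall a b, a ++ b = s -> a <> [::] -> psi a b = 0) -> cut psi s = psi [::] s.
Proof.
case: s => //= x t H; rewrite cut_eq0 ?addr0 // => a b E.
by apply: H; rewrite /= ?E.
Qed.

(** Coassociativity of deconcatenation. *)
Lemma cutA V (psi : seq T -> seq T -> seq T -> V) s :
  cut (fun a c => cut (fun a' b => psi a' b c) a) s =
  cut (fun a t => cut (fun b c => psi a b c) t) s.
Proof.
elim: s psi => //= x t IH psi.
by rewrite cutD IH addrA.
Qed.

Lemma cut_cat V (psi : seq T -> seq T -> V) s1 z s2 :
  cut psi (s1 ++ z :: s2) =
    cut (fun a b => psi a (b ++ z :: s2)) s1 + cut (fun a b => psi (s1 ++ z :: a) b) s2.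
Proof. by elim: s1 psi => //= x s1 IH psi; rewrite IH addrA. Qed.

Lemma cut_sum V (psi : seq T -> seq T -> V) s :
  cut psi s = \sum_(0 <= h < (size s).+1) psi (take h s) (drop h s).
Proof.
elim: s psi => [|x t IH] psi /=; first by rewrite big_nat1.
by rewrite big_nat_recl // IH.
Qed.

Lemma sum_cut V n (psi : nat -> seq T -> seq T -> V) s :
  \sum_(0 <= i < n) cut (psi i) s = cut (fun a b => \sum_(0 <= i < n) psi i a b) s.
Proof.
elim: n => [|n IH]; first by rewrite big_geq // cut_eq0 // => a b _; rewrite big_geq.
rewrite big_nat_recr //= IH -cutD.
by apply: eq_cut => a b _; rewrite big_nat_recr.
Qed.

End Cut.
Arguments cut_push {k T V W h psi s}.

Lemma cut_lin3 (k : comPzRingType) (A : gmod k) (V : lmodType k)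
    (psi : word A -> word A -> V) a u v w :
  lin3 a u v w ->
  (forall p p' p'' q, lin3 a p p' p'' -> psi p q = a *: psi p' q + psi p'' q) ->
  (forall p q q' q'', lin3 a q q' q'' -> (size q <= size u)%N ->
     psi p q = a *: psi p q' + psi p q'') ->
  cut psi u = a *: cut psi v + cut psi w.
Proof.
move=> E; elim: E psi => [i x y s|z u' v' w' E IH] psi Hl Hr /=.
  rewrite (Hr [::] _ _ _ (lin3_head a x y s)) // scalerDr addrACA; congr (_ + _).
  rewrite -cut_comb; apply: eq_cut => p q _.
  exact: (Hl _ _ _ q (lin3_head a x y p)).
rewrite (Hr [::] _ _ _ (lin3_tail z E)) // IH 1?scalerDr 1?addrACA //.
  by move=> p p' p'' q E1; exact: (Hl _ _ _ q (lin3_tail z E1)).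
by move=> p q q' q'' E1 Hq; apply: Hr => //=; apply: leqW.
Qed.

(** * Letters *)

Section Letters.
Variables (k : comPzRingType) (A B : gmod k).

(** The degree of a letter is only known up to an equality of integers; the index
    [e] absorbs the transport. *)
Lemma letterE d (f : cochain A B) w e :
  degs w + d = e -> letter d f w = hel (f w e).
Proof. by move<-. Qed.
Arguments letterE {d f w} e.

Variables (d : int) (f : cochain A B).
Hypothesis f_ax : cochain_axiom d f.

Lemma cochain_nil j : f [::] j = 0.
Proof. by case: f_ax. Qed.

Lemma cochain_shape s j : j != degs s + d -> f s j = 0.
Proof. by case: f_ax => _ H _; apply: H. Qed.

Lemma cochain_mlin j : mlin (f ^~ j).
Proof.
by case: f_ax => _ _ H a u v w /lin3_inv[s1 [i [x [y [s2 [-> -> ->]]]]]].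
Qed.

Lemma lin3_letter a u v w e t : lin3 a u v w ->
  lin3 a (letter e f u :: t) (letter e f v :: t) (letter e f w :: t).
Proof.
move=> E; have [Ev Ew] := lin3_degs E.
rewrite (letterE _ (erefl (degs u + e))).
rewrite (letterE (w := v) (degs u + e)) ?Ev // (letterE (w := w) (degs u + e)) ?Ew //.
have -> : f u (degs u + e) = a *: f v (degs u + e) + f w (degs u + e).
  exact: cochain_mlin E.
exact: lin3_head.
Qed.

Lemma mlin_letter (V : lmodType k) e (phi : word B -> V) t :
  mlin phi -> mlin (fun s => phi (letter e f s :: t)).
Proof. by move=> H a u v w E; apply: H; apply: lin3_letter. Qed.

Lemma letter_eq0 (V : lmodType k) (phi : word B -> V) e w s1 s2 :
  mlin phi -> (forall j, f w j = 0) -> phi (s1 ++ letter e f w :: s2) = 0.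
Proof. by move=> H H0; rewrite /letter H0 mlin0. Qed.

End Letters.
Arguments letterE {k A B d f w} e.
Arguments letter_eq0 {k A B f V phi e w} s1 {s2}.

Lemma cochain_axiomP (k : comPzRingType) (A B : gmod k) d (f : cochain A B) :
  (forall j, f [::] j = 0) -> (forall s j, j != degs s + d -> f s j = 0) ->
  (forall j, mlin (f ^~ j)) -> cochain_axiom d f.
Proof.
by move=> H H' M; split=> // s1 s2 i j a x y; apply: M; apply: lin3_cat.
Qed.

Lemma cochain_comb (k : comPzRingType) (A B : gmod k) d (f g : cochain A B) c :
  cochain_axiom d f -> cochain_axiom d g ->
  cochain_axiom d (fun s j => c *: f s j + g s j).
Proof.
move=> F G; apply: cochain_axiomP => [j|s j H|j].
- by rewrite (cochain_nil F) (cochain_nil G) scaler0 addr0.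
- by rewrite (cochain_shape F) // (cochain_shape G) // scaler0 addr0.
- by apply: mlin_comb; [apply: cochain_mlin F _|apply: cochain_mlin G _].
Qed.

(** * Coderivations *)

Section Coder.
Variables (k : comPzRingType) (A : gmod k) (d : int) (nu : cochain A A).

(** The transpose of the coderivation of the tensor coalgebra with corestriction
    [nu], acting on functions of words: the recursion separates the terms in which
    [nu] is applied at the first letter. *)
Fixpoint coder (V : lmodType k) (phi : word A -> V) (s : word A) {struct s} : V :=
  if s is x :: t then
    cut (fun b c => phi (letter d nu (x :: b) :: c)) t
    + ksign k (d * projT1 x) *: coder (fun w => phi (x :: w)) t
  else 0.

Lemma eq_coder (V : lmodType k) (phi phi' : word A -> V) s :
  (forall w, (0 < size w <= size s)%N -> degs w = degs s + d -> phi w = phi' w) ->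
  coder phi s = coder phi' s.
Proof.
elim: s phi phi' => //= x t IH phi phi' H; congr (_ + _ *: _).
  apply: eq_cut => b c E; apply: H; first by rewrite -E /= size_cat; lia.
  by rewrite -E !degs_cons degs_cat /= degs_cons; lia.
apply: IH => w Hw E; apply: H; first by move: Hw => /=; lia.
by rewrite !degs_cons E addrA.
Qed.

Lemma coder_push (V W : lmodType k) (h : V -> W) (phi : word A -> V) s :
  lin h -> h (coder phi s) = coder (fun w => h (phi w)) s.
Proof.
move=> Hh; elim: s phi => [|x t IH] phi /=; first exact: lin_zero.
by rewrite (lin_add Hh) cut_push // (lin_scale Hh) IH.
Qed.

Lemma coder_comb (V : lmodType k) c (phi psi : word A -> V) s :
  coder (fun w => c *: phi w + psi w) s = c *: coder phi s + coder psi s.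
Proof.
elim: s phi psi => [|x t IH] phi psi /=; first by rewrite scaler0 addr0.
rewrite cut_comb IH !scalerDr !scalerA [_ * c]mulrC -!scalerA.
by rewrite addrACA.
Qed.

Lemma coderD (V : lmodType k) (phi psi : word A -> V) s :
  coder (fun w => phi w + psi w) s = coder phi s + coder psi s.
Proof.
rewrite -[coder phi s]scale1r -coder_comb; apply: eq_coder => w _ _.
by rewrite scale1r.
Qed.

Lemma coderZ (V : lmodType k) c (phi : word A -> V) s :
  coder (fun w => c *: phi w) s = c *: coder phi s.
Proof. by rewrite coder_push // => a x y; rewrite scalerDr !scalerA mulrC. Qed.

Lemma coder_eq0 (V : lmodType k) (phi : word A -> V) s :
  (forall w, (0 < size w <= size s)%N -> degs w = degs s + d -> phi w = 0) ->
  coder phi s = 0.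
Proof.
move=> H; rewrite (eq_coder (phi' := fun w => 0 *: phi w)).
  by rewrite coderZ scale0r.
by move=> w Hw E; rewrite scale0r H.
Qed.

(** The coderivation property: deconcatenation intertwines the extension of
    [nu] with the sum of its actions on the two tensor factors. *)
Lemma coder_cut (V : lmodType k) (psi : word A -> word A -> V) s :
  coder (cut psi) s =
    cut (fun a b => coder (psi ^~ b) a + ksign k (d * degs a) *: coder (psi a) b) s.
Proof.
elim: s psi => [|x t IH] psi; first by rewrite /= scaler0 addr0.
have -> : coder (cut psi) (x :: t) = coder (psi [::]) (x :: t) +
    (cut (fun b c => cut (fun a' b' => psi (letter d nu (x :: b) :: a') b') c) t +
     ksign k (d * projT1 x) *: coder (cut (fun a b => psi (x :: a) b)) t).
  by rewrite /= cutD coderD scalerDr addrACA.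
rewrite IH -cutA -cutZ -cutD /= -/(coder _ (x :: t)).
rewrite add0r degs_nil mulr0 ksign0 scale1r; congr (_ + _).
apply: eq_cut => a b _; rewrite degs_cons mulrDr ksignD -scalerA.
by rewrite scalerDr addrA.
Qed.

Lemma coder_of_cut1 (V : lmodType k) (psi : word A -> word A -> V) s :
  coder (cut1 psi) s =
    cut1 (fun a b => coder (psi ^~ b) a + ksign k (d * degs a) *: coder (psi a) b) s.
Proof.
apply: (addrI (coder (psi [::]) s)); rewrite -coderD.
rewrite (eq_coder (phi' := cut psi)); last by move=> w _ _; rewrite cutE.
rewrite coder_cut cutE; congr (_ + _).
by rewrite /= add0r degs_nil mulr0 ksign0 scale1r.
Qed.

Hypothesis nu_ax : cochain_axiom d nu.

Lemma mlin_coder (V : lmodType k) (phi : word A -> V) :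
  mlin phi -> mlin (coder phi).
Proof.
move=> Hphi a u v w E; elim: E phi Hphi => [i x y s|z u' v' w' E IH] phi Hphi /=.
  rewrite scalerDr addrACA; congr (_ + _).
    rewrite -cut_comb; apply: eq_cut => b c _.
    exact: (mlin_letter nu_ax d c Hphi (lin3_head a x y b)).
  rewrite !scalerA [a * _]mulrC -scalerA -scalerDr -coder_comb; congr (_ *: _).
  by apply: eq_coder => t _ _; apply: Hphi; constructor.
rewrite IH; last exact: mlin_tail.
rewrite !scalerDr addrACA !scalerA [a * _]mulrC; congr (_ + _).
apply: (cut_lin3 E) => [p p' p'' q E'|p q q' q'' E' _].
  exact: (mlin_letter nu_ax d q Hphi (lin3_tail z E')).
by apply: Hphi; constructor.
Qed.

Lemma coder_shape (B : gmod k) (f : cochain A B) s j e :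
  cochain_axiom e f -> j != degs s + d + e -> coder (f ^~ j) s = 0.
Proof.
move=> f_ax Hj; apply: coder_eq0 => w _ E; apply: (cochain_shape f_ax).
by rewrite E.
Qed.

End Coder.
Arguments coder_shape {k A d nu B f s j e}.
Arguments eq_coder {k A d nu V phi} phi' {s}.
Arguments coder_push {k A d nu V W h phi s}.

Lemma coder_cons (k : comPzRingType) (A : gmod k) d (nu : cochain A A)
    (V : lmodType k) (phi : word A -> V) x t :
  coder d nu phi (x :: t) =
    cut (fun b c => phi (letter d nu (x :: b) :: c)) t
    + ksign k (d * projT1 x) *: coder d nu (fun w => phi (x :: w)) t.
Proof. by []. Qed.

Lemma ksignN1 (k : comPzRingType) m : ksign k (-1 * m) = ksign k m.
Proof. by rewrite mulN1r ksignN. Qed.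

(** The square of an odd coderivation is a coderivation, hence the extension of
    its corestriction, which is the composite of [nu] with itself. *)
Lemma coder_coder (k : comPzRingType) (A : gmod k) (nu : cochain A A)
    (nu_ax : cochain_axiom (-1) nu) (V : lmodType k) (phi : word A -> V) s :
  mlin phi ->
  coder (-1) nu (coder (-1) nu phi) s =
  coder (-2) (fun w j => coder (-1) nu (nu ^~ j) w) phi s.
Proof.
elim: s phi => // x t IH phi Hphi.
rewrite !coder_cons.
have -> : coder (-1) nu (fun w => coder (-1) nu phi (x :: w)) t =
    cut (fun b c => coder (-1) nu (fun b' => phi (letter (-1) nu (x :: b') :: c)) b +
      ksign k (degs b) *: coder (-1) nu (fun w => phi (letter (-1) nu (x :: b) :: w)) c) t
    + ksign k (projT1 x) *: coder (-1) nu (coder (-1) nu (fun w => phi (x :: w))) t.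
  rewrite (eq_coder (fun w => cut (fun b c =>
      phi (letter (-1) nu (x :: b) :: c)) w +
      ksign k (projT1 x) *: coder (-1) nu (fun w' => phi (x :: w')) w)).
    rewrite coderD coderZ coder_cut; congr (_ + _).
    by apply: eq_cut => b c _; rewrite ksignN1.
  by move=> w _ _; rewrite coder_cons ksignN1.
rewrite IH; last exact: mlin_tail.
rewrite ksignN1 scalerDr scalerA ksignMM scale1r.
have -> : ksign k (-2 * projT1 x) = 1.
  by rewrite (_ : -2 * projT1 x = - (projT1 x + projT1 x)) ?ksignN ?ksignD ?ksignMM //; ring.
rewrite scale1r addrA; congr (_ + _).
rewrite -cutZ -cutD.
(* two copies of [nu] on disjoint blocks come in both orders, with opposite signs *)
rewrite (eq_cut (psi' := fun b c =>
   cut (fun e f => phi (letter (-1) nu (letter (-1) nu (x :: b) :: e) :: f)) c +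
   ksign k (projT1 x) *:
     coder (-1) nu (fun b' => phi (letter (-1) nu (x :: b') :: c)) b)); last first.
  move=> b c _; rewrite coder_cons scalerDr scalerA -ksignD ksignN1 /= degs_cons.
  by rewrite ksignD [ksign k (-1)]ksignN ksign1 mulrN1 scaleNr addrACA addNr addr0.
rewrite cutD -cutA -cutD; apply: eq_cut => a f _.
rewrite (letterE (degs (x :: a) - 2)) //.
have Hl := mlin_head f Hphi.
rewrite coder_cons (lin_add (Hl _)) (lin_scale (Hl _)) (cut_push (Hl _)).
rewrite (coder_push (Hl _)) ksignN1; congr (_ + _ *: _).
  apply: eq_cut => b e E; congr (phi (_ :: _)); apply: letterE.
  by rewrite -E !degs_cons degs_cat /= degs_cons; lia.
apply: eq_coder => w _ E; congr (phi (_ :: _)); apply: letterE.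
by rewrite !degs_cons E; lia.
Qed.

(** * Sums over the decompositions of a word into blocks *)

Section Parts.
Variables (k : comPzRingType) (T : Type).
Implicit Types (V W : lmodType k) (s : seq T).

(** The number [n] bounds the number of blocks; by [parts_rec_enough], the length
    of the word always suffices. *)
Fixpoint parts_rec V n (Psi : seq (seq T) -> V) s : V :=
  if s is [::] then Psi [::]
  else if n is n'.+1 then cut1 (fun a b => parts_rec n' (fun bs => Psi (a :: bs)) b) s
  else 0.

Definition parts V (Psi : seq (seq T) -> V) s : V := parts_rec (size s) Psi s.

Lemma parts_rec_enough V m n (Psi : seq (seq T) -> V) s :
  (size s <= m)%N -> (size s <= n)%N -> parts_rec m Psi s = parts_rec n Psi s.
Proof.
elim: m n Psi s => [|m IH] [|n] Psi [|x t] //= Hm Hn.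
by apply: eq_cut => a b E; apply: IH; rewrite -E size_cat in Hm Hn; lia.
Qed.

Lemma parts_nil V (Psi : seq (seq T) -> V) : parts Psi [::] = Psi [::].
Proof. by []. Qed.

Lemma parts_cons V (Psi : seq (seq T) -> V) x t :
  parts Psi (x :: t) = cut (fun a b => parts (fun bs => Psi ((x :: a) :: bs)) b) t.
Proof.
rewrite /parts /=; apply: eq_cut => a b E.
by apply: parts_rec_enough; rewrite // -E size_cat leq_addl.
Qed.

Lemma parts_cut1 V (Psi : seq (seq T) -> V) s :
  s <> [::] -> parts Psi s = cut1 (fun a b => parts (fun bs => Psi (a :: bs)) b) s.
Proof. by case: s => // x t _; rewrite parts_cons. Qed.

Definition nonempty_blocks (bs : seq (seq T)) := all (fun b => 0 < size b)%N bs.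

Lemma eq_parts V (Psi Psi' : seq (seq T) -> V) s :
  (forall bs, flatten bs = s -> nonempty_blocks bs -> Psi bs = Psi' bs) ->
  parts Psi s = parts Psi' s.
Proof.
have [n] := ubnP (size s); elim: n s Psi Psi' => // n IH [|x t] Psi Psi' Hn H.
  by rewrite !parts_nil H.
rewrite !parts_cons; apply: eq_cut => a b E; apply: IH.
  by move: Hn; rewrite /= -E size_cat; lia.
by move=> bs E' Hb; apply: H => //=; rewrite E' E.
Qed.

Lemma parts_push V W (h : V -> W) (Psi : seq (seq T) -> V) s :
  lin h -> h (parts Psi s) = parts (fun bs => h (Psi bs)) s.
Proof.
move=> Hh; have [n] := ubnP (size s); elim: n s Psi => // n IH [|x t] Psi Hn //.
rewrite !parts_cons cut_push //; apply: eq_cut => a b E; apply: IH.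
by move: Hn; rewrite /= -E size_cat; lia.
Qed.

Lemma parts_comb V c (Psi Psi' : seq (seq T) -> V) s :
  parts (fun bs => c *: Psi bs + Psi' bs) s = c *: parts Psi s + parts Psi' s.
Proof.
have [n] := ubnP (size s); elim: n s Psi Psi' => // n IH [|x t] Psi Psi' Hn //.
rewrite !parts_cons -cut_comb; apply: eq_cut => a b E; apply: IH.
by move: Hn; rewrite /= -E size_cat; lia.
Qed.

End Parts.
Arguments eq_parts {k T V Psi} Psi' {s}.
Arguments parts_push {k T V W h Psi s}.

Lemma size_flatten_blocks (T : Type) (bs : seq (seq T)) :
  nonempty_blocks bs -> (size bs <= size (flatten bs))%N.
Proof. by elim: bs => //= b bs IH /andP[Hb /IH]; rewrite size_cat; lia. Qed.

(** * Morphisms of tensor coalgebras *)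

Section Comor.
Variables (k : comPzRingType) (A B : gmod k) (alpha : cochain A B).
Implicit Types (V W : lmodType k) (s : word A).

(** The transpose of the morphism of tensor coalgebras with corestriction [alpha]. *)
Definition comor V (phi : word B -> V) s : V :=
  parts (fun bs => phi (map (letter 0 alpha) bs)) s.

Lemma comor_nil V (phi : word B -> V) : comor phi [::] = phi [::].
Proof. by []. Qed.

Lemma comor_cons V (phi : word B -> V) x t :
  comor phi (x :: t) = cut (fun a b => comor (fun w => phi (letter 0 alpha (x :: a) :: w)) b) t.
Proof. exact: parts_cons. Qed.

Lemma comor_cut1 V (phi : word B -> V) s : s <> [::] ->
  comor phi s = cut1 (fun a b => comor (fun w => phi (letter 0 alpha a :: w)) b) s.
Proof. exact: parts_cut1. Qed.

Lemma degs_letters bs : degs (map (letter 0 alpha) bs) = degs (flatten bs).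
Proof.
by elim: bs => [|b bs IH] /=; rewrite ?degs_nil // degs_cons degs_cat IH /= addr0.
Qed.

Lemma eq_comor V (phi phi' : word B -> V) s :
  (forall w, (size w <= size s)%N -> (s <> [::] -> w <> [::]) -> degs w = degs s ->
     phi w = phi' w) ->
  comor phi s = comor phi' s.
Proof.
move=> H; apply: eq_parts => bs E Hb; apply: H.
- by rewrite size_map -E size_flatten_blocks.
- by rewrite -E; case: bs {E Hb}.
- by rewrite degs_letters E.
Qed.

Lemma comor_push V W (h : V -> W) (phi : word B -> V) s :
  lin h -> h (comor phi s) = comor (fun w => h (phi w)) s.
Proof. exact: parts_push. Qed.

Lemma comor_comb V c (phi psi : word B -> V) s :
  comor (fun w => c *: phi w + psi w) s = c *: comor phi s + comor psi s.
Proof. exact: parts_comb. Qed.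

Lemma comorD V (phi psi : word B -> V) s :
  comor (fun w => phi w + psi w) s = comor phi s + comor psi s.
Proof.
rewrite -[comor phi s]scale1r -comor_comb; apply: eq_comor => w _ _ _.
by rewrite scale1r.
Qed.

Lemma comorZ V c (phi : word B -> V) s : comor (fun w => c *: phi w) s = c *: comor phi s.
Proof. by rewrite comor_push // => a x y; rewrite scalerDr !scalerA mulrC. Qed.

Lemma lin_comor V W (f : W -> word B -> V) s :
  (forall w, lin (f ^~ w)) -> lin (fun y => comor (f y) s).
Proof. by move=> H c y z; rewrite -comor_comb; apply: eq_comor => w _ _ _; apply: H. Qed.

Lemma comor_eq0 V (phi : word B -> V) s :
  (forall w, (size w <= size s)%N -> (s <> [::] -> w <> [::]) -> degs w = degs s ->
     phi w = 0) ->
  comor phi s = 0.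
Proof.
move=> H; rewrite (@eq_comor _ _ (fun w => 0 *: phi w)).
  by rewrite comorZ scale0r.
by move=> w H1 H2 E; rewrite scale0r H.
Qed.

(** Compatibility with deconcatenation, the defining property of a coalgebra
    morphism. *)
Lemma comor_cut V (psi : word B -> word B -> V) s :
  comor (cut psi) s = cut (fun a b => comor (fun a' => comor (psi a') b) a) s.
Proof.
have [n] := ubnP (size s); elim: n s psi => // n IH [|x t] psi Hn //.
rewrite comor_cons [RHS]/=.
rewrite (eq_cut (psi' := fun a b =>
    comor (fun w => psi [::] (letter 0 alpha (x :: a) :: w)) b +
    cut (fun c e => comor (fun c' => comor (psi (letter 0 alpha (x :: a) :: c')) e) c) b)).
  rewrite cutD -comor_cons -cutA; congr (_ + _).
  by apply: eq_cut => a b _; rewrite comor_cons.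
move=> a b E; rewrite -IH -?comorD //.
by move: Hn; rewrite /= -E size_cat; lia.
Qed.

Lemma comor_of_cut1 V (psi : word B -> word B -> V) s :
  comor (cut1 psi) s = cut1 (fun a b => comor (fun a' => comor (psi a') b) a) s.
Proof.
apply: (addrI (comor (psi [::]) s)); rewrite -comorD.
rewrite (@eq_comor _ _ (cut psi)); last by move=> w _ _ _; rewrite cutE.
by rewrite comor_cut cutE.
Qed.

Hypothesis alpha_ax : cochain_axiom 0 alpha.

Lemma mlin_comor V (phi : word B -> V) : mlin phi -> mlin (comor phi).
Proof.
move=> Hphi a u v w E; have [n] := ubnP (size u).
elim: n phi Hphi u v w E => // n IH phi Hphi _ _ _ [i x y s|z u v w E] Hn.
  rewrite !comor_cons -cut_comb; apply: eq_cut => b c _; rewrite -comor_comb.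
  apply: eq_comor => t _ _ _.
  exact: (mlin_letter alpha_ax 0 t Hphi (lin3_head a x y b)).
rewrite !comor_cons; apply: (cut_lin3 E) => [p p' p'' q E'|p q q' q'' E' Hq].
  rewrite -comor_comb; apply: eq_comor => t _ _ _.
  exact: (mlin_letter alpha_ax 0 t Hphi (lin3_tail z E')).
by apply: IH E' _; [apply: mlin_tail | apply: leq_ltn_trans Hq Hn].
Qed.

End Comor.
Arguments eq_comor {k A B alpha V phi} phi' {s}.
Arguments comor_push {k A B alpha V W h phi s}.

(** A composite of coalgebra morphisms is determined by its corestriction, the
    star product. *)
Lemma comor_comor (k : comPzRingType) (A B C : gmod k) (alpha : cochain A B)
    (beta : cochain B C) (alpha_ax : cochain_axiom 0 alpha)
    (beta_ax : cochain_axiom 0 beta) (V : lmodType k) (phi : word C -> V) s :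
  mlin phi ->
  comor alpha (comor beta phi) s =
  comor (fun w j => comor alpha (beta ^~ j) w) phi s.
Proof.
have [n] := ubnP (size s); elim: n s phi => // n IH [|x t] phi Hn Hphi //.
rewrite (eq_comor (cut1 (fun a b => comor beta (fun w => phi (letter 0 beta a :: w)) b)));
  last by move=> w _ Hw _; apply: comor_cut1; apply: Hw.
rewrite comor_of_cut1 comor_cons; apply: eq_cut => a b E.
rewrite (eq_comor (fun a' => comor (fun w j => comor alpha (beta ^~ j) w)
    (fun w => phi (letter 0 beta a' :: w)) b)); last first.
  move=> w _ _ _; apply: IH; last exact: mlin_tail.
  by move: Hn; rewrite /= -E size_cat; lia.
pose h (y : Pi C (degs (x :: a) + 0)) :=
  comor (fun w j => comor alpha (beta ^~ j) w) (fun w => phi (hel y :: w)) b.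
have Hh : lin h by apply: lin_comor => w; apply: mlin_head.
rewrite -/(h _) (comor_push Hh); apply: eq_comor => w _ _ Ew.
by rewrite /h (letterE (degs (x :: a) + 0)) ?Ew.
Qed.

(** * Coderivations along a pair of morphisms *)

Section Bicoder.
Variables (k : comPzRingType) (A B : gmod k).
Variables (alpha beta : cochain A B) (d : int) (r : cochain A B).
Implicit Types (V W : lmodType k) (s : word A).

(** The transpose of the coderivation along the morphisms extending [alpha] and
    [beta] with corestriction [r]: one block is sent through [r], those before it
    through [alpha], those after it through [beta]. *)
Definition bicoder V (phi : word B -> V) s : V :=
  parts (fun bs => \sum_(0 <= m < size bs)
    ksign k (d * degs (flatten (take m bs))) *:
      phi (map (letter 0 alpha) (take m bs) ++ letter d r (nth [::] bs m)
             :: map (letter 0 beta) (drop m.+1 bs))) s.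

Lemma bicoder_nil V (phi : word B -> V) : bicoder phi [::] = 0.
Proof. by rewrite /bicoder parts_nil big_geq. Qed.

Lemma bicoder_cons V (phi : word B -> V) x t :
  bicoder phi (x :: t) = cut (fun a b =>
    comor beta (fun w => phi (letter d r (x :: a) :: w)) b +
    ksign k (d * degs (x :: a)) *:
      bicoder (fun w => phi (letter 0 alpha (x :: a) :: w)) b) t.
Proof.
rewrite /bicoder parts_cons; apply: eq_cut => a b _.
rewrite addrC -parts_comb; apply: eq_parts => bs _ _ /=.
rewrite big_nat_recl //= degs_nil mulr0 scale1r drop0 [RHS]addrC; congr (_ + _).
rewrite scaler_sumr; apply: eq_bigr => m _.
by rewrite scalerA -ksignD -mulrDr -degs_cat.
Qed.

Lemma bicoder_cut1 V (phi : word B -> V) s :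
  bicoder phi s = cut1 (fun a b =>
    comor beta (fun w => phi (letter d r a :: w)) b +
    ksign k (d * degs a) *: bicoder (fun w => phi (letter 0 alpha a :: w)) b) s.
Proof. by case: s => [|x t]; rewrite ?bicoder_nil ?bicoder_cons. Qed.

Lemma eq_bicoder V (phi phi' : word B -> V) s :
  (forall w, (0 < size w <= size s)%N -> degs w = degs s + d -> phi w = phi' w) ->
  bicoder phi s = bicoder phi' s.
Proof.
have [n] := ubnP (size s); elim: n s phi phi' => // n IH [|x t] phi phi' Hn H.
  by rewrite !bicoder_nil.
rewrite !bicoder_cons; apply: eq_cut => a b E; congr (_ + _ *: _).
  apply: eq_comor => w Hw _ Ew; apply: H; first by move: Hw; rewrite -E /= size_cat; lia.
  by rewrite degs_cons Ew -E !degs_cons degs_cat /= degs_cons; lia.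
apply: IH; first by move: Hn; rewrite /= -E size_cat; lia.
move=> w Hw Ew; apply: H; first by move: Hw; rewrite -E /= size_cat; lia.
by rewrite degs_cons Ew -E !degs_cons degs_cat /= degs_cons; lia.
Qed.

Lemma bicoder_comb V c (phi psi : word B -> V) s :
  bicoder (fun w => c *: phi w + psi w) s = c *: bicoder phi s + bicoder psi s.
Proof.
rewrite /bicoder -parts_comb; apply: eq_parts => bs _ _.
rewrite scaler_sumr -big_split; apply: eq_bigr => m _ /=.
by rewrite scalerDr !scalerA mulrC.
Qed.

Lemma bicoder_push V W (h : V -> W) (phi : word B -> V) s :
  lin h -> h (bicoder phi s) = bicoder (fun w => h (phi w)) s.
Proof.
move=> Hh; rewrite /bicoder parts_push //; apply: eq_parts => bs _ _.
elim: (size bs) => [|m IH]; first by rewrite !big_geq // (lin_zero Hh).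
by rewrite !big_nat_recr //= (lin_add Hh) IH (lin_scale Hh).
Qed.

Lemma bicoderD V (phi psi : word B -> V) s :
  bicoder (fun w => phi w + psi w) s = bicoder phi s + bicoder psi s.
Proof.
rewrite -[bicoder phi s]scale1r -bicoder_comb; apply: eq_bicoder => w _ _.
by rewrite scale1r.
Qed.

Lemma bicoderZ V c (phi : word B -> V) s :
  bicoder (fun w => c *: phi w) s = c *: bicoder phi s.
Proof. by rewrite bicoder_push // => a x y; rewrite scalerDr !scalerA mulrC. Qed.

Lemma lin_bicoder V W (f : W -> word B -> V) s :
  (forall w, lin (f ^~ w)) -> lin (fun y => bicoder (f y) s).
Proof. by move=> H c y z; rewrite -bicoder_comb; apply: eq_bicoder => w _ _; apply: H. Qed.

Lemma bicoder_eq0 V (phi : word B -> V) s :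
  (forall w, (0 < size w <= size s)%N -> degs w = degs s + d -> phi w = 0) ->
  bicoder phi s = 0.
Proof.
move=> H; rewrite (@eq_bicoder _ _ (fun w => 0 *: phi w)).
  by rewrite bicoderZ scale0r.
by move=> w H1 E; rewrite scale0r H.
Qed.

(** The coderivation property along the two coalgebra morphisms. *)
Lemma bicoder_cut V (psi : word B -> word B -> V) s :
  bicoder (cut psi) s = cut (fun a b =>
    bicoder (fun a' => comor beta (psi a') b) a +
    ksign k (d * degs a) *: comor alpha (fun a' => bicoder (psi a') b) a) s.
Proof.
have [n] := ubnP (size s); elim: n s psi => [|n IH] [|x t] psi Hn //.
  by rewrite /= !bicoder_nil comor_nil add0r bicoder_nil scaler0.
rewrite bicoder_cons [RHS]/= bicoder_nil comor_nil add0r degs_nil mulr0 ksign0 scale1r.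
rewrite (eq_cut (psi' := fun a b =>
    (comor beta (fun w => psi [::] (letter d r (x :: a) :: w)) b +
    ksign k (d * degs (x :: a)) *:
      bicoder (fun w => psi [::] (letter 0 alpha (x :: a) :: w)) b) +
    cut (fun c e => comor beta (fun c' => comor beta (psi (letter d r (x :: a) :: c')) e) c +
       (ksign k (d * degs (x :: a)) *:
           bicoder (fun c' => comor beta (psi (letter 0 alpha (x :: a) :: c')) e) c +
       ksign k (d * degs ((x :: a) ++ c)) *:
           comor alpha (fun c' => bicoder (psi (letter 0 alpha (x :: a) :: c')) e) c)) b)).
  rewrite cutD -bicoder_cons -cutA; congr (_ + _).
  apply: eq_cut => a b _; rewrite bicoder_cons comor_cons -cutZ -cutD.
  by apply: eq_cut => p q E; rewrite addrA -E.
move=> a b E; rewrite cutD.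
rewrite [X in _ = _ + (_ + X)](eq_cut (s := b) (psi' := fun c e => ksign k (d * degs (x :: a)) *:
     (bicoder (fun c' => comor beta (psi (letter 0 alpha (x :: a) :: c')) e) c +
      ksign k (d * degs c) *:
           comor alpha (fun c' => bicoder (psi (letter 0 alpha (x :: a) :: c')) e) c)));
  last by move=> p q _; rewrite scalerDr scalerA -ksignD -mulrDr -degs_cat.
rewrite cutZ -IH; last by move: Hn; rewrite /= -E size_cat; lia.
rewrite -comor_cut addrACA -scalerDr -comorD -bicoderD.
by [].
Qed.

Lemma bicoder_of_cut1 V (psi : word B -> word B -> V) s :
  bicoder (cut1 psi) s = cut1 (fun a b =>
    bicoder (fun a' => comor beta (psi a') b) a +
    ksign k (d * degs a) *: comor alpha (fun a' => bicoder (psi a') b) a) s.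
Proof.
apply: (addrI (bicoder (psi [::]) s)); rewrite -bicoderD.
rewrite (@eq_bicoder _ _ (cut psi)); last by move=> w _ _; rewrite cutE.
rewrite bicoder_cut cutE bicoder_nil comor_nil degs_nil mulr0 ksign0 scale1r.
by rewrite add0r.
Qed.

Hypothesis alpha_ax : cochain_axiom 0 alpha.
Hypothesis beta_ax : cochain_axiom 0 beta.
Hypothesis r_ax : cochain_axiom d r.

Lemma mlin_bicoder V (phi : word B -> V) : mlin phi -> mlin (bicoder phi).
Proof.
move=> Hphi a u v w E; have [n] := ubnP (size u).
elim: n phi Hphi u v w E => // n IH phi Hphi _ _ _ [i x y s|z u v w E] Hn.
  rewrite !bicoder_cons -cut_comb; apply: eq_cut => b c _.
  rewrite scalerDr addrACA -comor_comb; congr (_ + _).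
    apply: eq_comor => t _ _ _.
    exact: (mlin_letter r_ax d t Hphi (lin3_head a x y b)).
  rewrite !degs_cons !scalerA [a * _]mulrC -scalerA -scalerDr -bicoder_comb.
  congr (_ *: _); apply: eq_bicoder => t _ _.
  exact: (mlin_letter alpha_ax 0 t Hphi (lin3_head a x y b)).
rewrite !bicoder_cons; apply: (cut_lin3 E) => [p p' p'' q E'|p q q' q'' E' Hq].
  have [E1 E2] := lin3_degs (lin3_tail z E').
  rewrite scalerDr addrACA -comor_comb E1 E2; congr (_ + _).
    apply: eq_comor => t _ _ _.
    exact: (mlin_letter r_ax d t Hphi (lin3_tail z E')).
  rewrite !scalerA [a * _]mulrC -scalerA -scalerDr -bicoder_comb.
  congr (_ *: _); apply: eq_bicoder => t _ _.
  exact: (mlin_letter alpha_ax 0 t Hphi (lin3_tail z E')).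
rewrite scalerDr addrACA scalerA [a * _]mulrC -scalerA -scalerDr.
congr (_ + _ *: _); first by apply: (mlin_comor beta_ax) E'; apply: mlin_tail.
by apply: IH E' _; [apply: mlin_tail | apply: leq_ltn_trans Hq Hn].
Qed.

End Bicoder.
Arguments eq_bicoder {k A B alpha beta d r V phi} phi' {s}.
Arguments bicoder_push {k A B alpha beta d r V W h phi s}.

Definition coder_tail (k : comPzRingType) (A : gmod k) d (nu : cochain A A)
    (V : lmodType k) (phi : word A -> V) (s : word A) : V :=
  if s is x :: t then ksign k (d * projT1 x) *: coder d nu (fun w => phi (x :: w)) t else 0.

Lemma coder_head_tail (k : comPzRingType) (A : gmod k) d (nu : cochain A A)
    (V : lmodType k) (phi : word A -> V) s :
  coder d nu phi s = cut1 (fun b c => phi (letter d nu b :: c)) s + coder_tail d nu phi s.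
Proof. by case: s => //=; rewrite addr0. Qed.

Section Commutation.
Variables (k : comPzRingType) (A B : gmod k).
Variables (nuA : cochain A A) (nuB : cochain B B).
Hypothesis nuA_ax : cochain_axiom (-1) nuA.
Hypothesis nuB_ax : cochain_axiom (-1) nuB.

Definition defect (alpha : cochain A B) : cochain A B :=
  fun s j => comor alpha (nuB ^~ j) s - coder (-1) nuA (alpha ^~ j) s.

(** The commutator of the morphism extending [alpha] with the coderivations is a
    coderivation along that morphism, hence it extends its corestriction, the
    failure of [alpha] to be a morphism of A-infinity structures. *)
Lemma comor_coder (alpha : cochain A B) (alpha_ax : cochain_axiom 0 alpha)
    (V : lmodType k) (phi : word B -> V) s :
  mlin phi ->
  comor alpha (coder (-1) nuB phi) s =
  coder (-1) nuA (comor alpha phi) s + bicoder alpha alpha (-1) (defect alpha) phi s.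
Proof.
have [n] := ubnP (size s); elim: n s phi => // n IH s phi Hn Hphi.
have [->|s_ne] := pselect (s = [::]); first by rewrite comor_nil bicoder_nil addr0.
have Hl i := mlin_head (i := i) _ Hphi.
rewrite (eq_comor (fun w => cut1 (fun b c => phi (letter (-1) nuB b :: c)) w +
    coder_tail (-1) nuB phi w)); last by move=> w _ _ _; apply: coder_head_tail.
rewrite comorD comor_of_cut1 (comor_cut1 _ (coder_tail _ _ _)) //.
rewrite (eq_coder (cut1 (fun a b => comor alpha (fun w => phi (letter 0 alpha a :: w)) b)));
  last by move=> w Hw _; apply: comor_cut1; case: w Hw.
rewrite coder_of_cut1 bicoder_cut1 -!cut1D; apply: eq_cut1 => a b E a_ne.
rewrite [X in _ + X = _](_ : _ = ksign k (degs a) *: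
    (coder (-1) nuA (comor alpha (fun w => phi (letter 0 alpha a :: w))) b +
     bicoder alpha alpha (-1) (defect alpha) (fun w => phi (letter 0 alpha a :: w)) b));
  last first.
  rewrite /= comorZ -IH; first by rewrite ksignN1 addr0.
    by move: Hn; rewrite -E size_cat; case: a {E} a_ne => //= x a _; lia.
  exact: mlin_tail.
rewrite ksignN1 scalerDr [RHS]addrACA; congr (_ + _).
(* both sides insert the composites [nuB alpha], [alpha nuA] in the first slot *)
pose h (y : Pi B (degs a - 1)) := comor alpha (fun w => phi (hel y :: w)) b.
have Hh : lin h by apply: lin_comor => w.
rewrite -/(h (defect alpha a (degs a - 1))) (lin_sub Hh).
rewrite (comor_push Hh) (coder_push Hh) [RHS]addrC.
rewrite (eq_coder (s := a) (fun w => h (alpha w (degs a - 1)))); last first.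
  by move=> w _ Ew; apply: eq_comor => w' _ _ _; rewrite (letterE (degs a - 1)) ?Ew ?addr0.
rewrite subrK; apply: eq_comor => w _ _ Ew; rewrite /h.
by apply: eq_comor => w' _ _ _; rewrite (letterE (degs a - 1)) ?Ew.
Qed.

Lemma comor_coder_morphism (alpha : cochain A B) (alpha_ax : cochain_axiom 0 alpha)
    (V : lmodType k) (phi : word B -> V) s :
  mlin phi ->
  (forall w j, (size w <= size s)%N -> defect alpha w j = 0) ->
  comor alpha (coder (-1) nuB phi) s = coder (-1) nuA (comor alpha phi) s.
Proof.
move=> Hphi H0; rewrite comor_coder // [X in _ + X](_ : _ = 0) ?addr0 //.
have : forall w j, (size w <= size s)%N -> defect alpha w j = 0 := H0.
clear H0; have [n] := ubnP (size s); elim: n s phi Hphi => // n IH [|x t] phi Hphi Hn H0.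
  exact: bicoder_nil.
rewrite bicoder_cons cut_eq0 // => a b E.
rewrite IH ?scaler0 ?addr0; last 3 first.
- exact: mlin_tail.
- by move: Hn; rewrite /= -E size_cat; lia.
- by move=> w j Hw; apply: H0; move: Hw; rewrite /= -E size_cat; lia.
apply: comor_eq0 => w _ _ _; rewrite /letter H0 ?(mlin0 [::]) //.
by rewrite /= -E size_cat; lia.
Qed.

Section Homotopy.
Variables (alpha beta r : cochain A B).
Hypothesis alpha_ax : cochain_axiom 0 alpha.
Hypothesis beta_ax : cochain_axiom 0 beta.
Hypothesis r_ax : cochain_axiom 1 r.
Hypothesis alpha_mor : forall s j, defect alpha s j = 0.
Hypothesis beta_mor : forall s j, defect beta s j = 0.

Definition homotopy_defect : cochain A B :=
  fun s j => bicoder alpha beta 1 r (nuB ^~ j) s + coder (-1) nuA (r ^~ j) s.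

(** Since [alpha] and [beta] commute with the coderivations, the anticommutator of
    the extension of [r] with them is again a coderivation along [alpha] and
    [beta], determined by its corestriction. *)
Lemma bicoder_coder (V : lmodType k) (phi : word B -> V) s :
  mlin phi ->
  bicoder alpha beta 1 r (coder (-1) nuB phi) s +
    coder (-1) nuA (bicoder alpha beta 1 r phi) s =
  bicoder alpha beta 0 homotopy_defect phi s.
Proof.
have [n] := ubnP (size s); elim: n s phi => // n IH s phi Hn Hphi.
have [->|s_ne] := pselect (s = [::]); first by rewrite !bicoder_nil addr0.
have Hl i := mlin_head (i := i) _ Hphi.
rewrite (eq_bicoder (fun w => cut1 (fun b c => phi (letter (-1) nuB b :: c)) w +
    coder_tail (-1) nuB phi w)); last by move=> w _ _; apply: coder_head_tail.
rewrite bicoderD bicoder_of_cut1 (bicoder_cut1 _ _ _ _ (coder_tail _ _ _)).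
rewrite (eq_coder (cut1 (fun a b =>
    comor beta (fun w => phi (letter 1 r a :: w)) b +
    ksign k (1 * degs a) *: bicoder alpha beta 1 r (fun w => phi (letter 0 alpha a :: w)) b)));
  last by move=> w Hw _; apply: bicoder_cut1.
rewrite coder_of_cut1 bicoder_cut1 -!cut1D; apply: eq_cut1 => a b E a_ne.
have Hb : (size b < n)%N.
  by move: Hn; rewrite -E size_cat; case: a {E} a_ne => //= x a _; lia.
rewrite !mul1r mul0r ksign0 scale1r ksignN1.
set s_a := ksign k (degs a).
have Hra := mlin_tail (letter 1 r a) Hphi.
have Haa := mlin_tail (letter 0 alpha a) Hphi.
have -> : comor beta (fun w => coder_tail (-1) nuB phi (letter 1 r a :: w)) b =
    - (s_a *: coder (-1) nuA (comor beta (fun w => phi (letter 1 r a :: w))) b).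
  rewrite -comor_coder_morphism //.
  by rewrite comorZ ksignN1 ksignD ksign1 mulrN1 scaleNr.
have -> : bicoder alpha beta 1 r
      (fun w => coder_tail (-1) nuB phi (letter 0 alpha a :: w)) b =
    s_a *: bicoder alpha beta 1 r (coder (-1) nuB (fun w => phi (letter 0 alpha a :: w))) b.
  by rewrite bicoderZ ksignN1 /= addr0.
have -> : coder (-1) nuA (fun a' => comor beta (fun w => phi (letter 1 r a' :: w)) b +
      ksign k (1 * degs a') *: bicoder alpha beta 1 r
        (fun w => phi (letter 0 alpha a' :: w)) b) a =
    coder (-1) nuA (fun a' => comor beta (fun w => phi (letter 1 r a' :: w)) b) a -
    s_a *: coder (-1) nuA
      (fun a' => bicoder alpha beta 1 r (fun w => phi (letter 0 alpha a' :: w)) b) a.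
  rewrite coderD -scaleNr -coderZ; congr (_ + _); apply: eq_coder => w _ Ew.
  by rewrite mul1r Ew ksignD [ksign k (-1)]ksignN ksign1 mulrN1.
rewrite coderD coderZ scalerDr.
rewrite addrACA [X in X + _]addrACA [X in _ + X]addrACA addNr add0r.
rewrite !scalerA ksignMM !scale1r IH // -scalerBr; congr (_ + _).
pose h (y : Pi B (degs a)) := comor beta (fun w => phi (hel y :: w)) b.
have Hh : lin h by apply: lin_comor => w.
pose h' (y : Pi B (degs a - 1)) :=
  bicoder alpha beta 1 r (fun w => phi (hel y :: w)) b.
have Hh' : lin h' by apply: lin_bicoder => w.
rewrite [X in _ + X](_ : _ = s_a *: h' (defect alpha a (degs a - 1))); last first.
  congr (_ *: _); rewrite (lin_sub Hh') (comor_push Hh') (coder_push Hh').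
  congr (_ - _); first by apply: eq_comor => w _ _ Ew; rewrite (letterE (degs a - 1)) ?Ew.
  by apply: eq_coder => w _ Ew; rewrite (letterE (degs a - 1)) ?Ew ?addr0.
rewrite alpha_mor (lin_zero Hh') scaler0 addr0.
rewrite (letterE (degs a)) ?addr0 // -/(h _) (lin_add Hh).
rewrite (bicoder_push Hh) (coder_push Hh); congr (_ + _).
  by apply: eq_bicoder => w _ Ew; rewrite (letterE (degs a)) // Ew; lia.
by apply: eq_coder => w _ Ew; rewrite (letterE (degs a)) // Ew; lia.
Qed.

(** The difference of two coalgebra morphisms is a coderivation along them. *)
Lemma comor_sub (V : lmodType k) (phi : word B -> V) s :
  mlin phi ->
  comor alpha phi s - comor beta phi s =
  bicoder alpha beta 0 (fun w j => alpha w j - beta w j) phi s.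
Proof.
have [n] := ubnP (size s); elim: n s phi => // n IH [|x t] phi Hn Hphi.
  by rewrite bicoder_nil !comor_nil subrr.
rewrite bicoder_cons !comor_cons addrC -scaleN1r -cut_comb.
apply: eq_cut => a b E; rewrite mul0r ksign0 scale1r -IH; last exact: mlin_tail.
  pose h (y : Pi B (degs (x :: a) + 0)) := comor beta (fun w => phi (hel y :: w)) b.
  have Hh : lin h by apply: lin_comor => w; apply: mlin_head.
  have -> : comor beta (fun w =>
      phi (letter 0 (fun w j => alpha w j - beta w j) (x :: a) :: w)) b =
    comor beta (fun w => phi (letter 0 alpha (x :: a) :: w)) b -
    comor beta (fun w => phi (letter 0 beta (x :: a) :: w)) b by exact: (lin_sub Hh).
  rewrite scaleN1r [RHS]addrC addrA subrK addrC.
  by [].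
by move: Hn; rewrite /= -E size_cat; lia.
Qed.

End Homotopy.
End Commutation.

(** * The three products as coalgebra operations *)

Lemma triangle_sum (V : nmodType) l (G : nat -> nat -> V) :
  \sum_(1 <= i < l.+1) \sum_(0 <= p < i) G p (l - i + 1)%N =
  \sum_(0 <= p < l) \sum_(1 <= m < (l - p).+1) G p m.
Proof.
rewrite big_nat_rev /= [RHS](eq_big_nat _ _ (F2 := fun p =>
  \sum_(1 <= m < l.+1 | (m < (l - p).+1)%N) G p m)); last first.
  by move=> p _; rewrite (big_nat_widen 1 (l - p).+1 l.+1) // ltnS leq_subr.
rewrite [RHS](exchange_big_dep_nat xpredT) //=; apply: eq_big_nat => m Hm.
rewrite add1n subSS; have -> : (l - (l.+1 - m) + 1 = m)%N by lia.
rewrite (big_nat_widen 0 (l.+1 - m) l); last by lia.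
by rewrite big_nat_cond [RHS]big_nat_cond; apply: eq_bigl => p /=; lia.
Qed.

Lemma gerstE (k : comPzRingType) (A B : gmod k) d (mu : cochain A B)
    (nu : cochain A A) s j :
  gerst d mu nu s j = coder d nu (mu ^~ j) s.
Proof.
have sumE (V : lmodType k) (phi : word A -> V) : coder d nu phi s =
    \sum_(0 <= p < size s) ksign k (d * degs (take p s)) *:
      \sum_(1 <= m < (size s - p).+1)
         phi (take p s ++ letter d nu (take m (drop p s)) :: drop (p + m) s).
  elim: s phi => [|x t IH] phi; first by rewrite big_geq.
  rewrite coder_cons [RHS]big_nat_recl //= degs_nil mulr0 scale1r; congr (_ + _).
    by rewrite subn0 cut_sum big_add1 /=.
  rewrite IH scaler_sumr; apply: eq_bigr => p _.
  by rewrite scalerA -ksignD -mulrDr -degs_cons subSS.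
rewrite sumE /gerst.
rewrite (triangle_sum _ (fun p m => ksign k (d * degs (take p s)) *:
  mu (take p s ++ letter d nu (take m (drop p s)) :: drop (p + m) s) j)).
by apply: eq_bigr => p _; rewrite scaler_sumr.
Qed.

Lemma sum_tuple_cons (V : nmodType) (I : finType) n (F : n.+1.-tuple I -> V) :
  \sum_t F t = \sum_(h : I) \sum_(t : n.-tuple I) F (cons_tuple h t).
Proof.
rewrite pair_big /=.
rewrite (reindex (fun p : I * n.-tuple I => cons_tuple p.1 p.2)) //=.
exists (fun t => (thead t, behead_tuple t)) => [[h t] _|t _] /=.
  by rewrite theadE; congr (_, _); apply: val_inj.
by case/tupleP: t => h t; rewrite theadE; apply: val_inj.
Qed.

Section Blocks.
Variables (k : comPzRingType) (T : Type) (V : lmodType k).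
Implicit Types (Psi : seq (seq T) -> V) (s : seq T).

(** The bound [L] on the parts is kept apart from the length of the word so that it
    stays fixed when the first block is removed. *)
Definition block_sum Psi L i s : V :=
  \sum_(c : i.-tuple 'I_L.+1 | composition (size s) (map val c))
    Psi (reshape (map val c) s).

Lemma block_sum0 Psi L s : block_sum Psi L 0 s = if s is [::] then Psi [::] else 0.
Proof.
rewrite /block_sum; case: s => [|x t].
  rewrite (big_pred1 [tuple]) // => c; rewrite [c]tuple0 /composition /=.
  by apply/esym/eqP.
by rewrite big_pred0 // => c; rewrite [c]tuple0.
Qed.

Lemma block_sumS Psi L i s : (size s <= L)%N ->
  block_sum Psi L i.+1 s = cut1 (fun a b => block_sum (fun bs => Psi (a :: bs)) L i b) s.
Proof.
move=> Hs; rewrite /block_sum big_mkcond sum_tuple_cons.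
case: s Hs => [|x t] Hs /=.
  apply: big1 => h _; apply: big1 => c _; rewrite /composition /=.
  by case: (nat_of_ord h) => [|m]; rewrite ?in_cons //= andbF.
rewrite big_ord_recl [X in X + _]big1 ?add0r; last by move=> c _.
rewrite cut_sum (big_nat_widen 0 _ L) // big_mkord [RHS]big_mkcond.
apply: eq_bigr => h _; rewrite -big_mkcond /=.
have Ec (c : i.-tuple 'I_L.+1) : composition (size t).+1 (bump 0 h :: map val c) =
    (h < (size t).+1)%N && composition (size (drop h t)) (map val c).
  rewrite /composition /= in_cons size_drop; case: (0%N \in _); rewrite /= ?andbF //.
  by rewrite /bump leq0n; lia.
case: ifP => Hh; last by rewrite big_pred0 // => c; rewrite Ec Hh.
by apply: eq_bigl => c; rewrite Ec Hh.
Qed.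

Lemma block_sum_parts Psi L n s : (size s <= L)%N -> (size s < n)%N ->
  \sum_(0 <= i < n) block_sum Psi L i s = parts Psi s.
Proof.
elim: n Psi s => // n IH Psi s HL Hn.
rewrite big_nat_recl // block_sum0.
case: s HL Hn => [|x t] HL Hn.
  by rewrite big1 ?addr0 // => i _; rewrite block_sumS.
rewrite add0r parts_cons.
rewrite (eq_bigr (fun i => cut (fun a b =>
    block_sum (fun bs => Psi ((x :: a) :: bs)) L i b) t)); last first.
  by move=> i _; rewrite block_sumS.
rewrite sum_cut; apply: eq_cut => a b E; apply: IH.
  by move: HL; rewrite -E /= size_cat; lia.
by move: Hn; rewrite -E /= size_cat; lia.
Qed.

Lemma sum_compositions Psi s : s <> [::] ->
  \sum_(1 <= i < (size s).+1)
    \sum_(c : i.-tuple 'I_(size s).+1 | composition (size s) (map val c))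
      Psi (reshape (map val c) s) = parts Psi s.
Proof.
move=> Hs; rewrite -(@block_sum_parts Psi (size s) (size s).+1) // [RHS]big_nat_recl //.
by rewrite block_sum0 big_add1; case: s Hs => //= x t _; rewrite add0r.
Qed.

End Blocks.

Lemma starE (k : comPzRingType) (A B C : gmod k) (nu : cochain B C)
    (alpha : cochain A B) s j :
  nu [::] j = 0 -> star nu alpha s j = comor alpha (nu ^~ j) s.
Proof.
move=> H0; have [->|Hs] := pselect (s = [::]).
  by rewrite comor_nil /star big_geq.
exact: (sum_compositions (fun bs => nu (map (letter 0 alpha) bs) j) Hs).
Qed.

Lemma hstarE (k : comPzRingType) (A B : gmod k) (nu : cochain B B)
    (alpha beta r : cochain A B) s j :
  hstar nu alpha beta r s j = bicoder alpha beta 1 r (nu ^~ j) s.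
Proof.
have [->|Hs] := pselect (s = [::]); first by rewrite bicoder_nil /hstar big_geq.
rewrite /bicoder -(sum_compositions _ Hs) /hstar.
apply: eq_bigr => i _; apply: eq_bigr => c /andP[_ /eqP Hc].
rewrite size_reshape size_map size_tuple; apply: eq_bigr => m _.
by rewrite mul1r.
Qed.

(** * Strict units *)

Section Single.
Variables (k : comPzRingType).

Lemma coder_single (A : gmod k) d (nu : cochain A A) (V : lmodType k) (phi : word A -> V) s :
  (forall w, size w <> 1%N -> phi w = 0) -> s <> [::] ->
  coder d nu phi s = phi [:: letter d nu s].
Proof.
case: s => // x t H _; rewrite coder_cons cut_last.
  by rewrite coder_eq0 ?scaler0 ?addr0 // => -[|y w] //= _ _; apply: H.
by move=> a [|y b] _ // _; apply: H.
Qed.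

Variables (A B : gmod k) (alpha beta r : cochain A B) (V : lmodType k).
Variable (phi : word B -> V) (s : word A).
Hypothesis phi1 : forall w, size w <> 1%N -> phi w = 0.
Hypothesis s_ne : s <> [::].

Lemma comor_single : comor alpha phi s = phi [:: letter 0 alpha s].
Proof.
case: s s_ne => // x t _; rewrite comor_cons cut_last ?comor_nil // => a b _ Hb.
by apply: comor_eq0 => -[|y w] _ Hw _; [case: (Hw Hb) | apply: phi1].
Qed.

Lemma bicoder_single d : bicoder alpha beta d r phi s = phi [:: letter d r s].
Proof.
case: s s_ne => // x t _; rewrite bicoder_cons cut_last.
  by rewrite comor_nil bicoder_nil scaler0 addr0.
move=> a b _ Hb; rewrite bicoder_eq0 ?scaler0 ?addr0.
  by apply: comor_eq0 => -[|y w] _ Hw _; [case: (Hw Hb) | apply: phi1].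
by case=> [|y w] // _ _; apply: phi1.
Qed.

End Single.

Definition unitless (k : comPzRingType) (A : gmod k) (one : A 0) (V : lmodType k)
    (phi : word A -> V) : Prop :=
  forall s1 s2, phi (s1 ++ bar1 one :: s2) = 0.

(** The word [1] itself is excepted because a strictly unital morphism sends it to
    [1]; fixing the first letter of such a function removes the exception. *)
Definition almost_unitless (k : comPzRingType) (A : gmod k) (one : A 0) (V : lmodType k)
    (phi : word A -> V) : Prop :=
  forall s1 s2, s1 ++ s2 <> [::] -> phi (s1 ++ bar1 one :: s2) = 0.

Lemma unitlessW (k : comPzRingType) (A : gmod k) (one : A 0) (V : lmodType k)
    (phi : word A -> V) :
  unitless one phi -> almost_unitless one phi.
Proof. by move=> H s1 s2 _. Qed.

Lemma almost_unitless_tail (k : comPzRingType) (A : gmod k) (one : A 0)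
    (V : lmodType k) (phi : word A -> V) x :
  almost_unitless one phi -> unitless one (fun w => phi (x :: w)).
Proof. by move=> H s1 s2; apply: (H (x :: s1)). Qed.

Section StrictUnit.
Variables (k : comPzRingType) (A : gmod k) (one : A 0) (nu : cochain A A).
Hypothesis nu_ax : cochain_axiom (-1) nu.
Hypothesis nu_su : strictly_unital one nu.

Lemma su_left n (x : Pi A n) : nu [:: bar1 one; hel x] n = x.
Proof. by case: nu_su => H _; case: (H n x). Qed.

Lemma su_right n (x : Pi A n) : nu [:: hel x; bar1 one] n = ksign k (n - 1) *: x.
Proof.
case: nu_su => H _; case: (H n x) => _ E.
by rewrite [in RHS]E scalerA ksignMM scale1r.
Qed.

Lemma su_zero s1 s2 j : size (s1 ++ s2) <> 1%N -> nu (s1 ++ bar1 one :: s2) j = 0.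
Proof.
case: nu_su => _ H Hs; apply: H.
by apply/eqP; move: Hs; rewrite !size_cat /=; lia.
Qed.

Arguments su_zero s1 {s2}.

Lemma su_left_letter x : letter (-1) nu [:: bar1 one; x] = x.
Proof.
case: x => i x; rewrite (letterE i); first by rewrite su_left.
by rewrite degs_cons degs1 /=; lia.
Qed.

Lemma su_right_letter (V : lmodType k) (phi : word A -> V) x t : mlin phi ->
  phi (letter (-1) nu [:: x; bar1 one] :: t) = ksign k (projT1 x - 1) *: phi (x :: t).
Proof.
case: x => i x Hphi; rewrite (letterE i); last by rewrite degs_cons degs1 /=; lia.
by rewrite su_right (lin_scale (mlin_head t Hphi)).
Qed.

Lemma su_tail x j : almost_unitless one (fun w => nu (x :: w) j).
Proof. by move=> s1 s2 H; apply: (su_zero (x :: s1)) => /= -[]; case: (s1 ++ s2) H. Qed.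

Lemma su_left_cochain (C : gmod k) d (f : cochain C A) s j : cochain_axiom d f ->
  nu [:: bar1 one; letter d f s] j = f s j.
Proof.
move=> f_ax; have [->|Hj] := eqVneq j (degs s + d); first exact: su_left.
rewrite (cochain_shape f_ax) // (cochain_shape nu_ax) // degs_cons degs1 /=.
by apply: contraNneq Hj => ->; lia.
Qed.

Lemma su_right_cochain (C : gmod k) d (f : cochain C A) s j : cochain_axiom d f ->
  nu [:: letter d f s; bar1 one] j = ksign k (degs s + d - 1) *: f s j.
Proof.
move=> f_ax; have [->|Hj] := eqVneq j (degs s + d); first exact: su_right.
rewrite (cochain_shape f_ax) // (cochain_shape nu_ax) ?scaler0 // degs_cons degs1 /=.
by apply: contraNneq Hj => ->; lia.
Qed.

(** In the sum, the letter [1] must be an argument of [nu], which then has exactly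
    one neighbour of [1] as other argument. The two neighbours contribute the same
    word with opposite signs. *)
Lemma coder_unit (V : lmodType k) (phi : word A -> V) s1 s2 :
  mlin phi -> almost_unitless one phi ->
  coder (-1) nu phi (s1 ++ bar1 one :: s2) = ksign k (degs s1) *:
    ((if s2 is [::] then 0 else phi (s1 ++ s2)) -
     (if s1 is [::] then 0 else phi (s1 ++ s2))).
Proof.
elim: s1 phi => [|x s1 IH] phi Hphi H.
  rewrite [_ ++ _]/= coder_cons coder_eq0 ?scaler0 ?addr0; last first.
    by case=> // y w _ _; apply: (H [::]).
  rewrite degs_nil scale1r subr0; case: s2 => [|y t] /=.
    by apply: (letter_eq0 [::]) => // j; apply: (su_zero [::]).
  rewrite (letter_eq0 [::]) ?add0r //; last first.
    by move=> j; apply: (su_zero [::]).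
  rewrite cut_first ?su_left_letter // => -[|z a] b _ // _.
  by apply: (letter_eq0 [::]) => // j; apply: (su_zero [::]).
rewrite [_ ++ _]/= coder_cons IH; [|exact: mlin_tail|]; last first.
  exact/unitlessW/almost_unitless_tail.
rewrite cut_cat cut_eq0 ?add0r; last by move=> a b _; apply: (H (_ :: b)).
rewrite cut_first; last first.
  move=> [|z a] b _ // _; apply: (letter_eq0 [::]) => // j.
  by apply: (su_zero (x :: s1)); rewrite size_cat /= addnS.
rewrite ksignN1 degs_cons; case: s1 {IH} => [|y s1]; last first.
  rewrite (letter_eq0 [::]) ?add0r //; last first.
    by move=> j; apply: (su_zero (x :: y :: s1)).
  by rewrite scalerA -ksignD.
rewrite su_right_letter // degs_nil addr0 scale1r subr0 scalerBr addrC.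
congr (_ + _); rewrite ksignD [ksign k (-1)]ksignN ksign1 mulrN1 scaleNr.
by [].
Qed.

(** Besides the terms of [coder_unit], the outer [nu] may take [1] as one of two
    arguments. This happens at the ends of the word, where one neighbour of [1] is
    missing, and compensates for it. *)
Lemma coder_self_unitless j : unitless one (coder (-1) nu (nu ^~ j)).
Proof.
have Hnu : mlin (nu ^~ j) := cochain_mlin nu_ax j.
have Ht x : mlin (fun w => nu (x :: w) j) := mlin_tail x Hnu.
case=> [|x s1] s2.
  rewrite [_ ++ _]/= coder_cons ksignN1; case: s2 => [|y t].
    by rewrite /= scaler0 addr0; apply: (letter_eq0 (phi := nu ^~ j) [::]) => // i;
       apply: (su_zero [::]).
  rewrite coder_single //; last by move=> w Hw; exact: (su_zero [::] j Hw).
  rewrite (su_left_cochain _ _ nu_ax) /= (letter_eq0 (phi := nu ^~ j) [::]) ?add0r //; last first.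
    by move=> i; apply: (su_zero [::]).
  rewrite cut_first; last first.
    move=> [|z a] b _ // _; apply: (letter_eq0 (phi := nu ^~ j) [::]) => // i.
    by apply: (su_zero [::]).
  by rewrite su_left_letter ksign1 scaleN1r subrr.
rewrite [_ ++ _]/= coder_cons coder_unit //; last exact: su_tail.
rewrite cut_cat ksignN1.
rewrite [X in X + _ + _](_ : _ = if s2 is [::] then
    ksign k (degs (x :: s1)) *: nu (x :: s1) j else 0); last first.
  rewrite cut_last; last first.
    by move=> a [|z b] E // _; apply: (su_zero (_ :: z :: b)).
  case: s2 => [|y t]; last by apply: (su_zero [:: _]).
  rewrite (su_right_cochain _ _ nu_ax) -addrA ksignD.
  by rewrite [ksign k (-1 - 1)](_ : _ = 1) ?mulr1 // /ksign /= expr2 mulN1r opprK.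
rewrite cut_first; last first.
  move=> [|z a] b _ // _; apply: (letter_eq0 (phi := nu ^~ j) [::]) => // i.
  by apply: (su_zero (x :: s1)); rewrite size_cat /= addnS.
rewrite scalerA -ksignD -degs_cons; case: s1 => [|y s1].
  have -> : nu (letter (-1) nu [:: x; bar1 one] :: s2) j =
      ksign k (projT1 x - 1) *: nu (x :: s2) j by apply: (su_right_letter x s2 Hnu).
  rewrite ksignD [ksign k (-1)]ksignN ksign1 mulrN1 scaleNr.
  by rewrite degs1 /= subr0; case: s2 => [|z t]; rewrite ?scaler0 ?addr0 ?subrr // add0r addNr.
rewrite (letter_eq0 (phi := nu ^~ j) [::]) ?addr0 //; last by move=> i; apply: (su_zero (x :: y :: s1)).
by case: s2 => [|z t]; rewrite ?cats0 ?sub0r ?scalerN ?subrr ?scaler0 ?addr0.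
Qed.

End StrictUnit.
Arguments su_zero {k A one nu} nu_su s1 {s2} j.

Section StrictUnitMap.
Variables (k : comPzRingType) (A B : gmod k) (oneA : A 0) (oneB : B 0).
Variables (nuA : cochain A A) (nuB : cochain B B).
Hypothesis nuA_ax : cochain_axiom (-1) nuA.
Hypothesis nuB_ax : cochain_axiom (-1) nuB.
Hypothesis nuA_su : strictly_unital oneA nuA.
Hypothesis nuB_su : strictly_unital oneB nuB.

Lemma su_map_letter (alpha : cochain A B) :
  strictly_unital_map oneA oneB alpha -> letter 0 alpha [:: bar1 oneA] = bar1 oneB.
Proof. by case=> H _; rewrite (letterE 1) ?H // degs1. Qed.

Lemma su_map_zero (alpha : cochain A B) s1 s2 j :
  strictly_unital_map oneA oneB alpha -> s1 ++ s2 <> [::] ->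
  alpha (s1 ++ bar1 oneA :: s2) j = 0.
Proof.
case=> _ H Hs; apply: H; move: Hs; rewrite size_cat /=.
by case: s1 s2 => [|x s1] [|y s2] //= _; lia.
Qed.

Lemma comor_almost_unitless (alpha : cochain A B) (V : lmodType k) (phi : word B -> V) :
  strictly_unital_map oneA oneB alpha -> mlin phi ->
  almost_unitless oneB phi -> almost_unitless oneA (comor alpha phi).
Proof.
move=> su Hphi H s1 s2.
have [n] := ubnP (size (s1 ++ s2)).
elim: n s1 phi Hphi H => // n IH [|x s1] phi Hphi H Hn Hs.
  rewrite [_ ++ _]/= comor_cons cut_first; last first.
    move=> [|z a] b _ // _; apply: comor_eq0 => w _ _ _; apply: (letter_eq0 [::]) => // j.
    by apply: (su_map_zero (s1 := [::])).
  rewrite su_map_letter //; apply: comor_eq0 => -[|y w] _ Hw _; first by case: (Hw Hs).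
  exact: (H [::]).
rewrite [_ ++ _]/= comor_cons cut_cat [X in _ + X]cut_eq0 ?addr0; last first.
  move=> a b _; apply: comor_eq0 => w _ _ _; apply: (letter_eq0 [::]) => // j.
  exact: (su_map_zero (s1 := x :: s1)).
apply: cut_eq0 => a b E; set psi := (fun w => _).
have Hpsi : mlin psi by apply: mlin_tail.
have upsi : unitless oneB psi by apply: almost_unitless_tail.
have [Eb|Nb] := pselect (b ++ s2 = [::]).
  have [-> ->] : b = [::] /\ s2 = [::] by case: (b) (s2) Eb => [|? ?] [|? ?].
  by rewrite comor_cons /= comor_nil su_map_letter //; apply: (upsi [::]).
apply: IH => //.
by move: Hn; rewrite -E /= !size_cat; lia.
Qed.

Lemma comor_unitless (alpha : cochain A B) (V : lmodType k) (phi : word B -> V) :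
  strictly_unital_map oneA oneB alpha -> mlin phi ->
  unitless oneB phi -> unitless oneA (comor alpha phi).
Proof.
move=> su Hphi H s1 s2.
have [E|N] := pselect (s1 ++ s2 = [::]); last first.
  by apply: comor_almost_unitless => //; apply: unitlessW.
case: s1 s2 E => // -[] // _ /=.
by rewrite comor_cons /= comor_nil su_map_letter //; apply: (H [::]).
Qed.

(** At an end of the word, [nuB] applied to [1] and to the value of [alpha] on the
    rest makes up for the missing neighbour of [1] in [coder_unit]. *)
Lemma defect_unitless (alpha : cochain A B) (alpha_ax : cochain_axiom 0 alpha) j :
  strictly_unital_map oneA oneB alpha -> unitless oneA ((defect nuA nuB alpha) ^~ j).
Proof.
move=> su s1 s2; rewrite /defect coder_unit //; last 2 first.
- exact: cochain_mlin alpha_ax j.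
- by move=> t1 t2 H; apply: su_map_zero.
have HnuB := cochain_mlin nuB_ax j.
have Hone : comor alpha (nuB ^~ j) [:: bar1 oneA] = 0.
  rewrite comor_cons /= comor_nil su_map_letter //.
  exact: (su_zero nuB_su [::] j).
case: s1 => [|x s1].
  case: s2 => [|y t]; first by rewrite /= Hone subrr scaler0 subrr.
  rewrite [_ ++ _]/= comor_cons cut_first; last first.
    move=> [|z a] b _ // _; apply: comor_eq0 => w _ _ _; apply: (letter_eq0 (phi := nuB ^~ j) [::]) => // i.
    exact: (su_map_zero (s1 := [::])).
  rewrite su_map_letter // comor_single //; last first.
    by move=> w Hw; exact: (su_zero nuB_su [::] j Hw).
  by rewrite (su_left_cochain nuB_ax nuB_su _ _ alpha_ax) degs_nil scale1r subr0 subrr.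
rewrite [_ ++ _]/= comor_cons cut_cat [X in _ + X - _]cut_eq0 ?addr0; last first.
  move=> a b _; apply: comor_eq0 => w _ _ _; apply: (letter_eq0 (phi := nuB ^~ j) [::]) => // i.
  exact: (su_map_zero (s1 := x :: s1)).
rewrite cut_last; last first.
  move=> a b _ Hb; apply: comor_almost_unitless => //; first exact: (mlin_tail _ HnuB).
    exact: su_tail.
  by case: b Hb.
case: s2 => [|y t].
  rewrite [[::] ++ _]/= comor_cons /= comor_nil su_map_letter //.
  rewrite (su_right_cochain nuB_ax nuB_su _ _ alpha_ax) addr0 cats0 sub0r scalerN opprK.
  by rewrite ksignD [ksign k (-1)]ksignN ksign1 mulrN1 scaleNr addNr.
rewrite comor_almost_unitless ?subrr ?scaler0 ?subrr //; first exact: (mlin_tail _ HnuB).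
exact: su_tail.
Qed.

Lemma bicoder_almost_unitless d (alpha beta r : cochain A B) (V : lmodType k)
    (phi : word B -> V) :
  strictly_unital_map oneA oneB alpha -> strictly_unital_map oneA oneB beta ->
  reduced oneA r -> mlin phi -> almost_unitless oneB phi ->
  unitless oneA (bicoder alpha beta d r phi).
Proof.
move=> sua sub red Hphi H s1 s2.
have [n] := ubnP (size s1); elim: n s1 phi Hphi H => // n IH [|x s1] phi Hphi H Hn.
  rewrite [_ ++ _]/= bicoder_cons; apply: cut_eq0 => a b E.
  rewrite comor_eq0 ?add0r; last first.
    by move=> w _ _ _; apply: (letter_eq0 [::]) => // j; apply: (red [::]).
  rewrite bicoder_eq0 ?scaler0 // => w Hw _; case: a E => [|z a] E.
    by rewrite su_map_letter //; apply: (H [::]); case: w Hw.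
  by apply: (letter_eq0 [::]) => // j; apply: (su_map_zero (s1 := [::])).
rewrite [_ ++ _]/= bicoder_cons cut_cat !cut_eq0 ?addr0 // => a b E.
  rewrite comor_eq0 ?add0r; last first.
    by move=> w _ _ _; apply: (letter_eq0 [::]) => // j; apply: (red (x :: s1)).
  rewrite bicoder_eq0 ?scaler0 // => w Hw _.
  by apply: (letter_eq0 [::]) => // j; apply: (su_map_zero (s1 := x :: s1)).
rewrite comor_unitless ?add0r //; [|exact: mlin_tail|exact: almost_unitless_tail].
rewrite IH ?scaler0 //; [exact: mlin_tail| |].
  exact/unitlessW/almost_unitless_tail.
by move: Hn; rewrite -E /= size_cat; lia.
Qed.

Lemma homotopy_defect_unitless (alpha beta r : cochain A B) j :
  strictly_unital_map oneA oneB alpha -> strictly_unital_map oneA oneB beta ->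
  cochain_axiom 1 r -> reduced oneA r ->
  unitless oneA ((homotopy_defect nuA nuB alpha beta r) ^~ j).
Proof.
move=> sua sub r_ax red s1 s2; rewrite /homotopy_defect coder_unit; last 3 first.
- exact: nuA_su.
- exact: cochain_mlin r_ax j.
- by move=> t1 t2 _; apply: red.
have HnuB := cochain_mlin nuB_ax j.
case: s1 => [|x s1].
  rewrite [_ ++ _]/= bicoder_cons cut_first; last first.
    move=> [|z a] b _ // _; rewrite comor_eq0 ?add0r; last first.
      by move=> w _ _ _; apply: (letter_eq0 (phi := nuB ^~ j) [::]) => // i; apply: (red [::]).
    rewrite bicoder_eq0 ?scaler0 // => w _ _; apply: (letter_eq0 (phi := nuB ^~ j) [::]) => // i.
    exact: (su_map_zero (s1 := [::])).
  rewrite comor_eq0 ?add0r; last first.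
    by move=> w _ _ _; apply: (letter_eq0 (phi := nuB ^~ j) [::]) => // i; apply: (red [::]).
  rewrite su_map_letter // degs1 mul1r degs_nil scale1r subr0 ksign1 scaleN1r.
  case: s2 => [|y t]; first by rewrite bicoder_nil oppr0 addr0.
  rewrite bicoder_single //; last by move=> w Hw; exact: (su_zero nuB_su [::] j Hw).
  by rewrite (su_left_cochain nuB_ax nuB_su _ _ r_ax) addNr.
rewrite [_ ++ _]/= bicoder_cons cut_cat [X in _ + X + _]cut_eq0 ?addr0; last first.
  move=> a b E; rewrite comor_eq0 ?add0r; last first.
    by move=> w _ _ _; apply: (letter_eq0 (phi := nuB ^~ j) [::]) => // i; apply: (red (x :: s1)).
  rewrite bicoder_eq0 ?scaler0 // => w Hw _.
  by apply: (letter_eq0 (phi := nuB ^~ j) [::]) => // i; apply: (su_map_zero (s1 := x :: s1)).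
rewrite (eq_cut (psi' := fun a b => comor beta
    (fun w => nuB (letter 1 r (x :: a) :: w) j) (b ++ bar1 oneA :: s2))); last first.
  move=> a b _; rewrite bicoder_almost_unitless ?scaler0 ?addr0 //.
    exact: (mlin_tail _ HnuB).
  exact: su_tail.
have Hx z : mlin (fun w => nuB (z :: w) j) by exact: (mlin_tail _ HnuB).
rewrite cut_last; last first.
  move=> a b _ Hb; apply: comor_almost_unitless => //; first exact: su_tail.
  by case: b Hb.
case: s2 => [|y t].
  rewrite [[::] ++ _]/= comor_cons /= comor_nil su_map_letter //.
  rewrite (su_right_cochain nuB_ax nuB_su _ _ r_ax) addrK cats0 sub0r scalerN.
  by rewrite subrr.
rewrite comor_almost_unitless ?subrr ?scaler0 ?addr0 //.
exact: su_tail.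
Qed.

End StrictUnitMap.

Lemma scale_comb_sub (k : comPzRingType) (V : lmodType k) (a c : k) (x y z w : V) :
  (a *: x + y) - c *: (a *: z + w) = a *: (x - c *: z) + (y - c *: w).
Proof. by rewrite !scalerDr scalerN opprD addrACA !scalerA mulrC. Qed.

(** * Surjective quasi-isomorphisms *)

Section Kernel.
Variables (k : comPzRingType) (X Y : gmod k).
Variables (dX : differential X) (dY : differential Y) (f : ghom X Y 0).

(** For surjective chain maps this is equivalent to being a quasi-isomorphism, and
    it is the form in which quasi-isomorphisms are used. The degree [m] is a
    variable to avoid transports. *)
Definition acyclic_kernel : Prop := forall n m (x : X n), m = n + 1 ->
  (forall j, dX n j x = 0) -> f n n x = 0 ->
  exists2 y : X m, dX m n y = x & f m m y = 0.

Lemma cycle_all n (x : X n) : cycle dX x -> forall j, dX n j x = 0.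
Proof.
by move=> H j; have [->//|/ghom_shape->] := eqVneq j (n + -1).
Qed.

Lemma quasi_iso_acyclic_kernel :
  quasi_iso dX dY f -> surjective f -> acyclic_kernel.
Proof.
case=> fC f_inj f_surj fS n m x -> Hx fx.
have [|y0 Hy0] := f_inj n x (Hx _).
  by exists 0; rewrite ghom0 fx.
have cy0 : cycle dY (f (n + 1) (n + 1) y0).
  by rewrite /cycle -fC; move: (n + 1 - 1) (addrK 1 n) => m' ->; rewrite Hy0 fx.
have [z Hz [w Hw]] := f_surj _ _ cy0.
have [w' Hw'] := fS _ w.
exists (y0 - z + dX _ (n + 1) w').
  rewrite ghomD (lin_sub (@ghom_linear _ _ _ _ dX _ _)) diff_sq0 addr0 Hy0.
  by rewrite cycle_all // subr0.
rewrite ghomD (lin_sub (@ghom_linear _ _ _ _ f _ _)) fC Hw' Hw addrA.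
by rewrite subrK subrr.
Qed.

Lemma acyclic_kernel_quasi_iso :
  chain_map dX dY f -> surjective f -> acyclic_kernel -> quasi_iso dX dY f.
Proof.
move=> fC fS fK; split=> // n.
  move=> x cx [y Hy]; have [y' Hy'] := fS _ y.
  have [||z Hz fz] := fK n (n + 1) (x - dX (n + 1) n y') erefl.
  - move=> j; rewrite (lin_sub (@ghom_linear _ _ _ _ dX _ _)) diff_sq0 subr0.
    exact: cycle_all.
  - by rewrite (lin_sub (@ghom_linear _ _ _ _ f _ _)) fC Hy' Hy subrr.
  by exists (z + y'); rewrite ghomD Hz subrK.
move=> y cy; have [x Hx] := fS _ y.
have [|||z Hz fz] := fK (n - 1) n (dX n (n - 1) x).
- by rewrite subrK.
- by move=> j; rewrite diff_sq0.
- by rewrite fC Hx; exact: cy.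
exists (x - z); first by rewrite /cycle (lin_sub (@ghom_linear _ _ _ _ dX _ _)) Hz subrr.
exists 0; rewrite ghom0 (lin_sub (@ghom_linear _ _ _ _ f _ _)) fz subr0 Hx.
by rewrite subrr.
Qed.

End Kernel.

(** * The differential on multilinear functions *)

Section StrictCoder.
Variables (k : comPzRingType) (A : gmod k) (dA : differential (Pi A)).

Definition dletter (x : homog (Pi A)) : homog (Pi A) :=
  hel (dA (projT1 x) (projT1 x - 1) (projT2 x)).

Definition dcoder (V : lmodType k) (phi : word A -> V) : word A -> V :=
  coder (-1) (strict_fun dA) phi.

Lemma strict_letter x : letter (-1) (strict_fun dA) [:: x] = dletter x.
Proof. by rewrite (letterE (projT1 x - 1)) // degs1. Qed.

Lemma mlin_dcoder (V : lmodType k) (phi : word A -> V) : mlin phi -> mlin (dcoder phi).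
Proof. exact: (mlin_coder (strict_axiom dA)). Qed.

Lemma eq_dcoder (V : lmodType k) (phi phi' : word A -> V) s :
  (forall w, phi w = phi' w) -> dcoder phi s = dcoder phi' s.
Proof. by move=> H; apply: eq_coder => w _ _. Qed.

Lemma dcoder_comb (V : lmodType k) c (phi psi : word A -> V) s :
  dcoder (fun w => c *: phi w + psi w) s = c *: dcoder phi s + dcoder psi s.
Proof. exact: coder_comb. Qed.

Lemma dcoder_push (V W : lmodType k) (h : V -> W) (phi : word A -> V) s :
  lin h -> h (dcoder phi s) = dcoder (fun w => h (phi w)) s.
Proof. exact: coder_push. Qed.

Lemma dcoder_cons (V : lmodType k) (phi : word A -> V) x t : mlin phi ->
  dcoder phi (x :: t) =
    phi (dletter x :: t) + ksign k (projT1 x) *: dcoder (fun w => phi (x :: w)) t.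
Proof.
move=> Hphi; rewrite /dcoder coder_cons ksignN1 cut_first ?strict_letter //.
by move=> [|y a] b _ // _; apply: (letter_eq0 [::]).
Qed.

Lemma dcoder_eq0 (V : lmodType k) (phi : word A -> V) s : mlin phi ->
  (forall w, size w = size s -> degs w = degs s - 1 -> phi w = 0) -> dcoder phi s = 0.
Proof.
elim: s phi => // x t IH phi Hphi H.
rewrite dcoder_cons // IH ?scaler0 ?addr0; last 2 first.
- exact: mlin_tail.
- by move=> w Hw Ew; apply: H; rewrite ?degs_cons /= ?Hw ?Ew ?addrA.
by apply: H; rewrite ?degs_cons //= addrAC.
Qed.

Lemma eq_dcoder_size (V : lmodType k) (phi phi' : word A -> V) s : mlin phi -> mlin phi' ->
  (forall w, size w = size s -> phi w = phi' w) -> dcoder phi s = dcoder phi' s.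
Proof.
elim: s phi phi' => // x t IH phi phi' Hphi Hphi' H.
rewrite !dcoder_cons // H //; congr (_ + _ *: _).
apply: IH; [exact: mlin_tail|exact: mlin_tail|].
by move=> w Hw; apply: H; rewrite /= Hw.
Qed.

Lemma coder_zero d (nu : cochain A A) (V : lmodType k) (phi : word A -> V) s :
  mlin phi -> (forall w j, nu w j = 0) -> coder d nu phi s = 0.
Proof.
move=> Hphi H; elim: s phi Hphi => // x t IH phi Hphi.
rewrite coder_cons IH ?scaler0 ?addr0; last exact: mlin_tail.
by apply: cut_eq0 => a b _; apply: (letter_eq0 [::]).
Qed.

Lemma dcoder_dcoder (V : lmodType k) (phi : word A -> V) s : mlin phi ->
  dcoder (dcoder phi) s = 0.
Proof.
move=> Hphi; rewrite /dcoder (coder_coder (strict_axiom dA)) //.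
rewrite coder_zero // => w j.
have Hn := cochain_mlin (strict_axiom dA) j.
rewrite -/(dcoder _ _); case: w => [|x [|y t]] //.
  by rewrite dcoder_cons //= /dcoder /= scaler0 addr0 diff_sq0.
by rewrite dcoder_eq0 // => -[|z [|z' v]].
Qed.

Lemma dcoder_unitless (V : lmodType k) (one : A 0) (phi : word A -> V) :
  dA 1 0 one = 0 -> mlin phi -> unitless one phi -> unitless one (dcoder phi).
Proof.
move=> H0 Hphi H s1 s2; elim: s1 phi Hphi H => [|x s1 IH] phi Hphi H.
  rewrite [_ ++ _]/= dcoder_cons // dcoder_eq0 ?scaler0 ?addr0; last 2 first.
  - exact: mlin_tail.
  - by move=> w _ _; apply: (H [::]).
  by rewrite /dletter /= H0; apply: (mlin0 [::]).
rewrite [_ ++ _]/= dcoder_cons // IH ?scaler0 ?addr0; last 2 first.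
- exact: mlin_tail.
- by move=> t1 t2; apply: (H (x :: t1)).
exact: (H (_ :: s1)).
Qed.

End StrictCoder.

Section MultilinearMaps.
Variables (k : comPzRingType) (A : gmod k) (one : A 0) (X : gmod k) (l : nat).

(** The module Hom((Pi A / k[1])^{(x) l}, X)_d. A map out of the quotient and of the
    tensor power is given by the function on words that induces it, so that no
    reduced tensor power has to be constructed. *)
Record rmul (d : int) := RMul {
  rmul_fun :> word A -> forall j, X j;
  rmul_size : forall s j, size s <> l -> rmul_fun s j = 0;
  rmul_shape : forall s j, j != degs s + d -> rmul_fun s j = 0;
  rmul_mlin : forall j, mlin (rmul_fun ^~ j);
  rmul_unit : forall j, unitless one (rmul_fun ^~ j) }.

Variable d : int.
Implicit Types f g h : rmul d.

Lemma rmulP f g : (forall s j, f s j = g s j) -> f = g.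
Proof.
case: f g => [f f1 f2 f3 f4] [g g1 g2 g3 g4] /= fg.
have E : f = g.
  by apply: funext => s; apply: functional_extensionality_dep => j; apply: fg.
by subst g; congr RMul; apply: Prop_irrelevance.
Qed.

HB.instance Definition _ := gen_eqMixin (rmul d).
HB.instance Definition _ := gen_choiceMixin (rmul d).

Program Definition rmul_zero : rmul d := @RMul d (fun s j => 0) _ _ _ _.
Next Obligation. by move=> a u v w _; rewrite scaler0 addr0. Qed.
Next Obligation. by []. Qed.

Program Definition rmul_comb (c : k) f g : rmul d :=
  @RMul d (fun s j => c *: f s j + g s j) _ _ _ _.
Next Obligation. by rewrite !rmul_size ?scaler0 ?addr0. Qed.
Next Obligation. by rewrite !rmul_shape ?scaler0 ?addr0. Qed.
Next Obligation. by apply: mlin_comb; apply: rmul_mlin. Qed.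
Next Obligation. by move=> s1 s2; rewrite !rmul_unit ?scaler0 ?addr0. Qed.

Definition rmul_add f g := rmul_comb 1 f g.
Definition rmul_scale c f := rmul_comb c f rmul_zero.
Definition rmul_opp f := rmul_scale (-1) f.

Fact rmul_addA : associative rmul_add.
Proof. by move=> f g h; apply: rmulP => s j /=; rewrite !scale1r addrA. Qed.
Fact rmul_addC : commutative rmul_add.
Proof. by move=> f g; apply: rmulP => s j /=; rewrite !scale1r addrC. Qed.
Fact rmul_add0 : left_id rmul_zero rmul_add.
Proof. by move=> f; apply: rmulP => s j /=; rewrite scale1r add0r. Qed.
Fact rmul_addN : left_inverse rmul_zero rmul_opp rmul_add.
Proof. by move=> f; apply: rmulP => s j /=; rewrite scale1r addr0 scaleN1r addNr. Qed.
HB.instance Definition _ := GRing.isZmodule.Build (rmul d)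
  rmul_addA rmul_addC rmul_add0 rmul_addN.

Fact rmul_scaleA a b f : rmul_scale a (rmul_scale b f) = rmul_scale (a * b) f.
Proof. by apply: rmulP => s j /=; rewrite !addr0 scalerA. Qed.
Fact rmul_scale1 : left_id 1 rmul_scale.
Proof. by move=> f; apply: rmulP => s j /=; rewrite addr0 scale1r. Qed.
Fact rmul_scaleDr : right_distributive rmul_scale +%R.
Proof. by move=> a f g; apply: rmulP => s j /=; rewrite !addr0 !scale1r scalerDr. Qed.
Fact rmul_scaleDl f : {morph rmul_scale^~ f : a b / a + b}.
Proof. by move=> a b; apply: rmulP => s j /=; rewrite !addr0 scale1r scalerDl. Qed.
HB.instance Definition _ := GRing.Zmodule_isLmodule.Build k (rmul d)
  rmul_scaleA rmul_scale1 rmul_scaleDr rmul_scaleDl.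

Lemma rmulDE f g s j : (f + g) s j = f s j + g s j.
Proof. by rewrite /= scale1r. Qed.
Lemma rmulZE c f s j : (c *: f) s j = c *: f s j.
Proof. by rewrite /= addr0. Qed.
Lemma rmulBE f g s j : (f - g) s j = f s j - g s j.
Proof. by rewrite rmulDE -scaleN1r rmulZE scaleN1r. Qed.

End MultilinearMaps.

Section MultilinearComplex.
Variables (k : comPzRingType) (A : gmod k) (one : A 0) (dA : differential (Pi A)).
Hypothesis d_one : dA 1 0 one = 0.

Definition rmod (X : gmod k) (l : nat) : gmod k := fun d => rmul one X l d : lmodType k.

(* The operations of [rmod], whose carriers unfold to [rmul]. *)
Lemma rmodE X l d c (f g : rmod X l d) s j :
  rmul_fun (c *: f + g) s j = c *: rmul_fun f s j + rmul_fun g s j.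
Proof. by rewrite /= scale1r addr0. Qed.

Lemma rmodBE X l d (f g : rmod X l d) s j :
  rmul_fun (f - g) s j = rmul_fun f s j - rmul_fun g s j.
Proof. exact: rmulBE. Qed.

Lemma rmodZE X l d c (f : rmod X l d) s j : rmul_fun (c *: f) s j = c *: rmul_fun f s j.
Proof. exact: rmulZE. Qed.

Lemma rmod0E X l d s j : rmul_fun (0 : rmod X l d) s j = 0.
Proof. by []. Qed.

Section Differential.
Variables (X : gmod k) (dX : differential X) (l : nat).

Definition rbnd_fun d (F : word A -> forall j, X j) : word A -> forall j, X j :=
  fun s j => dX (j + 1) j (F s (j + 1)) - ksign k d *: dcoder dA (F ^~ j) s.

Program Definition rbnd d e (F : rmul one X l d) : rmul one X l e :=
  @RMul k A one X l e (fun s j => if e == d - 1 then rbnd_fun d F s j else 0) _ _ _ _.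
Next Obligation.
case: ifP => // _; rewrite /rbnd_fun rmul_size // ghom0 dcoder_eq0 ?scaler0 ?subrr //.
  exact: rmul_mlin.
by move=> w Hw _; rewrite rmul_size ?Hw.
Qed.
Next Obligation.
case: ifP => // /eqP E; rewrite /rbnd_fun rmul_shape; last first.
  by apply: contraNneq H; rewrite E => Ej; apply/eqP; lia.
rewrite ghom0 dcoder_eq0 ?scaler0 ?subrr //; first exact: rmul_mlin.
move=> w _ Ew; rewrite rmul_shape // Ew.
by apply: contraNneq H; rewrite E => Ej; apply/eqP; lia.
Qed.
Next Obligation.
move=> a u v w E; case: ifP => _; last by rewrite scaler0 addr0.
rewrite /rbnd_fun.
rewrite (rmul_mlin F _ E) (@ghom_linear _ _ _ _ dX).
rewrite (mlin_dcoder dA (rmul_mlin F j) E).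
exact: scale_comb_sub.
Qed.
Next Obligation.
move=> s1 s2; case: ifP => // _; rewrite /rbnd_fun rmul_unit ghom0.
rewrite dcoder_unitless ?scaler0 ?subrr //; first exact: rmul_mlin.
exact: rmul_unit.
Qed.

Lemma rbndE d e (F : rmul one X l d) s j :
  rmul_fun (rbnd e F) s j = if e == d - 1 then rbnd_fun d F s j else 0.
Proof. by []. Qed.

Program Definition rdiff_hom : ghom (rmod X l) (rmod X l) (-1) :=
  @GHom k (rmod X l) (rmod X l) (-1) rbnd _ _.
Next Obligation.
apply: rmulP => s e; rewrite rmodE !rbndE.
case: ifP => _; last by rewrite scaler0 addr0.
rewrite /rbnd_fun -scale_comb_sub rmodE (@ghom_linear _ _ _ _ dX) -dcoder_comb.
by congr (_ - _ *: _); apply: eq_dcoder => w; rewrite rmodE.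
Qed.
Next Obligation. by apply: rmulP => s e /=; rewrite (negPf H). Qed.

Program Definition rdiff : differential (rmod X l) :=
  @Differential k (rmod X l) rdiff_hom _.
Next Obligation.
apply: rmulP => s e; rewrite rbndE; case: ifP => // _.
have [Ej|Nj] := eqVneq j (i - 1); last first.
  have E0 : rbnd j x = rmul_zero one X l j by apply: rmulP => w e'; rewrite rbndE (negPf Nj).
  rewrite /rbnd_fun E0 ghom0 dcoder_eq0 ?scaler0 ?subrr //.
  by move=> a u v w _; rewrite scaler0 addr0.
have Ex w e' : rmul_fun (rbnd j x) w e' = rbnd_fun i x w e' by rewrite rbndE Ej eqxx.
rewrite {1}/rbnd_fun Ex (@eq_dcoder _ _ _ _ _ ((rbnd_fun i x)^~ e)) //.
rewrite {1}/rbnd_fun (lin_sub (@ghom_linear _ _ _ _ dX _ _)) diff_sq0 sub0r.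
rewrite (lin_scale (@ghom_linear _ _ _ _ dX _ _)).
rewrite (dcoder_push _ _ _ (@ghom_linear _ _ _ _ dX _ _)).
rewrite [X in _ - _ *: X](@eq_dcoder _ _ _ _ _ (fun w => - ksign k i *: dcoder dA (x^~ e) w +
    dX (e + 1) e (x w (e + 1)))); last by move=> w; rewrite /rbnd_fun scaleNr [RHS]addrC.
rewrite dcoder_comb dcoder_dcoder ?scaler0 ?add0r; last exact: rmul_mlin.
by rewrite Ej ksignD [ksign k (-1)]ksignN ksign1 mulrN1 scaleNr opprK addNr.
Qed.

Lemma rdiffE d e (F : rmod X l d) s j : e = d - 1 ->
  rmul_fun (rdiff d e F) s j =
    dX (j + 1) j (rmul_fun F s (j + 1)) - ksign k d *: dcoder dA ((rmul_fun F)^~ j) s.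
Proof. by move=> ->; rewrite /= eqxx. Qed.

End Differential.

Section Functoriality.
Variables (X Y : gmod k) (l : nat) (f : ghom X Y 0).

Program Definition rmap_fun d e (F : rmul one X l d) : rmul one Y l e :=
  @RMul k A one Y l e (fun s j => if e == d then f j j (F s j) else 0) _ _ _ _.
Next Obligation. by case: ifP => // _; rewrite rmul_size // ghom0. Qed.
Next Obligation. by case: ifP => // /eqP E; rewrite rmul_shape -?E // ghom0. Qed.
Next Obligation.
move=> a u v w E; case: ifP => _; last by rewrite scaler0 addr0.
by rewrite (rmul_mlin F _ E) (@ghom_linear _ _ _ _ f).
Qed.
Next Obligation. by move=> s1 s2; case: ifP => // _; rewrite rmul_unit ghom0. Qed.

Lemma rmap_funE d e (F : rmul one X l d) s j :
  rmul_fun (rmap_fun e F) s j = if e == d then f j j (F s j) else 0.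
Proof. by []. Qed.

Program Definition rmap : ghom (rmod X l) (rmod Y l) 0 :=
  @GHom k (rmod X l) (rmod Y l) 0 rmap_fun _ _.
Next Obligation.
apply: rmulP => s e; rewrite rmodE !rmap_funE.
case: ifP => _; last by rewrite scaler0 addr0.
by rewrite rmodE (@ghom_linear _ _ _ _ f).
Qed.
Next Obligation.
by apply: rmulP => s e; rewrite rmap_funE; rewrite addr0 in H; rewrite (negPf H).
Qed.

Lemma rmapE d (F : rmod X l d) s j : rmul_fun (rmap d d F) s j = f j j (rmul_fun F s j).
Proof. by rewrite /= eqxx. Qed.

End Functoriality.

Lemma rmap_chain (X Y : gmod k) (dX : differential X) (dY : differential Y) l
    (f : ghom X Y 0) :
  chain_map dX dY f -> chain_map (rdiff dX l) (rdiff dY l) (rmap l f).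
Proof.
move=> fC i j F; apply: rmulP => s e; rewrite rmapE.
have [Ej|Nj] := eqVneq j (i - 1); last by rewrite /= (negPf Nj) ghom0.
rewrite !rdiffE // (lin_sub (@ghom_linear _ _ _ _ f _ _)).
rewrite (lin_scale (@ghom_linear _ _ _ _ f _ _)) (dcoder_push _ _ _ (@ghom_linear _ _ _ _ f _ _)).
rewrite rmapE fC; congr (_ - _ *: _); apply: eq_dcoder => w.
by rewrite rmapE.
Qed.

End MultilinearComplex.

Section SplitCoordinate.
Variables (k : comPzRingType) (A : gmod k) (u : split_element A).

(** The splitting A -> k, extended by zero outside degree 0. *)
Definition coord0 n : A n -> k :=
  match n return A n -> k with Posz 0 => split_map u | _ => fun _ => 0 end.

Definition coord i (x : Pi A i) : k := coord0 x.

Lemma coord_lin i : lin (coord (i := i) : _ -> k^o).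
Proof.
rewrite /coord /Pi => a x y; move: (i - 1) x y => -[[|n]|n] x y /=.
- exact: linearP.
- by rewrite scaler0 addr0.
- by rewrite scaler0 addr0.
Qed.

Lemma coord_shape i (x : Pi A i) : i != 1 -> coord x = 0.
Proof.
rewrite -subr_eq0 /coord /Pi in x *.
by move: (i - 1) x => -[[|n]|n].
Qed.

Lemma coord_one : @coord 1 (split_one u) = 1.
Proof. exact: split_mapK. Qed.

End SplitCoordinate.

Lemma gid_id (k : comPzRingType) (M : gmod k) i (x : M i) : gid M i i x = x.
Proof. by rewrite /= /gid_fun; case: eqP => // e; rewrite (eq_axiomK e). Qed.

Lemma gid_ne (k : comPzRingType) (M : gmod k) i j (x : M i) : i <> j -> gid M i j x = 0.
Proof. by move=> H; rewrite /= /gid_fun; case: eqP. Qed.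

Section Constants.
Variables (k : comPzRingType) (A : gmod k) (one : A 0) (X : gmod k) (d : int) (x : X d).

(** The zeroth tensor power is k in degree 0, so a function of degree [d] on it is
    an element of [X d]; [gid] moves this element to every degree. *)
Program Definition const_rmul : rmod one X 0 d :=
  @RMul k A one X 0 d (fun s j => if s is [::] then gid X d j x else 0) _ _ _ _.
Next Obligation. by case: s H. Qed.
Next Obligation.
case: s H => // H; apply: gid_ne => E; move: H.
by rewrite E degs_nil add0r eqxx.
Qed.
Next Obligation. by move=> a v w z [] *; rewrite scaler0 addr0. Qed.
Next Obligation. by case. Qed.

Lemma const_rmul_nil j : rmul_fun const_rmul [::] j = gid X d j x.
Proof. by []. Qed.

Lemma const_rmul_cons y t j : rmul_fun const_rmul (y :: t) j = 0.
Proof. by []. Qed.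

End Constants.

Lemma hom_postE (k : comPzRingType) (P X Y : gmod k) (f : ghom X Y 0) n
    (g : ghom P X n) i j x :
  hom_post P f n n g i j x = f j j (g i j x).
Proof. by rewrite /= eqxx. Qed.

Lemma hom_diffE (k : comPzRingType) (P X : gmod k) (dP : differential P)
    (dX : differential X) n m (g : ghom P X n) i j x : m = n - 1 ->
  hom_diff dP dX n m g i j x =
    dX (j + 1) j (g i (j + 1) x) - ksign k n *: g (i - 1) j (dP i (i - 1) x).
Proof. by move=> ->; rewrite /= eqxx. Qed.

Section Currying.
Variables (k : comPzRingType) (A : gmod k) (one : A 0) (dA : differential (Pi A)).
Hypothesis d_one : dA 1 0 one = 0.
Variables (X : gmod k) (dX : differential X) (l : nat).

Notation RM := (rmod one X).

Program Definition curry_fun d (F : RM l.+1 d) i j (x : Pi A i) : RM l j :=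
  @RMul k A one X l j
    (fun s e => if j == i + d then rmul_fun F (hel x :: s) e else 0) _ _ _ _.
Next Obligation. by case: ifP => // _; rewrite rmul_size //= => -[]. Qed.
Next Obligation.
case: ifP => // /eqP E; rewrite rmul_shape // degs_cons.
by apply: contraNneq H => ->; rewrite E addrCA addrA.
Qed.
Next Obligation.
move=> a v w z E; case: ifP => _; last by rewrite scaler0 addr0.
exact: (rmul_mlin F _ (lin3_tail (hel x) E)).
Qed.
Next Obligation. by move=> s1 s2; case: ifP => // _; apply: (rmul_unit F _ (hel x :: s1)). Qed.

Program Definition curry d (F : RM l.+1 d) : ghom (Pi A) (RM l) d :=
  @GHom k (Pi A) (RM l) d (curry_fun F) _ _.
Next Obligation.
apply: rmulP => s e; rewrite rmodE /=; case: ifP => _; last by rewrite scaler0 addr0.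
exact: (rmul_mlin F e (lin3_head a x y s)).
Qed.
Next Obligation. by apply: rmulP => s e /=; rewrite (negPf H). Qed.

Lemma curryE d (F : RM l.+1 d) i j (x : Pi A i) s e : j = i + d ->
  rmul_fun (curry F i j x) s e = rmul_fun F (hel x :: s) e.
Proof. by move=> ->; rewrite /= eqxx. Qed.

Section Uncurry.
Variables (d : int) (h : ghom (Pi A) (RM l) d).
Hypothesis h_one : forall j, h 1 j one = 0.

(** The adjunction Hom(T (x) S, X) = Hom(T, Hom(S, X)), restricted to the maps that
    vanish on [1] in the first tensor factor. *)
Program Definition uncurry : RM l.+1 d :=
  @RMul k A one X l.+1 d (fun s e => if s is x :: t then
     rmul_fun (h (projT1 x) (projT1 x + d) (projT2 x)) t e else 0) _ _ _ _.
Next Obligation.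
by case: s H => // x t H; rewrite rmul_size // => E; apply: H; rewrite /= E.
Qed.
Next Obligation.
case: s H => // x t H; rewrite rmul_shape //.
by apply: contraNneq H => ->; rewrite degs_cons addrCA addrA.
Qed.
Next Obligation.
move=> a v w z [i x y t|x v' w' z' E] /=.
  by rewrite (@ghom_linear _ _ _ _ h) rmodE.
exact: (rmul_mlin _ _ E).
Qed.
Next Obligation.
move=> [|x s1] s2 /=; first by rewrite h_one.
exact: rmul_unit.
Qed.

Lemma uncurryE i (x : Pi A i) t j e : j = i + d ->
  rmul_fun uncurry (hel x :: t) e = rmul_fun (h i j x) t e.
Proof. by move=> ->. Qed.

Lemma rdiff_uncurry d' i (x : Pi A i) t e : d' = d - 1 ->
  rmul_fun (rdiff d_one dX l.+1 d d' uncurry) (hel x :: t) e =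
  rmul_fun (hom_diff dA (rdiff d_one dX l) d d' h i (i + d') x) t e.
Proof.
move=> ->; rewrite rdiffE // dcoder_cons; last exact: rmul_mlin.
rewrite hom_diffE // rmodBE rmodZE rdiffE ?addrK //=.
have -> : i + (d - 1) + 1 = i + d by lia.
have -> : i - 1 + d = i + (d - 1) by lia.
by rewrite scalerDr scalerA -ksignD [d + i]addrC opprD addrA addrAC.
Qed.

End Uncurry.

Lemma curry_one d (F : RM l.+1 d) j : curry F 1 j one = 0.
Proof.
by apply: rmulP => s e /=; case: ifP => // _; apply: (rmul_unit F e [::]).
Qed.

Lemma curryK d (F : RM l.+1 d) : uncurry (curry_one F) = F.
Proof.
apply: rmulP => -[|[i x] t] e; first by rewrite !rmul_size.
by rewrite (uncurryE _ _ _ _ erefl) curryE.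
Qed.

End Currying.

(** * Semiprojectivity of the reduced tensor powers *)

Section Semiprojective.
Variables (k : comPzRingType) (A : gmod k) (u : split_element A).
Variable (dA : differential (Pi A)).
Hypothesis d_one : dA 1 0 (split_one u) = 0.
Hypothesis dA_semi : semiprojective dA.

Section Correction.
Variable Z : gmod k.

(** As the family [y] is concentrated in one degree, this is the map that sends [1]
    to [y] and is zero on the kernel of the splitting. *)
Program Definition coord_times d (y : forall j, Z j)
    (y_shape : forall j, j != 1 + d -> y j = 0) : ghom (Pi A) Z d :=
  @GHom k (Pi A) Z d (fun i j x => coord u x *: y j) _ _.
Next Obligation. by rewrite coord_lin scalerDl -scalerA. Qed.
Next Obligation.
have [Ei|Ni] := eqVneq i 1; last by rewrite coord_shape ?scale0r.
by rewrite y_shape ?scaler0 // -Ei.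
Qed.

End Correction.

Variables (X Y : gmod k) (dX : differential X) (dY : differential Y) (f : ghom X Y 0).
Hypothesis f_qi : quasi_iso dX dY f.
Hypothesis f_surj : surjective f.

Notation one := (split_one u).
Notation RM := (rmod one).

Lemma rmap_surjective0 : surjective (rmap one 0 f).
Proof.
move=> d G; have [x Hx] := f_surj (rmul_fun G [::] d).
exists (const_rmul _ x); apply: rmulP => s j; rewrite rmapE.
case: s => [|y t]; last by rewrite const_rmul_cons ghom0 rmul_size.
rewrite const_rmul_nil; have [<-|/eqP N] := eqVneq d j; first by rewrite gid_id.
rewrite gid_ne // ghom0 rmul_shape // degs_nil add0r.
by apply/eqP => E; apply: N.
Qed.

Lemma rmap_acyclic0 : acyclic_kernel (rdiff d_one dX 0) (rmap one 0 f).
Proof.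
move=> d m F -> cF fF.
have [|||y Hy fy] := @quasi_iso_acyclic_kernel _ _ _ _ _ _ f_qi f_surj d (d + 1) (rmul_fun F [::] d).
- by [].
- move=> j; have [->|N] := eqVneq j (d - 1); last by rewrite ghom_shape.
  have := congr1 (fun H : RM X 0 (d - 1) => rmul_fun H [::] (d - 1)) (cF (d - 1)).
  by rewrite rdiffE // rmod0E /dcoder /= scaler0 subr0 subrK.
- by have := congr1 (fun H : RM Y 0 d => rmul_fun H [::] d) fF; rewrite rmapE.
exists (const_rmul _ y); apply: rmulP => s j; last first.
  rewrite rmapE; case: s => [|z t]; last by rewrite const_rmul_cons ghom0.
  rewrite const_rmul_nil; have [<-|/eqP N] := eqVneq (d + 1) j.
    by rewrite gid_id fy.
  by rewrite gid_ne // ghom0.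
rewrite rdiffE ?addrK //; case: s => [|z t]; last first.
  rewrite const_rmul_cons ghom0 rmul_size // dcoder_eq0 ?scaler0 ?subrr //.
    exact: rmul_mlin.
  by case.
rewrite const_rmul_nil /dcoder [coder _ _ _ _]/= scaler0 subr0; have [<-|N] := eqVneq d j; first by rewrite gid_id.
rewrite [RHS]rmul_shape; last by rewrite degs_nil add0r eq_sym.
rewrite gid_ne ?ghom0 // => /addIr E.
by rewrite E eqxx in N.
Qed.


(** Reduced tensor powers of Pi A are semiprojective. By induction on the length and
    the tensor-Hom adjunction, only maps out of Pi A that vanish on [1] have to be
    lifted. Semiprojectivity of Pi A gives a lift [h], or a bounding map [g], whose
    value on [1] may be nonzero. For the lift, the map sending [1] to [h 1] through
    the splitting is subtracted. The value [g 1] is a cycle in the kernel, as [1] is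
    a cycle, hence it is the boundary of some [y], and the boundary of the map
    sending [1] to [y] is subtracted. *)
Lemma rmap_surjective_acyclic l :
  surjective (rmap one l f) /\ acyclic_kernel (rdiff d_one dX l) (rmap one l f).
Proof.
elim: l => [|l [IHs IHk]]; first by split; [exact: rmap_surjective0 | exact: rmap_acyclic0].
have fC : chain_map dX dY f by case: f_qi.
have qi := acyclic_kernel_quasi_iso (rmap_chain d_one fC) IHs IHk.
have [Hqi Hs] := dA_semi qi IHs.
have Hk := quasi_iso_acyclic_kernel Hqi Hs.
split.
  move=> d G; have [h Hh] := Hs d (curry G).
  have hE i j x : rmap one l f j j (h i j x) = curry G i j x by rewrite -Hh hom_postE.
  have y_shape j : j != 1 + d -> h 1 j one = 0 by move=> H; rewrite ghom_shape.
  pose h' : ghom (Pi A) (RM X l) d := h - coord_times y_shape.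
  have h'_one j : h' 1 j one = 0 by rewrite /= coord_one scale1r subrr.
  exists (uncurry h'_one); apply: rmulP => -[|[i x] t] e; rewrite rmapE.
    by rewrite ghom0 rmul_size.
  rewrite (uncurryE h'_one _ _ _ erefl).
  have -> : h' i (i + d) x = h i (i + d) x - coord u x *: h 1 (i + d) one by [].
  rewrite rmodBE rmodZE (lin_sub (@ghom_linear _ _ _ _ f _ _)).
  rewrite (lin_scale (@ghom_linear _ _ _ _ f _ _)) -!rmapE !hE curryE //.
  by rewrite curry_one rmod0E scaler0 subr0.
move=> d m F -> cF fF.
have [|||g Hg fg] := Hk d (d + 1) (curry F).
- by [].
- move=> e; apply: ghomP => i j x.
  have [Ee|Ne] := eqVneq e (d - 1); last by rewrite /= (negPf Ne).
  have [Ej|Nj] := eqVneq j (i + e); last by rewrite ghom_shape.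
  rewrite Ej; apply: rmulP => t e'.
  by rewrite -(rdiff_uncurry d_one dX (curry_one F) _ _ _ Ee) curryK cF.
- apply: ghomP => i j x; rewrite hom_postE; apply: rmulP => t e; rewrite rmapE.
  have [Ej|Nj] := eqVneq j (i + d); last by rewrite (ghom_shape (curry F)) // rmod0E ghom0.
  by rewrite curryE // -rmapE fF.
pose D := d + 1 + 1.
have g1K j : rdiff d_one dX l (1 + (d + 1)) j (g 1 (1 + (d + 1)) one) = 0.
  have [->|N] := eqVneq j (1 + d); last first.
    by rewrite ghom_shape //; apply: contraNneq N => ->; apply/eqP; lia.
  have := congr1 (fun H : ghom (Pi A) (RM X l) d => H 1 (1 + d) one) Hg.
  rewrite curry_one hom_diffE ?addrK //.
  rewrite [dA 1 _ _]d_one ghom0 scaler0 subr0.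
  by have -> : 1 + d + 1 = 1 + (d + 1) by lia.
have [|||y Hy fy] := IHk (1 + (d + 1)) (1 + D) (g 1 (1 + (d + 1)) one).
- by rewrite addrA.
- exact: g1K.
- have := congr1 (fun H : ghom (Pi A) (RM Y l) (d + 1) => H 1 (1 + (d + 1)) one) fg.
  by rewrite hom_postE.
have y_shape j : j != 1 + D -> gid (RM X l) (1 + D) j y = 0.
  by move=> H; apply: gid_ne => E; rewrite E eqxx in H.
pose c := coord_times y_shape.
pose g' : ghom (Pi A) (RM X l) (d + 1) := g - hom_diff dA (rdiff d_one dX l) D (d + 1) c.
have g'_one j : g' 1 j one = 0.
  have [->|N] := eqVneq j (1 + (d + 1)); last by rewrite ghom_shape.
  have -> : g' 1 (1 + (d + 1)) one = g 1 (1 + (d + 1)) one -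
     hom_diff dA (rdiff d_one dX l) D (d + 1) c 1 (1 + (d + 1)) one by [].
  have -> : hom_diff dA (rdiff d_one dX l) D (d + 1) c 1 (1 + (d + 1)) one =
      rdiff d_one dX l (1 + D) (1 + (d + 1)) y.
    rewrite hom_diffE ?addrK // [dA 1 _ _]d_one ghom0 scaler0 subr0.
    have -> : 1 + (d + 1) + 1 = 1 + D by rewrite -addrA.
    have -> : c 1 (1 + D) one = @coord k A u 1 one *: gid (RM X l) (1 + D) (1 + D) y by [].
    by rewrite coord_one scale1r gid_id.
  by rewrite Hy subrr.
exists (uncurry g'_one); apply: rmulP => -[|[i x] t] e.
- by rewrite !rmul_size.
- rewrite rdiff_uncurry ?addrK //.
  rewrite (lin_sub (@ghom_linear _ _ _ _ (hom_diff dA (rdiff d_one dX l)) _ _)).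
  by rewrite diff_sq0 subr0 Hg curryE.
- by rewrite rmapE !rmul_size // ghom0.
rewrite rmapE (uncurryE _ _ _ _ erefl) -rmapE -hom_postE.
rewrite (lin_sub (@ghom_linear _ _ _ _ (hom_post (Pi A) (rmap one l f)) _ _)) fg.
case: Hqi => pC _ _; rewrite pC.
have -> : hom_post (Pi A) (rmap one l f) D D c = 0.
  apply: ghomP => i' j' x'; rewrite hom_postE.
  have -> : c i' j' x' = coord u x' *: gid (RM X l) (1 + D) j' y by [].
  rewrite (lin_scale (@ghom_linear _ _ _ _ (rmap one l f) _ _)).
  have [<-|/eqP N] := eqVneq (1 + D) j'; first by rewrite gid_id fy scaler0.
  by rewrite gid_ne // ghom0 scaler0.
by rewrite ghom0 subr0.
Qed.

End Semiprojective.

(** * Dependence on the component of highest tensor degree *)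

Definition agree (k : comPzRingType) (A B : gmod k) n (f g : cochain A B) : Prop :=
  forall s j, (size s < n)%N -> f s j = g s j.

Lemma agree_letter (k : comPzRingType) (A B : gmod k) n (f g : cochain A B) d s :
  agree n f g -> (size s < n)%N -> letter d f s = letter d g s.
Proof. by move=> H Hs; rewrite /letter H. Qed.

Section Top.
Variables (k : comPzRingType) (A B : gmod k) (V : lmodType k).

Lemma cut1_last (T : Type) (psi psi' : seq T -> seq T -> V) s : s <> [::] ->
  (forall a b, a ++ b = s -> a <> [::] -> b <> [::] -> psi a b = psi' a b) ->
  cut1 psi s - cut1 psi' s = psi s [::] - psi' s [::].
Proof.
case: s => // x t _ H; rewrite -[cut1 psi _]/(cut _ t) -[cut1 psi' _]/(cut _ t).
rewrite addrC -scaleN1r -cut_comb cut_last; first by rewrite scaleN1r addrC.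
by move=> a b E Hb; rewrite scaleN1r (H (x :: a) b) ?addNr //= E.
Qed.

Lemma agree_comor (alpha beta : cochain A B) (phi : word B -> V) s n :
  agree n alpha beta -> (size s < n)%N -> comor alpha phi s = comor beta phi s.
Proof.
move=> H; elim: n {-2}n (leqnn n) s phi H => [|N IH] n Hn [|x t] phi H Hs //.
  by move: Hs; case: n Hn H.
rewrite !comor_cons; apply: eq_cut => a b E.
have Ha : (size (x :: a) < n)%N by move: Hs; rewrite -E /= size_cat; lia.
rewrite (agree_letter _ H Ha); apply: (IH n.-1); first by lia.
  by move=> s j Hj; apply: H; lia.
by move: Hs; rewrite -E /= size_cat; lia.
Qed.

(** A decomposition into at least two blocks only involves the values of [alpha] on
    shorter words. *)
Lemma comor_top (alpha beta : cochain A B) (phi : word B -> V) s : s <> [::] ->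
  agree (size s) alpha beta ->
  comor alpha phi s - comor beta phi s =
    phi [:: letter 0 alpha s] - phi [:: letter 0 beta s].
Proof.
move=> Hs H; rewrite !comor_cut1 // cut1_last // => a b E Ha Hb.
have [Sa Sb] : (size a < size s)%N /\ (size b < size s)%N.
  by rewrite -E size_cat; case: a b Ha Hb {E} => [|x a] [|y b] //= _ _; lia.
by rewrite (agree_letter _ H Sa); apply: agree_comor H Sb.
Qed.

Lemma bicoder_top (alpha beta : cochain A B) d (r r' : cochain A B)
    (phi : word B -> V) s :
  agree (size s) r r' -> s <> [::] ->
  bicoder alpha beta d r phi s - bicoder alpha beta d r' phi s =
    phi [:: letter d r s] - phi [:: letter d r' s].
Proof.
move=> H Hs.
have agr n w psi : agree n r r' -> (size w < n)%N ->
    bicoder alpha beta d r psi w = bicoder alpha beta d r' psi w.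
  move=> Hr; elim: n {-2}n (leqnn n) w psi Hr => [|N IH] n Hn [|x t] psi Hr Hw.
  - by rewrite !bicoder_nil.
  - by move: Hw; case: n Hn {Hr}.
  - by rewrite !bicoder_nil.
  rewrite !bicoder_cons; apply: eq_cut => a b E.
  have Ha : (size (x :: a) < n)%N by move: Hw; rewrite -E /= size_cat; lia.
  rewrite (agree_letter _ Hr Ha); congr (_ + _ *: _); apply: (IH n.-1); first by lia.
    by move=> s' j Hj; apply: Hr; lia.
  by move: Hw; rewrite -E /= size_cat; lia.
rewrite !bicoder_cut1 cut1_last //.
  by rewrite !comor_nil !bicoder_nil scaler0 !addr0.
move=> a b E Ha Hb.
have [Sa Sb] : (size a < size s)%N /\ (size b < size s)%N.
  by rewrite -E size_cat; case: a b Ha Hb {E} => [|x a] [|y b] //= _ _; lia.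
by rewrite (agree_letter _ H Sa) (agr _ _ _ _ H Sb).
Qed.

Lemma coder_top d (nu nu' : cochain A A) (phi : word A -> V) s :
  agree (size s) nu nu' -> s <> [::] ->
  coder d nu phi s - coder d nu' phi s = phi [:: letter d nu s] - phi [:: letter d nu' s].
Proof.
move=> H Hs.
have agr n w psi : agree n nu nu' -> (size w < n)%N ->
    coder d nu psi w = coder d nu' psi w.
  move=> Hr; elim: w n psi Hr => [|x t IH] n psi Hr Hw //.
  rewrite !coder_cons; congr (_ + _ *: _); last by apply: (IH n) => //; apply: ltnW.
  apply: eq_cut => a b E; rewrite (@agree_letter _ _ _ _ _ _ _ (x :: a) Hr) //.
  by move: Hw; rewrite -E /= size_cat; lia.
case: s Hs H => // x t _ H; rewrite !coder_cons.
rewrite (agr _ _ t _ H) // opprD addrACA subrr addr0.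
rewrite -/(cut1 (fun a b => phi (letter d nu a :: b)) (x :: t)).
rewrite -/(cut1 (fun a b => phi (letter d nu' a :: b)) (x :: t)).
rewrite cut1_last // => a b E _ Hb; rewrite (agree_letter _ H) // -E size_cat.
by case: b Hb {E} => //= y b _; lia.
Qed.

Lemma coder_leading d (nu : cochain A A) (phi : word A -> V) s :
  mlin phi -> (forall w j, (size w < size s)%N -> nu w j = 0) -> s <> [::] ->
  coder d nu phi s = phi [:: letter d nu s].
Proof.
move=> Hphi H Hs; have := @coder_top d nu (fun w j => 0) phi s H Hs.
rewrite (@coder_zero _ _ _ (fun _ _ => 0)) // subr0 => ->.
by rewrite [X in _ - X](letter_eq0 [::]) // subr0.
Qed.

(** An argument of [nu] of length at least two shortens the word, so that only the
    linear part of [nu] reaches a function supported in maximal length. *)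
Lemma coder_dcoder (nu : cochain A A) (dA : differential (Pi A)) (phi : word A -> V) s :
  (forall i j (x : Pi A i), nu [:: hel x] j = dA i j x) -> mlin phi ->
  (forall w, (size w < size s)%N -> phi w = 0) ->
  coder (-1) nu phi s = dcoder dA phi s.
Proof.
move=> Hd; elim: s phi => // x t IH phi Hphi H.
rewrite coder_cons dcoder_cons // ksignN1 IH; last 2 first.
- exact: mlin_tail.
- by move=> w Hw; apply: H.
congr (_ + _); rewrite cut_first.
  congr (phi (_ :: _)); case: x {H} => i x.
  by rewrite (letterE (i - 1)) ?degs1 // Hd.
move=> [|y a] b E // _; apply: H.
by rewrite -E /= size_cat; lia.
Qed.

End Top.

(** The degree of the letter and the degree [j] need not match, in which case both
    sides vanish. *)
Lemma linear_letter (k : comPzRingType) (A B : gmod k) (nu : cochain B B)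
    (dB : differential (Pi B)) d (r : cochain A B) s j :
  (forall i j (x : Pi B i), nu [:: hel x] j = dB i j x) ->
  (forall j, j != degs s + d -> r s j = 0) ->
  nu [:: letter d r s] j = dB (j + 1) j (r s (j + 1)).
Proof.
move=> Hd Hr; have [E|N] := eqVneq (j + 1) (degs s + d).
  by rewrite (letterE (j + 1)) // Hd.
rewrite (Hr _ N) ghom0 Hd ghom_shape //.
by apply: contraNneq N => ->; rewrite subrK.
Qed.
Arguments linear_letter {k A B nu dB d r s j}.

(** * Leading terms of the obstructions are cycles *)

Section BicoderArgument.
Variables (k : comPzRingType) (A B : gmod k) (alpha beta : cochain A B) (d : int).
Variable V : lmodType k.

Lemma bicoder_sub_arg (r r' : cochain A B) (phi : word B -> V) s : mlin phi ->
  bicoder alpha beta d (fun w j => r w j - r' w j) phi s =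
  bicoder alpha beta d r phi s - bicoder alpha beta d r' phi s.
Proof.
have [n] := ubnP (size s); elim: n s phi => // n IH [|x t] phi Hn Hphi.
  by rewrite !bicoder_nil subr0.
rewrite !bicoder_cons -[X in _ = _ + X]scaleN1r addrC -cut_comb; apply: eq_cut => a b E.
rewrite IH; last first.
- exact: mlin_tail.
- by move: Hn; rewrite /= -E size_cat; lia.
pose h (y : Pi B (degs (x :: a) + d)) := comor beta (fun w => phi (hel y :: w)) b.
have Hh : lin h by apply: lin_comor => w; apply: mlin_head.
have -> : comor beta (fun w => phi (letter d (fun w j => r w j - r' w j) (x :: a) :: w)) b =
    h (r (x :: a) (degs (x :: a) + d)) - h (r' (x :: a) (degs (x :: a) + d)).
  by rewrite -(lin_sub Hh).
by rewrite scaleN1r scalerBr opprD addrACA [RHS]addrC addrACA.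
Qed.

Lemma bicoder_zero (phi : word B -> V) s : mlin phi ->
  bicoder alpha beta d (fun w j => 0) phi s = 0.
Proof.
move=> Hphi; set z : cochain A B := fun w j => 0.
have Ez : (fun w j => z w j - z w j) = z :> cochain A B.
  by apply: funext => w; apply: functional_extensionality_dep => j; rewrite subrr.
by rewrite -Ez bicoder_sub_arg // subrr.
Qed.

Lemma bicoder_leading (r : cochain A B) (phi : word B -> V) s : mlin phi ->
  (forall w j, (size w < size s)%N -> r w j = 0) -> s <> [::] ->
  bicoder alpha beta d r phi s = phi [:: letter d r s].
Proof.
move=> Hphi H Hs.
have := @bicoder_top _ _ _ _ alpha beta d r (fun w j => 0) phi s H Hs.
by rewrite bicoder_zero // subr0 [X in _ - X](letter_eq0 [::]) // subr0.
Qed.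

End BicoderArgument.

Section Obstructions.
Variables (k : comPzRingType).

Definition square (A : gmod k) (nu : cochain A A) : cochain A A :=
  fun s j => coder (-1) nu (nu ^~ j) s.

Lemma square_axiom (A : gmod k) (nu : cochain A A) :
  cochain_axiom (-1) nu -> cochain_axiom (-2) (square nu).
Proof.
move=> nu_ax; apply: cochain_axiomP => [j //|s j Hj|j].
  apply: (coder_shape nu_ax).
  by apply: contraNneq Hj => ->; apply/eqP; lia.
by apply: mlin_coder => //; apply: cochain_mlin nu_ax j.
Qed.

(** The two expressions of the triple composite of [nu] given by [coder_coder] have
    the leading terms [nu^1 (nu o nu)] and [(nu o nu) nu^1]. *)
Lemma square_cycle (A : gmod k) (nu : cochain A A) (dA : differential (Pi A)) s j :
  cochain_axiom (-1) nu -> (forall i j (x : Pi A i), nu [:: hel x] j = dA i j x) ->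
  (forall w j, (size w < size s)%N -> square nu w j = 0) -> s <> [::] ->
  dA (j + 1) j (square nu s (j + 1)) = dcoder dA ((square nu) ^~ j) s.
Proof.
move=> nu_ax Hd H Hs.
have sq_ax := square_axiom nu_ax.
have := coder_coder nu_ax s (cochain_mlin nu_ax j).
rewrite -/(square nu) [X in _ = X -> _]coder_leading //; last exact: cochain_mlin nu_ax j.
rewrite (linear_letter Hd); last by move=> j1 Hj; exact: (cochain_shape sq_ax Hj).
move=> <-; apply: coder_dcoder => //; first exact: cochain_mlin sq_ax j.
by move=> w Hw; apply: H.
Qed.

Variables (A B : gmod k) (nuA : cochain A A) (nuB : cochain B B).
Variables (dA : differential (Pi A)) (dB : differential (Pi B)).
Hypothesis nuA_ax : cochain_axiom (-1) nuA.
Hypothesis nuB_ax : cochain_axiom (-1) nuB.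
Hypothesis dA_nuA : forall i j (x : Pi A i), nuA [:: hel x] j = dA i j x.
Hypothesis dB_nuB : forall i j (x : Pi B i), nuB [:: hel x] j = dB i j x.
Hypothesis nuA_sq : forall s j, square nuA s j = 0.
Hypothesis nuB_sq : forall s j, square nuB s j = 0.

Lemma coder_coder0 (V : lmodType k) (phi : word A -> V) s : mlin phi ->
  coder (-1) nuA (coder (-1) nuA phi) s = 0.
Proof.
by move=> Hphi; rewrite coder_coder // coder_zero.
Qed.

Lemma defect_axiom (alpha : cochain A B) :
  cochain_axiom 0 alpha -> cochain_axiom (-1) (defect nuA nuB alpha).
Proof.
move=> alpha_ax; apply: cochain_axiomP => [j|s j Hj|j].
- by rewrite /defect comor_nil (cochain_nil nuB_ax) subr0.
- rewrite /defect comor_eq0 ?sub0r; last first.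
    by move=> w _ _ E; apply: (cochain_shape nuB_ax); rewrite E.
  rewrite (coder_shape alpha_ax) ?oppr0 //.
  by rewrite addr0.
- move=> a u v w E; rewrite /defect (mlin_comor alpha_ax (cochain_mlin nuB_ax j) E).
  rewrite (mlin_coder nuA_ax (cochain_mlin alpha_ax j) E).
  by rewrite opprD addrACA scalerBr.
Qed.

(** Apply [comor_coder] to [nuB]. Its left side vanishes as [nuB] squares to zero, and
    the two terms on its right have the two sides of the equation as leading terms. *)
Lemma defect_cycle (alpha : cochain A B) s j : cochain_axiom 0 alpha ->
  (forall w j, (size w < size s)%N -> defect nuA nuB alpha w j = 0) -> s <> [::] ->
  dB (j + 1) j (defect nuA nuB alpha s (j + 1)) =
    - dcoder dA ((defect nuA nuB alpha) ^~ j) s.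
Proof.
move=> alpha_ax H Hs.
have HnuB := cochain_mlin nuB_ax j; have Ha := cochain_mlin alpha_ax j.
have d_ax := defect_axiom alpha_ax.
have := comor_coder nuA nuB alpha_ax s HnuB.
rewrite [X in X = _](_ : _ = 0); last by apply: comor_eq0 => w _ _ _; apply: nuB_sq.
rewrite (eq_coder (fun w => defect nuA nuB alpha w j + coder (-1) nuA (alpha ^~ j) w));
  last by move=> w _ _; rewrite /defect subrK.
rewrite coderD coder_coder0 // addr0 bicoder_leading // (linear_letter dB_nuB); last first.
  by move=> j1 Hj; exact: (cochain_shape d_ax Hj).
rewrite (coder_dcoder dA_nuA); last by move=> w Hw; apply: H.
  by move/eqP; rewrite eq_sym addrC addr_eq0 => /eqP.
exact: cochain_mlin d_ax j.
Qed.

Variables (alpha beta r : cochain A B).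
Hypothesis alpha_ax : cochain_axiom 0 alpha.
Hypothesis beta_ax : cochain_axiom 0 beta.
Hypothesis r_ax : cochain_axiom 1 r.
Hypothesis alpha_mor : forall s j, defect nuA nuB alpha s j = 0.
Hypothesis beta_mor : forall s j, defect nuA nuB beta s j = 0.

Definition homotopy_obstruction : cochain A B :=
  fun s j => (alpha s j - beta s j) - homotopy_defect nuA nuB alpha beta r s j.

Lemma homotopy_obstruction_axiom : cochain_axiom 0 homotopy_obstruction.
Proof.
apply: cochain_axiomP => [j|s j Hj|j].
- rewrite /homotopy_obstruction /homotopy_defect bicoder_nil.
  by rewrite (cochain_nil alpha_ax) (cochain_nil beta_ax) subrr addr0 subr0.
- rewrite /homotopy_obstruction /homotopy_defect.
  rewrite (cochain_shape alpha_ax) // (cochain_shape beta_ax) // subrr sub0r.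
  rewrite bicoder_eq0 ?add0r; last first.
    move=> w _ E; apply: (cochain_shape nuB_ax); rewrite E.
    by apply: contraNneq Hj => ->; apply/eqP; lia.
  rewrite (coder_shape r_ax) ?oppr0 //.
  by apply: contraNneq Hj => ->; apply/eqP; lia.
- move=> a u v w E; rewrite /homotopy_obstruction /homotopy_defect.
  have Ha := cochain_mlin alpha_ax j; have Hb := cochain_mlin beta_ax j.
  rewrite (Ha _ _ _ _ E) (Hb _ _ _ _ E) (mlin_coder nuA_ax (cochain_mlin r_ax j) E).
  rewrite (mlin_bicoder alpha_ax beta_ax r_ax (cochain_mlin nuB_ax j) E).
  have sub x y z t : (a *: x + y) - (a *: z + t) = a *: (x - z) + (y - t) :> Pi B j.
    by rewrite scalerBr opprD addrACA.
  by rewrite sub addrACA -scalerDr sub.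
Qed.

(** Apply [bicoder_coder] and [comor_sub] to [nuB], and compare leading terms. *)
Lemma homotopy_cycle s j :
  (forall w j, (size w < size s)%N -> homotopy_obstruction w j = 0) -> s <> [::] ->
  dB (j + 1) j (homotopy_obstruction s (j + 1)) = dcoder dA (homotopy_obstruction ^~ j) s.
Proof.
move=> H Hs.
have HnuB := cochain_mlin nuB_ax j.
have o_ax := homotopy_obstruction_axiom.
have := @bicoder_sub_arg _ _ _ alpha beta 0 _ (fun w j => alpha w j - beta w j)
  (homotopy_defect nuA nuB alpha beta r) (nuB ^~ j) s HnuB.
rewrite -/homotopy_obstruction bicoder_leading // (linear_letter dB_nuB); last first.
  by move=> j1 Hj; exact: (cochain_shape o_ax Hj).
move=> ->; rewrite -comor_sub // -bicoder_coder //.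
rewrite [bicoder _ _ _ _ _ _](_ : _ = 0) ?add0r; last first.
  by apply: bicoder_eq0 => w _ _; apply: nuB_sq.
have comorE gamma : (forall s j, defect nuA nuB gamma s j = 0) ->
    comor gamma (nuB ^~ j) s = coder (-1) nuA (gamma ^~ j) s.
  by move=> /(_ s j) /eqP; rewrite subr_eq0 => /eqP.
rewrite (comorE _ alpha_mor) (comorE _ beta_mor) -(coder_dcoder dA_nuA); last 2 first.
- exact: cochain_mlin o_ax j.
- by move=> w Hw; apply: H.
rewrite /homotopy_obstruction /homotopy_defect.
have coderB (phi psi : word A -> Pi B j) : coder (-1) nuA (fun w => phi w - psi w) s =
    coder (-1) nuA phi s - coder (-1) nuA psi s.
  rewrite -[RHS]addrC -[X in X + _]scaleN1r -coder_comb.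
  by apply: eq_coder => w _ _; rewrite scaleN1r addrC.
by rewrite !coderB coderD coder_coder0 ?addr0 //; apply: cochain_mlin r_ax j.
Qed.

End Obstructions.

(** * Construction of cochains by induction on the tensor degree *)

(** Step [n] leaves the components of tensor degree at most [n] unchanged, so each
    component is eventually constant. *)
Lemma cochain_limit (k : comPzRingType) (A B : gmod k)
    (P : nat -> cochain A B -> Prop) (f0 : cochain A B) :
  P 0 f0 ->
  (forall n f, P n f -> exists f', P n.+1 f' /\ agree n.+1 f f') ->
  exists f, forall n, exists g, P n g /\ agree n.+1 f g.
Proof.
move=> P0 PS.
pose next n (F : {f | P n f}) : {f | P n.+1 f} :=
  let H := cid (PS n (sval F) (svalP F)) in exist _ (sval H) (proj1 (svalP H)).
pose seqF := fix seqF n : {f | P n f} :=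
  if n is m.+1 then next m (seqF m) else exist _ f0 P0.
have step n : agree n.+1 (sval (seqF n)) (sval (seqF n.+1)).
  by rewrite /= /next; case: (cid _) => f' [].
exists (fun s j => sval (seqF (size s)) s j) => n; exists (sval (seqF n)).
split; first exact: svalP.
move=> s j; rewrite ltnS => /subnKC <-; move: (n - size s)%N => m.
elim: m => [|m ->]; first by rewrite addn0.
by rewrite addnS; apply: step; rewrite ltnS leq_addr.
Qed.

Section StrictCochain.
Variables (k : comPzRingType) (A B C : gmod k) (q : ghom (Pi A) (Pi B) 0).

Lemma strict_fun_letter d (f : cochain C A) s j : cochain_axiom d f ->
  strict_fun q [:: letter d f s] j = q j j (f s j).
Proof.
move=> f_ax; have [->|N] := eqVneq j (degs s + d); first by [].
rewrite (cochain_shape f_ax N) ghom0 /= ghom_shape // addr0.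
by [].
Qed.

Lemma strict_fun_ne1 d (f : ghom (Pi A) (Pi B) d) s j :
  size s <> 1%N -> strict_fun f s j = 0.
Proof. by case: s => [|x [|y s]]. Qed.

Lemma comor_strict (f : cochain C A) s j : cochain_axiom 0 f ->
  comor f (strict_fun q ^~ j) s = q j j (f s j).
Proof.
move=> f_ax; have [->|Hs] := pselect (s = [::]).
  by rewrite comor_nil (cochain_nil f_ax) ghom0.
rewrite comor_single ?strict_fun_letter // => w Hw.
exact: strict_fun_ne1.
Qed.

End StrictCochain.

Lemma coder_strict (k : comPzRingType) (A B : gmod k) (q : ghom (Pi A) (Pi B) 0)
    (nu : cochain A A) d s j : cochain_axiom d nu ->
  coder d nu (strict_fun q ^~ j) s = q j j (nu s j).
Proof.
move=> nu_ax; have [->|Hs] := pselect (s = [::]).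
  by rewrite (cochain_nil nu_ax) ghom0.
rewrite coder_single ?strict_fun_letter // => w Hw.
exact: strict_fun_ne1.
Qed.

Section Lifting.
Variables (k : comPzRingType) (A B C : gmod k) (u : split_element C).
Variables (dC : differential (Pi C)) (dA : differential (Pi A)) (dB : differential (Pi B)).
Variable q : ghom (Pi A) (Pi B) 0.
Hypothesis d_one : dC 1 0 (split_one u) = 0.
Hypothesis dC_semi : semiprojective dC.
Hypothesis q_qi : quasi_iso dA dB q.
Hypothesis q_surj : surjective q.

Notation one := (split_one u).

Section Truncation.
Variables (D : gmod k) (d : int) (l : nat) (f : cochain C D).
Hypothesis f_ax : cochain_axiom d f.
Hypothesis f_unit : forall s1 s2 j, size (s1 ++ bar1 one :: s2) = l ->
  f (s1 ++ bar1 one :: s2) j = 0.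

Program Definition trunc : rmod one (Pi D) l d :=
  @RMul k C one (Pi D) l d (fun s j => if size s == l then f s j else 0) _ _ _ _.
Next Obligation. by case: eqP. Qed.
Next Obligation. by rewrite (cochain_shape f_ax) // if_same. Qed.
Next Obligation.
move=> a v w z E; have [-> ->] := lin3_size E.
case: ifP => _; last by rewrite scaler0 addr0.
exact: (cochain_mlin f_ax j E).
Qed.
Next Obligation. by move=> s1 s2; case: eqP => // /f_unit ->. Qed.

Lemma truncE s j : size s = l -> rmul_fun trunc s j = f s j.
Proof. by move=> H; rewrite /= H eqxx. Qed.

End Truncation.

Lemma rmul_axiom (D : gmod k) l d (F : rmod one (Pi D) l.+1 d) :
  cochain_axiom d (rmul_fun F).
Proof.
apply: cochain_axiomP => [j|s j|j]; first by rewrite rmul_size.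
  exact: rmul_shape.
exact: rmul_mlin.
Qed.

(** Lifting through the surjection [q], one tensor degree at a time. Degree one is
    left out: there the linear part is prescribed, and [1] is not sent to zero. *)
Lemma lift_cochain d (G : cochain C B) :
  cochain_axiom d G -> (forall j, almost_unitless one (G ^~ j)) ->
  exists F : cochain C A, [/\ cochain_axiom d F, forall j, unitless one (F ^~ j),
    forall s j, (size s <= 1)%N -> F s j = 0
  & forall s j, (1 < size s)%N -> q j j (F s j) = G s j].
Proof.
move=> G_ax G_unit.
have Gl l s1 s2 j : size (s1 ++ bar1 one :: s2) = l.+2 -> G (s1 ++ bar1 one :: s2) j = 0.
  move=> Hs; apply: G_unit => E; move: Hs; rewrite size_cat /= addnS -size_cat E.
  by [].
have ex l : exists F : rmod one (Pi A) l.+2 d, rmap one l.+2 q d d F = trunc G_ax (@Gl l).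
  by have [H _] := rmap_surjective_acyclic d_one dC_semi q_qi q_surj l.+2; apply: H.
pose F l := sval (cid (ex l)).
have HF l : rmap one l.+2 q d d (F l) = trunc G_ax (@Gl l) := svalP (cid (ex l)).
exists (fun s j => if size s is l.+2 then rmul_fun (F l) s j else 0); split.
- apply: cochain_axiomP => [j|s j Hj|j] //.
    by case: (size s) => [|[|l]] //; rewrite rmul_shape.
  move=> a v w z E; have [-> ->] := lin3_size E.
  case: (size v) => [|[|l]]; rewrite ?scaler0 ?addr0 //.
  exact: (rmul_mlin (F l) j E).
- by move=> j s1 s2; case: (size _) => [|[|l]] //; rewrite rmul_unit.
- by move=> s j; case: (size s) => [|[|l]].
- move=> s j; case E: (size s) => [|[|l]] // _.
  by rewrite -rmapE HF truncE.
Qed.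

(** A leading obstruction [f] is a cycle with values in the acyclic kernel of [q],
    hence the boundary of a cochain [g] with values in that kernel; correcting by [g]
    does not change the composite with [q]. *)
Lemma correct_cochain d l (f : cochain C A) : cochain_axiom d f ->
  (forall s1 s2 j, size (s1 ++ bar1 one :: s2) = l.+1 -> f (s1 ++ bar1 one :: s2) j = 0) ->
  (forall s j, size s = l.+1 ->
     dA (j + 1) j (f s (j + 1)) = ksign k d *: dcoder dC (f ^~ j) s) ->
  (forall s j, size s = l.+1 -> q j j (f s j) = 0) ->
  exists g : cochain C A, [/\ cochain_axiom (d + 1) g, forall j, unitless one (g ^~ j),
    forall s j, size s <> l.+1 -> g s j = 0,
    forall s j, q j j (g s j) = 0
  & forall s j, size s = l.+1 ->
     dA (j + 1) j (g s (j + 1)) - ksign k (d + 1) *: dcoder dC (g ^~ j) s = f s j].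
Proof.
move=> f_ax f_unit f_cycle qf.
have [_ H] := rmap_surjective_acyclic d_one dC_semi q_qi q_surj l.+1.
have [|||G HG qG] := H d (d + 1) (trunc f_ax f_unit).
- by [].
- move=> e; have [->|N] := eqVneq e (d - 1); last by rewrite ghom_shape.
  apply: rmulP => s j; rewrite rdiffE // rmod0E.
  have [Hs|Ns] := pselect (size s = l.+1); last first.
    rewrite rmul_size // ghom0 dcoder_eq0 ?scaler0 ?subrr //; first exact: rmul_mlin.
    by move=> w Hw _; rewrite rmul_size ?Hw.
  rewrite truncE // f_cycle //; apply/eqP; rewrite subr_eq0; apply/eqP.
  congr (_ *: _); apply: eq_dcoder_size => [||w Hw].
  - exact: cochain_mlin f_ax j.
  - exact: rmul_mlin.
  - by rewrite truncE // Hw.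
- apply: rmulP => s j; rewrite rmapE.
  have [Hs|Ns] := pselect (size s = l.+1); last by rewrite rmul_size // ghom0.
  by rewrite truncE // qf.
exists (rmul_fun G); split.
- exact: rmul_axiom.
- by move=> j; apply: rmul_unit.
- by move=> s j; apply: rmul_size.
- by move=> s j; rewrite -rmapE qG.
- by move=> s j Hs; rewrite -(rdiffE d_one dA G s j (e := d)) ?addrK // HG truncE.
Qed.

End Lifting.

(** * Lifting morphisms *)

Lemma agree_sym (k : comPzRingType) (A B : gmod k) n (f g : cochain A B) :
  agree n f g -> agree n g f.
Proof. by move=> H s j Hs; rewrite H. Qed.

Lemma cochain_sub (k : comPzRingType) (A B : gmod k) d (f g : cochain A B) :
  cochain_axiom d f -> cochain_axiom d g -> cochain_axiom d (fun s j => f s j - g s j).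
Proof.
move=> F G; have := cochain_comb (-1) G F; congr (cochain_axiom _ _).
apply: funext => s; apply: functional_extensionality_dep => j.
by rewrite scaleN1r addrC.
Qed.

Lemma cochain_add (k : comPzRingType) (A B : gmod k) d (f g : cochain A B) :
  cochain_axiom d f -> cochain_axiom d g -> cochain_axiom d (fun s j => f s j + g s j).
Proof.
move=> F G; have := cochain_comb 1 F G; congr (cochain_axiom _ _).
apply: funext => s; apply: functional_extensionality_dep => j.
by rewrite scale1r.
Qed.

Lemma cochain_axiom_local (k : comPzRingType) (A B : gmod k) d (f : cochain A B) :
  (forall n, exists g, cochain_axiom d g /\ agree n.+1 f g) -> cochain_axiom d f.
Proof.
move=> H; apply: cochain_axiomP => [j|s j Hj|j a u v w E].
- by have [g [g_ax ag]] := H 0%N; rewrite ag // (cochain_nil g_ax).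
- by have [g [g_ax ag]] := H (size s); rewrite ag // (cochain_shape g_ax).
have [g [g_ax ag]] := H (size u); have [Ev Ew] := lin3_size E.
by rewrite !ag ?Ev ?Ew //; apply: (cochain_mlin g_ax j E).
Qed.

Section Locality.
Variables (k : comPzRingType) (A B : gmod k) (nuA : cochain A A) (nuB : cochain B B).

Lemma agree_defect (f g : cochain A B) s j :
  agree (size s).+1 f g -> defect nuA nuB f s j = defect nuA nuB g s j.
Proof.
move=> H; rewrite /defect (agree_comor _ H) //; congr (_ - _).
by apply: eq_coder => w /andP[_ Hw] _; rewrite H.
Qed.

Lemma agree_homotopy_obstruction (alpha beta f g : cochain A B) s j :
  agree (size s).+1 f g ->
  homotopy_obstruction nuA nuB alpha beta f s j =
  homotopy_obstruction nuA nuB alpha beta g s j.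
Proof.
move=> H; rewrite /homotopy_obstruction /homotopy_defect; congr (_ - (_ + _)).
  have [->|Hs] := pselect (s = [::]); first by rewrite !bicoder_nil.
  have H' : agree (size s) f g by move=> w i Hw; apply: H; apply: ltnW.
  apply/eqP; rewrite -subr_eq0 bicoder_top // (agree_letter _ H) // subrr.
  by [].
by apply: eq_coder => w /andP[_ Hw] _; rewrite H.
Qed.

End Locality.

Lemma agree_square (k : comPzRingType) (A : gmod k) (f g : cochain A A) s j :
  agree (size s).+1 f g -> square f s j = square g s j.
Proof.
move=> H; rewrite /square.
have -> : coder (-1) f (f ^~ j) s = coder (-1) f (g ^~ j) s.
  by apply: eq_coder => w /andP[_ Hw] _; rewrite H.
have [->//|Hs] := pselect (s = [::]).
have H' : agree (size s) f g by move=> w i Hw; apply: H; apply: ltnW.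
by apply/eqP; rewrite -subr_eq0 coder_top // (agree_letter _ H) // subrr.
Qed.

Section LiftMorphism.
Variables (k : comPzRingType) (A B C : gmod k) (u : split_element C).
Variables (oneA : A 0) (oneB : B 0).
Variables (nuA : cochain A A) (nuB : cochain B B) (nuC : cochain C C).
Variables (dC : differential (Pi C)) (dA : differential (Pi A)) (dB : differential (Pi B)).
Variable q : ghom (Pi A) (Pi B) 0.
Hypothesis d_one : dC 1 0 (split_one u) = 0.
Hypothesis dC_semi : semiprojective dC.
Hypothesis q_qi : quasi_iso dA dB q.
Hypothesis q_surj : surjective q.
Hypothesis nuA_ax : cochain_axiom (-1) nuA.
Hypothesis nuB_ax : cochain_axiom (-1) nuB.
Hypothesis nuC_ax : cochain_axiom (-1) nuC.
Hypothesis dA_nuA : forall i j (x : Pi A i), nuA [:: hel x] j = dA i j x.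
Hypothesis dC_nuC : forall i j (x : Pi C i), nuC [:: hel x] j = dC i j x.
Hypothesis nuA_sq : forall s j, square nuA s j = 0.
Hypothesis nuC_sq : forall s j, square nuC s j = 0.
Hypothesis nuA_su : strictly_unital oneA nuA.
Hypothesis nuC_su : strictly_unital (split_one u) nuC.
Hypothesis q_mor : forall s j, q j j (nuA s j) = comor (strict_fun q) (nuB ^~ j) s.
Variable alpha : cochain C B.

Notation one := (split_one u).

(** The obstruction to a lift of [alpha] lies in the kernel of [q], because [alpha]
    is a morphism. *)
Lemma q_defect (delta : cochain C A) s j : cochain_axiom 0 delta ->
  (forall s j, q j j (delta s j) = alpha s j) ->
  q j j (defect nuC nuA delta s j) = defect nuC nuB alpha s j.
Proof.
move=> d_ax Hq; have Hl := @ghom_linear _ _ _ _ q j j.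
rewrite /defect (lin_sub Hl) (comor_push Hl) (coder_push Hl).
rewrite (eq_coder (alpha ^~ j)); last by move=> w _ _; rewrite Hq.
rewrite (eq_comor (comor (strict_fun q) (nuB ^~ j))); last by move=> w _ _ _; apply: q_mor.
rewrite (comor_comor d_ax (strict_axiom q)); last exact: cochain_mlin nuB_ax j.
have -> // : (fun w j => comor delta (strict_fun q ^~ j) w) = alpha.
apply: funext => w; apply: functional_extensionality_dep => i.
by rewrite comor_strict.
Qed.

Hypothesis alpha_ax : cochain_axiom 0 alpha.
Hypothesis alpha_su : strictly_unital_map one oneB alpha.
Hypothesis alpha_mor : forall s j, defect nuC nuB alpha s j = 0.
Variable delta1 : ghom (Pi C) (Pi A) 0.
Hypothesis delta1_chain : chain_map dC dA delta1.
Hypothesis delta1_one : delta1 1 1 one = oneA.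
Hypothesis q_delta1 : forall i (x : Pi C i), q i i (delta1 i i x) = alpha [:: hel x] i.

Definition good_lift (delta : cochain C A) : Prop :=
  [/\ cochain_axiom 0 delta, strictly_unital_map one oneA delta
    & forall s j, q j j (delta s j) = alpha s j].

Lemma lift_morphism0 :
  exists delta, good_lift delta /\
    forall s j, (size s < 2)%N -> defect nuC nuA delta s j = 0.
Proof.
have au j : almost_unitless one (alpha ^~ j).
  by move=> s1 s2 H; exact: (su_map_zero _ alpha_su H).
have [F [F_ax F_unit F1 qF]] := lift_cochain d_one dC_semi q_qi q_surj alpha_ax au.
have d_ax := cochain_add (strict_axiom delta1) F_ax.
exists (fun s j => strict_fun delta1 s j + F s j); split; first split=> //.
- split; first by rewrite /= F1 // addr0.
  by move=> s1 s2 j Hs; rewrite F_unit addr0 strict_fun_ne1 // => E; rewrite E in Hs.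
- move=> s j; rewrite ghomD; case: s => [|x [|y s]].
  + by rewrite F1 //= !ghom0 addr0 (cochain_nil alpha_ax).
  + rewrite F1 //= ghom0 addr0; case: x => i x /=.
    have [<-|/eqP N] := eqVneq i j; first exact: q_delta1.
    have N' : j != i + 0 by rewrite addr0; apply/eqP => E; apply: N.
    by rewrite [delta1 _ _ _]ghom_shape // ghom0 (cochain_shape alpha_ax) // degs1.
  + by rewrite qF // [strict_fun _ _ _]/= ghom0 add0r.
move=> [|[i x] [|y s]] j // _.
  by rewrite (cochain_nil (defect_axiom nuC_ax nuA_ax d_ax)).
set d := (fun s => _) in d_ax *.
rewrite /defect comor_cons coder_cons /= comor_nil scaler0 addr0.
rewrite (linear_letter dA_nuA); last by move=> j1 Hj; exact: (cochain_shape d_ax Hj).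
have dE w j' : d [:: w] j' = strict_fun delta1 [:: w] j' by rewrite /d F1 // addr0.
rewrite !dE strict_fun_letter // dC_nuC /=.
have [E|N] := eqVneq (j + 1) i.
  by subst i; rewrite -delta1_chain subrr.
rewrite [delta1 i (j + 1) x]ghom_shape ?addr0 // ghom0.
rewrite [dC i j x]ghom_shape ?ghom0 ?subrr //.
by apply: contraNneq N => ->; rewrite subrK.
Qed.

Lemma lift_morphism_step n delta :
  good_lift delta -> (forall s j, (size s < n.+2)%N -> defect nuC nuA delta s j = 0) ->
  exists delta', (good_lift delta' /\
      (forall s j, (size s < n.+3)%N -> defect nuC nuA delta' s j = 0)) /\
    agree n.+1 delta delta'.
Proof.
move=> [d_ax d_su qd] d0.
have ob_ax := defect_axiom nuC_ax nuA_ax d_ax.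
have [s1 s2 j _|s j Hs|s j _|g [g_ax g_unit g_size qg dg]] :=
    correct_cochain (l := n.+1) d_one dC_semi q_qi q_surj ob_ax.
- exact: (defect_unitless nuA_ax nuC_su nuA_su d_ax j d_su).
- rewrite (defect_cycle nuC_ax nuA_ax dC_nuC dA_nuA nuC_sq nuA_sq _ d_ax).
  + by rewrite [ksign k (-1)]ksignN ksign1 scaleN1r.
  + by move=> w i Hw; apply: d0; rewrite -Hs.
  + by case: s Hs.
- by rewrite q_defect.
rewrite addNr in g_ax.
pose delta' : cochain C A := fun s j => delta s j - g s j.
have d'_ax : cochain_axiom 0 delta' := cochain_sub d_ax g_ax.
have ag : agree n.+2 delta delta'.
  by move=> s j Hs; rewrite /delta' g_size ?subr0 // => E; rewrite E ltnn in Hs.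
exists delta'; split; last by move=> s j Hs; apply: ag; apply: ltnW.
split.
  split=> //.
    have [su1 su2] := d_su; split; first by rewrite /delta' g_size // subr0.
    by move=> s1 s2 j Hs; rewrite /delta' su2 // g_unit subr0.
  by move=> s j; rewrite /delta' (lin_sub (@ghom_linear _ _ _ _ q _ _)) qg subr0.
move=> s j; rewrite ltnS leq_eqVlt => /orP[/eqP Hs|Hs]; last first.
  rewrite (@agree_defect _ _ _ _ _ delta' delta) ?d0 //.
  by apply: agree_sym => w i Hw; apply: ag; apply: leq_trans Hs.
have s_ne : s <> [::] by case: s Hs.
have ag' : agree (size s) delta' delta by rewrite Hs; apply: agree_sym.
have HgC := coder_dcoder dC_nuC (cochain_mlin g_ax j).
have E1 : comor delta' (nuA ^~ j) s = comor delta (nuA ^~ j) s - dA (j + 1) j (g s (j + 1)).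
  have := comor_top (nuA ^~ j) s_ne ag'.
  rewrite (linear_letter dA_nuA); last by move=> j1 Hj; exact: (cochain_shape d'_ax Hj).
  rewrite (linear_letter dA_nuA); last by move=> j1 Hj; exact: (cochain_shape d_ax Hj).
  move/eqP; rewrite subr_eq => /eqP ->.
  rewrite {1}/delta' (lin_sub (@ghom_linear _ _ _ _ dA _ _)).
  by rewrite [_ - _ - _]addrAC subrr sub0r addrC.
have E2 : coder (-1) nuC (delta' ^~ j) s =
    coder (-1) nuC (delta ^~ j) s - dcoder dC (g ^~ j) s.
  rewrite -HgC; last by move=> w Hw; apply: g_size => E; rewrite E -Hs ltnn in Hw.
  rewrite -[X in _ = _ + X]scaleN1r addrC -coder_comb; apply: eq_coder => w _ _.
  by rewrite scaleN1r addrC.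
rewrite /defect E1 E2 opprD addrACA -opprD -/(defect nuC nuA delta s j).
by have := dg s j Hs; rewrite addNr ksign0 scale1r => ->; rewrite subrr.
Qed.

Lemma lift_morphism : exists delta,
  good_lift delta /\ forall s j, defect nuC nuA delta s j = 0.
Proof.
have [delta0 H0] := lift_morphism0.
have [delta Hd] := cochain_limit (P := fun n delta => good_lift delta /\
  forall s j, (size s < n.+2)%N -> defect nuC nuA delta s j = 0) H0
  (fun n f H => lift_morphism_step (proj1 H) (proj2 H)).
exists delta; split; last first.
  move=> s j; have [g [[_ g0] ag]] := Hd (size s).
  by rewrite (agree_defect _ _ _ ag) // g0 // ltnW.
split.
- by apply: cochain_axiom_local => n; have [g [[[]]]] := Hd n; exists g.
- split; first by have [g [[[_ [su _] _] _] ag]] := Hd 1%N; rewrite ag.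
  move=> s1 s2 j Hs; have [g [[[_ [_ su] _] _] ag]] := Hd (size (s1 ++ bar1 one :: s2)).
  by rewrite ag // su.
- by move=> s j; have [g [[[_ _ qg] _] ag]] := Hd (size s); rewrite ag.
Qed.

End LiftMorphism.

(** * Lifting homotopies *)

Section Components.
Variables (k : comPzRingType) (A B : gmod k) (d : int).

Lemma evl_size l (f : CCl l A B d) s j : size s <> l -> evl f s j = 0.
Proof.
by move=> Hs; rewrite /evl tens_supp ?ghom0 // negb_and; move/eqP: Hs => ->.
Qed.

Lemma evl_axiom l (f : CCl l.+1 A B d) : cochain_axiom d (evl f).
Proof.
apply: cochain_axiomP => [j|s j H|j]; first by rewrite evl_size.
  by rewrite /evl ghom_shape.
move=> a u v w E; have [Ev Ew] := lin3_degs E.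
rewrite (evlE f j Ev) (evlE f j Ew) /evl.
have [s1 [i [x [y [s2 [-> -> ->]]]]]] := lin3_inv E.
by rewrite tens_lin ghom_linear.
Qed.

Lemma evl_mkCCl (F : cochain A B) (F_ax : cochain_axiom d F) l s j :
  evl (mkCCl F_ax l) s j = if size s == l then F s j else 0.
Proof.
rewrite /evl /= (tlift_tens (@mkphi_lin _ _ _ _ _ F_ax _ _ _) (@mkphi_supp _ _ _ _ _ _ _)).
by rewrite /mkphi eqxx andbT.
Qed.

End Components.

Lemma ev_strict (k : comPzRingType) (A B : gmod k) d (f : ghom (Pi A) (Pi B) d) :
  ev (strict f) = strict_fun f.
Proof.
by apply: funext => s; apply: functional_extensionality_dep => j; apply: ev_mkCC.
Qed.

Lemma CC_bndE (k : comPzRingType) (C A : gmod k) d (dC : differential (Pi C))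
    (dA : differential (Pi A)) (f : cochain C A) s j :
  CC_bnd d dC dA f s j = dA (j + 1) j (f s (j + 1)) - ksign k d *: dcoder dC (f ^~ j) s.
Proof. by rewrite /CC_bnd gerstE ev_strict. Qed.

Section LiftHomotopy.
Variables (k : comPzRingType) (A B C : gmod k) (u : split_element C) (oneA : A 0).
Variables (nuA : cochain A A) (nuC : cochain C C).
Variables (dC : differential (Pi C)) (dA : differential (Pi A)) (dB : differential (Pi B)).
Variable q : ghom (Pi A) (Pi B) 0.
Hypothesis d_one : dC 1 0 (split_one u) = 0.
Hypothesis dC_semi : semiprojective dC.
Hypothesis q_qi : quasi_iso dA dB q.
Hypothesis q_surj : surjective q.
Hypothesis nuA_ax : cochain_axiom (-1) nuA.
Hypothesis nuC_ax : cochain_axiom (-1) nuC.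
Hypothesis dA_nuA : forall i j (x : Pi A i), nuA [:: hel x] j = dA i j x.
Hypothesis dC_nuC : forall i j (x : Pi C i), nuC [:: hel x] j = dC i j x.
Hypothesis nuA_sq : forall s j, square nuA s j = 0.
Hypothesis nuC_sq : forall s j, square nuC s j = 0.
Hypothesis nuA_su : strictly_unital oneA nuA.
Hypothesis nuC_su : strictly_unital (split_one u) nuC.
Variables alpha beta : cochain C A.
Hypothesis alpha_ax : cochain_axiom 0 alpha.
Hypothesis beta_ax : cochain_axiom 0 beta.
Hypothesis alpha_su : strictly_unital_map (split_one u) oneA alpha.
Hypothesis beta_su : strictly_unital_map (split_one u) oneA beta.
Hypothesis alpha_mor : forall s j, defect nuC nuA alpha s j = 0.
Hypothesis beta_mor : forall s j, defect nuC nuA beta s j = 0.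

Notation one := (split_one u).
Notation obstruction := (homotopy_obstruction nuC nuA alpha beta).

Definition good_homotopy n (r : cochain C A) : Prop :=
  [/\ cochain_axiom 1 r, reduced one r & forall s j, (size s < n)%N -> obstruction r s j = 0].

Lemma obstruction_unitless r j : cochain_axiom 1 r -> reduced one r ->
  unitless one ((obstruction r) ^~ j).
Proof.
move=> r_ax red s1 s2; rewrite /homotopy_obstruction.
rewrite (homotopy_defect_unitless nuA_ax nuC_su nuA_su j alpha_su beta_su r_ax red) subr0.
have [E|N] := pselect (s1 ++ s2 = [::]); last first.
  by rewrite (su_map_zero j alpha_su N) (su_map_zero j beta_su N) subr0.
have [-> ->] : s1 = [::] /\ s2 = [::] by case: (s1) (s2) E => [|? ?] [|? ?].
rewrite [_ ++ _]/=; have [->|Nj] := eqVneq j 1.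
  by case: alpha_su beta_su => [-> _] [-> _]; rewrite subrr.
have Nd : j != degs [:: bar1 one] + 0 by rewrite degs1 addr0.
by rewrite (cochain_shape alpha_ax Nd) (cochain_shape beta_ax Nd) subrr.
Qed.

Lemma homotopy_extend l r g : good_homotopy l.+1 r ->
  cochain_axiom 1 g -> (forall j, unitless one (g ^~ j)) ->
  (forall s j, size s <> l.+1 -> g s j = 0) ->
  (forall s j, size s = l.+1 ->
     dA (j + 1) j (g s (j + 1)) + dcoder dC (g ^~ j) s = obstruction r s j) ->
  good_homotopy l.+2 (fun s j => r s j + g s j).
Proof.
move=> [r_ax red r0] g_ax g_unit g_size dg.
pose r' : cochain C A := fun s j => r s j + g s j.
have r'_ax : cochain_axiom 1 r' := cochain_add r_ax g_ax.
have ag : agree l.+1 r' r.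
  by move=> s j Hs; rewrite /r' g_size ?addr0 // => E; rewrite E ltnn in Hs.
split=> //; first by move=> s1 s2 j; rewrite red g_unit addr0.
move=> s j; rewrite ltnS leq_eqVlt => /orP[/eqP Hs|Hs]; last first.
  rewrite -(r0 s j Hs); apply: agree_homotopy_obstruction => w i Hw; apply: ag.
  exact: leq_trans Hw Hs.
have s_ne : s <> [::] by case: s Hs.
have ag' : agree (size s) r' r by rewrite Hs.
rewrite -/r' /homotopy_obstruction /homotopy_defect.
have E1 : bicoder alpha beta 1 r' (nuA ^~ j) s =
    bicoder alpha beta 1 r (nuA ^~ j) s + dA (j + 1) j (g s (j + 1)).
  have := bicoder_top alpha beta 1 (nuA ^~ j) ag' s_ne.
  rewrite (linear_letter dA_nuA); last by move=> j1 Hj; exact: (cochain_shape r'_ax Hj).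
  rewrite (linear_letter dA_nuA); last by move=> j1 Hj; exact: (cochain_shape r_ax Hj).
  move/eqP; rewrite subr_eq => /eqP ->.
  by rewrite {1}/r' ghomD [_ + dA _ _ (g _ _)]addrC addrK addrC.
have E2 : coder (-1) nuC (r' ^~ j) s = coder (-1) nuC (r ^~ j) s + dcoder dC (g ^~ j) s.
  rewrite -(coder_dcoder dC_nuC (cochain_mlin g_ax j)) -?coderD //.
  by move=> w Hw; apply: g_size => E; rewrite E -Hs ltnn in Hw.
rewrite E1 E2 addrACA opprD addrA dg //.
by rewrite /homotopy_obstruction /homotopy_defect subrr.
Qed.

Hypothesis q_eq : forall s j, q j j (alpha s j) = q j j (beta s j).

(** In tensor degree one the obstruction, the difference of the linear parts, has
    values in the acyclic kernel of [q]; the hypothesis on H_0 concerns the higher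
    degrees only. *)
Lemma lift_homotopy1 : exists r, good_homotopy 2 r.
Proof.
pose z : cochain C A := fun s j => 0.
have z_ax : cochain_axiom 1 z.
  by apply: cochain_axiomP => // j a v w t _; rewrite scaler0 addr0.
have zred : reduced one z by [].
have o_ax := homotopy_obstruction_axiom nuC_ax nuA_ax alpha_ax beta_ax z_ax.
have zgood : good_homotopy 1 z.
  by split=> // -[|x s] // j _; rewrite (cochain_nil o_ax).
have zdef s j : homotopy_defect nuC nuA alpha beta z s j = 0.
  rewrite /homotopy_defect (@coder_eq0 _ _ _ _ _ (z ^~ j)) // addr0.
  by apply: bicoder_zero; exact: cochain_mlin nuA_ax j.
have [s1 s2 j _|s j Hs|s j Hs|g [g_ax g_unit g_size qg dg]] :=
    correct_cochain (l := 0) d_one dC_semi q_qi q_surj o_ax.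
- exact: obstruction_unitless.
- rewrite ksign0 scale1r.
  apply: (homotopy_cycle nuC_ax nuA_ax dC_nuC dA_nuA nuC_sq nuA_sq alpha_ax beta_ax z_ax
            alpha_mor beta_mor); last by case: s Hs.
  by move=> w i Hw; case: zgood => _ _; apply; rewrite -Hs.
- rewrite /homotopy_obstruction zdef subr0 (lin_sub (@ghom_linear _ _ _ _ q _ _)).
  by rewrite q_eq subrr.
exists (fun s j => z s j + g s j); apply: homotopy_extend => // s j Hs.
by rewrite -dg // add0r ksign1 scaleN1r opprK.
Qed.

Hypothesis H0_vanish : forall n, (1 <= n)%N -> reduced_H0_vanishes n.+1 one dC dA.

Lemma lift_homotopy_step n r : good_homotopy n.+2 r ->
  exists r', good_homotopy n.+3 r' /\ agree n.+1 r r'.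
Proof.
move=> r_good; have [r_ax red r0] := r_good.
have o_ax := homotopy_obstruction_axiom nuC_ax nuA_ax alpha_ax beta_ax r_ax.
have fE s j : size s = n.+2 -> evl (mkCCl o_ax n.+2) s j = obstruction r s j.
  by move=> Hs; rewrite evl_mkCCl Hs eqxx.
have [||g gred dg] := @H0_vanish n.+1 isT (mkCCl o_ax n.+2).
- by move=> s1 s2 j; rewrite evl_mkCCl obstruction_unitless // if_same.
- move=> s j; rewrite CC_bndE ksign0 scale1r.
  have [Hs|Ns] := pselect (size s = n.+2); last first.
    rewrite evl_size // ghom0 dcoder_eq0 ?subrr //; first exact: cochain_mlin (evl_axiom _) j.
    by move=> w Hw _; rewrite evl_size ?Hw.
  rewrite fE // (homotopy_cycle nuC_ax nuA_ax dC_nuC dA_nuA nuC_sq nuA_sq alpha_ax beta_ax r_ax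
            alpha_mor beta_mor); last 2 first.
  + by move=> w i Hw; apply: r0; rewrite -Hs.
  + by case: s Hs.
  apply/eqP; rewrite subr_eq0; apply/eqP; apply: eq_dcoder_size => [||w Hw].
  + exact: cochain_mlin o_ax j.
  + exact: cochain_mlin (evl_axiom _) j.
  + by rewrite fE // Hw.
exists (fun s j => r s j + evl g s j); split; last first.
  move=> s j Hs; rewrite evl_size ?addr0 // => E.
  by move: Hs; rewrite E; lia.
apply: homotopy_extend => //.
- exact: evl_axiom.
- by move=> j s1 s2; apply: gred.
- by move=> s j; apply: evl_size.
move=> s j Hs; rewrite -fE // -dg CC_bndE ksign1 scaleN1r opprK.
by [].
Qed.

Lemma lift_homotopy : exists r : cochain C A,
  [/\ cochain_axiom 1 r, reduced one r
    & forall s j, alpha s j - beta s j = homotopy_defect nuC nuA alpha beta r s j].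
Proof.
have [r0 H0] := lift_homotopy1.
have [r Hr] := cochain_limit (P := fun n => good_homotopy n.+2) H0 lift_homotopy_step.
exists r; split.
- by apply: cochain_axiom_local => n; have [g [[g_ax _ _] ag]] := Hr n; exists g.
- move=> s1 s2 j; have [g [[_ red _] ag]] := Hr (size (s1 ++ bar1 one :: s2)).
  by rewrite ag // red.
- move=> s j; have [g [[_ _ g0] ag]] := Hr (size s).
  apply/eqP; rewrite -subr_eq0; apply/eqP.
  rewrite -[LHS]/(obstruction r s j) (agree_homotopy_obstruction _ _ _ _ _ ag).
  by rewrite g0 // ltnW.
Qed.

End LiftHomotopy.

(** * Lifting A-infinity structures *)

Section UnitProduct.
Variables (k : comPzRingType) (A : gmod k) (u : split_element A).

Definition lcoord (x : homog (Pi A)) : k := coord u (projT2 x).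
Definition at_degree (x : homog (Pi A)) j : Pi A j := gid (Pi A) (projT1 x) j (projT2 x).

(** The values of [nu^2] that strict unitality prescribes, on words of length two
    through [1], extended by zero on the kernel of the splitting. Any [nu^2] with
    the right unit differs from it by a map vanishing on words through [1]. *)
Definition unit_product : cochain A A := fun s j =>
  if s is [:: x; y] then
    lcoord x *: at_degree y j + ksign k (projT1 x - 1) *: (lcoord y *: at_degree x j)
    - (lcoord x * lcoord y) *: at_degree (bar1 (split_one u)) j
  else 0.

Lemma unit_product_ne2 s j : size s <> 2%N -> unit_product s j = 0.
Proof. by case: s => [|x [|y [|z s]]]. Qed.

Lemma lcoord_shape x : projT1 x != 1 -> lcoord x = 0.
Proof. exact: coord_shape. Qed.

Lemma at_degree_shape x j : j != projT1 x -> at_degree x j = 0.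
Proof. by move=> H; apply: gid_ne => E; rewrite E eqxx in H. Qed.

Lemma at_degree_lin i j : lin (fun x : Pi A i => at_degree (hel x) j).
Proof. exact: (@ghom_linear _ _ _ _ (gid (Pi A))). Qed.

Lemma lcoord_lin i : lin ((fun x : Pi A i => lcoord (hel x)) : _ -> k^o).
Proof. exact: coord_lin. Qed.

Lemma lin_addf (V W : lmodType k) (f g : V -> W) :
  lin f -> lin g -> lin (fun x => f x + g x).
Proof. by move=> F G a x y; rewrite F G scalerDr addrACA. Qed.

Lemma lin_scalef (V W : lmodType k) c (f : V -> W) : lin f -> lin (fun x => c *: f x).
Proof. by move=> F a x y; rewrite F scalerDr !scalerA mulrC. Qed.

Lemma lin_mulf (V W : lmodType k) (f : V -> k^o) c (w : W) :
  lin f -> lin (fun x => (f x * c) *: w).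
Proof. by move=> F a x y; rewrite F mulrDl scalerDl scalerA mulrA. Qed.

Lemma unit_product_axiom : cochain_axiom (-1) unit_product.
Proof.
split=> // [[|x [|y [|z s]]] j|] //=.
  rewrite !degs_cons degs_nil addr0 => H.
  have [Ex|Nx] := eqVneq (projT1 x) 1; last first.
    rewrite (lcoord_shape Nx) mul0r !scale0r subr0 add0r.
    have [Ey|Ny] := eqVneq (projT1 y) 1; last by rewrite (lcoord_shape Ny) scale0r scaler0.
    by rewrite at_degree_shape ?scaler0 //; apply: contraNneq H => ->; rewrite Ey addrK.
  rewrite (@at_degree_shape y) ?scaler0 ?add0r; last first.
    by apply: contraNneq H => ->; rewrite Ex [1 + _]addrC addrK.
  have [Ey|Ny] := eqVneq (projT1 y) 1; last first.
    by rewrite (lcoord_shape Ny) mulr0 !scale0r subr0 scaler0.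
  rewrite !at_degree_shape ?scaler0 ?subrr //=.
    by apply: contraNneq H => ->; rewrite Ex Ey.
  by apply: contraNneq H => ->; rewrite ?Ex ?Ey.
move=> [|z [|z' [|z'' s1]]] [|w [|w' s2]] i j a x y //=; rewrite ?scaler0 ?addr0 //.
- pose f (x : Pi A i) := (lcoord (hel x) * 1) *: at_degree w j
     + (ksign k (i - 1) * lcoord w) *: at_degree (hel x) j
     + (- 1) *: ((lcoord (hel x) * lcoord w) *: at_degree (bar1 (split_one u)) j).
  have Hf : lin f.
    apply: lin_addf; first apply: lin_addf.
    + by apply: lin_mulf; apply: lcoord_lin.
    + by apply: lin_scalef; apply: at_degree_lin.
    + by apply: lin_scalef; apply: lin_mulf; apply: lcoord_lin.
  by have := Hf a x y; rewrite /f !mulr1 !scaleN1r -!scalerA.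
- pose f (x : Pi A i) := lcoord z *: at_degree (hel x) j
     + (lcoord (hel x) * ksign k (projT1 z - 1)) *: at_degree z j
     + (- 1) *: ((lcoord (hel x) * lcoord z) *: at_degree (bar1 (split_one u)) j).
  have Hf : lin f.
    apply: lin_addf; first apply: lin_addf.
    + by apply: lin_scalef; apply: at_degree_lin.
    + by apply: lin_mulf; apply: lcoord_lin.
    + by apply: lin_scalef; apply: lin_mulf; apply: lcoord_lin.
  have := Hf a x y; rewrite /f !scaleN1r.
  rewrite ![_ * ksign k (projT1 z - 1)]mulrC ![_ * lcoord z]mulrC -!scalerA.
  by [].
Qed.

Lemma lcoord_one : lcoord (bar1 (split_one u)) = 1.
Proof. exact: coord_one. Qed.

Lemma unit_product_left x j :
  unit_product [:: bar1 (split_one u); x] j = at_degree x j.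
Proof.
rewrite /= lcoord_one scale1r mul1r /ksign /= expr0 scale1r.
by rewrite addrK.
Qed.

Lemma unit_product_right x j :
  unit_product [:: x; bar1 (split_one u)] j = ksign k (projT1 x - 1) *: at_degree x j.
Proof. by rewrite /= lcoord_one scale1r mulr1 addrC addrA addNr add0r. Qed.

End UnitProduct.

Section LiftStructure.
Variables (k : comPzRingType) (A B : gmod k) (u : split_element A) (oneB : B 0).
Variable (nuB : cochain B B).
Variables (dA : differential (Pi A)) (dB : differential (Pi B)).
Variable q : ghom (Pi A) (Pi B) 0.
Hypothesis d_one : dA 1 0 (split_one u) = 0.
Hypothesis dA_semi : semiprojective dA.
Hypothesis q_qi : quasi_iso dA dB q.
Hypothesis q_surj : surjective q.
Hypothesis q_one : q 1 1 (split_one u) = oneB.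
Hypothesis nuB_ax : cochain_axiom (-1) nuB.
Hypothesis dB_nuB : forall i j (x : Pi B i), nuB [:: hel x] j = dB i j x.
Hypothesis nuB_sq : forall s j, square nuB s j = 0.
Hypothesis nuB_su : strictly_unital oneB nuB.

Notation one := (split_one u).

Definition good_structure (nu : cochain A A) : Prop :=
  [/\ cochain_axiom (-1) nu, forall i j (x : Pi A i), nu [:: hel x] j = dA i j x,
      strictly_unital one nu
    & forall s j, q j j (nu s j) = comor (strict_fun q) (nuB ^~ j) s].

Definition qletter (x : homog (Pi A)) : homog (Pi B) :=
  hel (q (projT1 x) (projT1 x) (projT2 x)).

Lemma qletterE x : letter 0 (strict_fun q) [:: x] = qletter x.
Proof. by rewrite (letterE (projT1 x)) // degs1 addr0. Qed.

Lemma comor_strict_map (V : lmodType k) (phi : word B -> V) s : mlin phi ->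
  comor (strict_fun q) phi s = phi (map qletter s).
Proof.
elim: s phi => // x t IH phi Hphi; rewrite comor_cons cut_first.
  by rewrite qletterE IH //; apply: mlin_tail.
move=> [|y a] b _ // _; apply: comor_eq0 => w _ _ _.
by apply: (letter_eq0 [::]).
Qed.

(** [unit_product] takes care of the unit, and the rest of the pullback of [nuB]
    along [q] vanishes on words through [1], so it can be lifted through [q] by a
    map with the same property. *)
Lemma lift_structure0 : exists nu, good_structure nu /\
  forall s j, (size s < 2)%N -> square nu s j = 0.
Proof.
have up_ax := unit_product_axiom u.
have qup_ax : cochain_axiom (-1) (fun s j => q j j (unit_product u s j)).
  apply: cochain_axiomP => [j|s j Hj|j]; first by rewrite ghom0.
    by rewrite (cochain_shape up_ax) // ghom0.
  exact: (mlin_lin (@ghom_linear _ _ _ _ q j j) (cochain_mlin up_ax j)).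
have com_ax : cochain_axiom (-1) (fun s j => comor (strict_fun q) (nuB ^~ j) s).
  apply: cochain_axiomP => [j|s j Hj|j].
  - by rewrite comor_nil (cochain_nil nuB_ax).
  - by apply: comor_eq0 => w _ _ E; apply: (cochain_shape nuB_ax); rewrite E.
  - exact: (mlin_comor (strict_axiom q) (cochain_mlin nuB_ax j)).
have G_ax := cochain_sub com_ax qup_ax.
have qat x j : q j j (at_degree x j) = strict_fun q [:: x] j.
  rewrite /at_degree; case: x => i x /=; have [<-|/eqP N] := eqVneq i j.
    by have := gid_id x => /= ->.
  have := gid_ne x N => /= ->; rewrite ghom0 [q i j x]ghom_shape // addr0.
  by apply/eqP => E; apply: N.
pose G : cochain A B :=
  fun s j => comor (strict_fun q) (nuB ^~ j) s - q j j (unit_product u s j).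
have G_unit j : almost_unitless one (G ^~ j).
  have qlone : qletter (bar1 one) = bar1 oneB by rewrite /qletter /= q_one.
  move=> s1 s2 Hs; rewrite /G comor_strict_map; last exact: cochain_mlin nuB_ax j.
  rewrite map_cat /= qlone.
  have [Hsz|Nsz] := pselect (size (s1 ++ s2) = 1%N); last first.
    rewrite (su_zero nuB_su) ?sub0r; last by rewrite size_cat !size_map -size_cat.
    rewrite unit_product_ne2 ?ghom0 ?oppr0 //.
    by move: Nsz; rewrite !size_cat /=; lia.
  case: s1 s2 Hsz {Hs} => [|x [|x1 s1]] [|y [|y1 s2]] //=; try by rewrite size_cat /=; lia.
    move=> _; rewrite -qletterE (su_left_cochain nuB_ax nuB_su _ _ (strict_axiom q)).
    rewrite -[X in _ - q j j X]/(unit_product u [:: bar1 one; y] j).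
    by rewrite unit_product_left qat subrr.
  move=> _; rewrite -qletterE (su_right_cochain nuB_ax nuB_su _ _ (strict_axiom q)).
  rewrite -[X in _ - q j j X]/(unit_product u [:: x; bar1 one] j) unit_product_right.
  by rewrite (lin_scale (@ghom_linear _ _ _ _ q j j)) qat degs1 addr0 subrr.
have [F [F_ax F_unit F1 qF]] := lift_cochain d_one dA_semi q_qi q_surj G_ax G_unit.
pose nu : cochain A A := fun s j => (strict_fun dA s j + unit_product u s j) + F s j.
have nu_ax : cochain_axiom (-1) nu.
  exact: (cochain_add (cochain_add (strict_axiom dA) up_ax) F_ax).
have nu1 w j : nu [:: w] j = strict_fun dA [:: w] j by rewrite /nu F1 // !addr0.
have dA_nu i j (x : Pi A i) : nu [:: hel x] j = dA i j x by rewrite nu1.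
have dA_one j : dA 1 j one = 0.
  have [->//|N] := eqVneq j 0.
  by rewrite ghom_shape.
exists nu; split; first split=> //.
- split.
    move=> n x; have nu2 a b : nu [:: a; b] n = unit_product u [:: a; b] n + F [:: a; b] n.
      by rewrite /nu /= add0r.
    rewrite !nu2 (F_unit n [::]) (F_unit n [:: hel x]) !addr0.
    rewrite unit_product_left unit_product_right scalerA ksignMM scale1r.
    by rewrite /at_degree gid_id.
  move=> s1 s2 j Hs; rewrite /nu F_unit addr0 unit_product_ne2 ?addr0; last exact/eqP.
  have [E|N] := pselect (s1 ++ s2 = [::]).
    by have [-> ->] : s1 = [::] /\ s2 = [::] by case: (s1) (s2) E => [|? ?] [|? ?].
  apply: strict_fun_ne1; move: N; rewrite size_cat /=.
  by case: s1 s2 {Hs} => [|x s1] [|y s2] //= _; lia.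
- move=> s j; case: s => [|x [|y s]].
  + by rewrite (cochain_nil nu_ax) ghom0 comor_nil (cochain_nil nuB_ax).
  + rewrite comor_strict_map; last exact: cochain_mlin nuB_ax j.
    case: x => i x; rewrite dA_nu dB_nuB /=; case: q_qi => qC _ _.
    by rewrite qC.
  + by rewrite /nu /= -/(unit_product u (x :: y :: s) j) add0r ghomD qF // /G addrC subrK.
move=> [|[i x] [|y s]] j // _.
rewrite /square coder_cons /= scaler0 addr0 (linear_letter dA_nu); last first.
  by move=> j1 Hj; exact: (cochain_shape nu_ax Hj).
by rewrite dA_nu diff_sq0.
Qed.

Lemma lift_structure_step n nu :
  good_structure nu -> (forall s j, (size s < n.+2)%N -> square nu s j = 0) ->
  exists nu', (good_structure nu' /\
      (forall s j, (size s < n.+3)%N -> square nu' s j = 0)) /\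
    agree n.+1 nu nu'.
Proof.
move=> [nu_ax dA_nu nu_su q_nu] nu0.
have ob_ax := square_axiom nu_ax.
have HnuB j := cochain_mlin nuB_ax j.
have [s1 s2 j _|s j Hs|s j _|g [g_ax g_unit g_size qg dg]] :=
    correct_cochain (l := n.+1) d_one dA_semi q_qi q_surj ob_ax.
- exact: (coder_self_unitless nu_ax nu_su j).
- rewrite (square_cycle j nu_ax dA_nu); last 2 first.
  + by move=> w i Hw; apply: nu0; rewrite -Hs.
  + by case: s Hs.
  by rewrite (_ : ksign k (-2) = 1) ?scale1r // /ksign /= expr2 mulN1r opprK.
- rewrite /square (coder_push (@ghom_linear _ _ _ _ q j j)).
  rewrite (eq_coder (comor (strict_fun q) (nuB ^~ j))); last by move=> w _ _; apply: q_nu.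
  rewrite -(comor_coder_morphism (nuB := nuB) (strict_axiom q) (HnuB j)).
    by apply: comor_eq0 => w _ _ _; apply: nuB_sq.
  move=> w i _; rewrite /defect coder_strict // q_nu.
  by rewrite subrr.
have g_ax' : cochain_axiom (-1) g by [].
pose nu' : cochain A A := fun s j => nu s j - g s j.
have nu'_ax : cochain_axiom (-1) nu' := cochain_sub nu_ax g_ax'.
have ag : agree n.+2 nu nu'.
  by move=> s j Hs; rewrite /nu' g_size ?subr0 // => E; rewrite E ltnn in Hs.
have dA_nu' i j (x : Pi A i) : nu' [:: hel x] j = dA i j x by rewrite -ag ?dA_nu.
exists nu'; split; last by move=> s j Hs; apply: ag; apply: ltnW.
split.
  split=> //.
    have [su1 su2] := nu_su; split.
      move=> m x; have [su_l su_r] := su1 m x; rewrite /nu'.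
      by rewrite (g_unit m [::]) (g_unit m [:: hel x]) !subr0.
    by move=> s1 s2 j Hs; rewrite /nu' su2 // g_unit subr0.
  by move=> s j; rewrite /nu' (lin_sub (@ghom_linear _ _ _ _ q _ _)) qg subr0 q_nu.
move=> s j; rewrite ltnS leq_eqVlt => /orP[/eqP Hs|Hs]; last first.
  rewrite (@agree_square _ _ nu' nu) ?nu0 //.
  by apply: agree_sym => w i Hw; apply: ag; apply: leq_trans Hs.
have s_ne : s <> [::] by case: s Hs.
have ag' : agree (size s) nu' nu by rewrite Hs; apply: agree_sym.
have E1 : coder (-1) nu' (nu ^~ j) s = square nu s j - dA (j + 1) j (g s (j + 1)).
  have := coder_top (-1) (nu ^~ j) ag' s_ne.
  rewrite (linear_letter dA_nu); last by move=> j1 Hj; exact: (cochain_shape nu'_ax Hj).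
  rewrite (linear_letter dA_nu); last by move=> j1 Hj; exact: (cochain_shape nu_ax Hj).
  move/eqP; rewrite subr_eq => /eqP ->.
  rewrite {1}/nu' (lin_sub (@ghom_linear _ _ _ _ dA _ _)).
  by rewrite [_ - _ - _]addrAC subrr sub0r addrC.
have E2 : square nu' s j = coder (-1) nu' (nu ^~ j) s - dcoder dA (g ^~ j) s.
  rewrite -(coder_dcoder dA_nu' (cochain_mlin g_ax' j)); last first.
    by move=> w Hw; apply: g_size => E; rewrite E -Hs ltnn in Hw.
  rewrite -[X in _ = _ + X]scaleN1r addrC -coder_comb; apply: eq_coder => w _ _.
  by rewrite scaleN1r addrC.
rewrite E2 E1 -addrA -opprD -(dg s j Hs).
have -> : ksign k (-2 + 1) = -1 by apply: expr1.
by rewrite scaleN1r opprK subrr.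
Qed.

Lemma lift_structure : exists nu,
  good_structure nu /\ forall s j, square nu s j = 0.
Proof.
have [nu0 H0] := lift_structure0.
have [nu Hn] := cochain_limit (P := fun n nu => good_structure nu /\
  forall s j, (size s < n.+2)%N -> square nu s j = 0) H0
  (fun n f H => lift_structure_step (proj1 H) (proj2 H)).
exists nu; split; last first.
  move=> s j; have [g [[_ g0] ag]] := Hn (size s).
  by rewrite (agree_square _ ag) // g0 // ltnW.
split.
- by apply: cochain_axiom_local => n; have [g [[[]]]] := Hn n; exists g.
- by move=> i j x; have [g [[[_ dg _ _] _] ag]] := Hn 1%N; rewrite ag.
- split.
    move=> n x; have [g [[[_ _ [su _] _] _] ag]] := Hn 2%N; by rewrite !ag //; apply: su.
  move=> s1 s2 j Hs; have [g [[[_ _ [_ su] _] _] ag]] := Hn (size (s1 ++ bar1 one :: s2)).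
  by rewrite ag // su.
- by move=> s j; have [g [[[_ _ _ qg] _] ag]] := Hn (size s); rewrite ag.
Qed.

End LiftStructure.

(** * Existence and uniqueness of lifts *)

Section Dictionary.
Variable k : comPzRingType.

Lemma ev_mkCC_fun (A B : gmod k) d (f : cochain A B) (f_ax : cochain_axiom d f) :
  ev (mkCC f_ax) = f.
Proof. by apply: funext => s; apply: functional_extensionality_dep => j; apply: ev_mkCC. Qed.

Lemma is_morphismP (A B : gmod k) (nuA : ainf A) (nuB : ainf B) (alpha : CC A B 0) :
  is_morphism nuA nuB alpha <-> forall s j, defect nuA nuB alpha s j = 0.
Proof.
have E s j : defect nuA nuB alpha s j = star nuB alpha s j - gerst (-1) alpha nuA s j.
  by rewrite starE ?gerstE.
split=> H s j; first by rewrite E H subrr.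
by apply/eqP; rewrite -subr_eq0 -E H.
Qed.

Lemma ainf_square (A : gmod k) (nu : ainf A) s j : square nu s j = 0.
Proof. by rewrite /square -gerstE ainf_sq0. Qed.

Lemma ainf_of_square (A : gmod k) (nu : cochain A A) : cochain_axiom (-1) nu ->
  (forall s j, square nu s j = 0) -> exists N : ainf A, ev N = nu.
Proof.
move=> nu_ax nu_sq.
have sq s j : gerst (-1) (mkCC nu_ax) (mkCC nu_ax) s j = 0.
  by rewrite ev_mkCC_fun gerstE; apply: nu_sq.
by exists (AInf sq); apply: ev_mkCC_fun.
Qed.

Lemma underlyingE (A : gmod k) (nu : ainf A) i j (x : Pi A i) :
  ev nu [:: hel x] j = underlying nu i j x.
Proof. by []. Qed.

Lemma underlying_one (A : gmod k) (one : A 0) (nu : ainf A) :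
  strictly_unital one nu -> underlying nu 1 0 one = 0.
Proof. by case=> _ H; apply: (H [::] [::]). Qed.

Lemma underlying_eq (A : gmod k) (nu : ainf A) (dA : differential (Pi A)) :
  (forall i j (x : Pi A i), linear_part nu i j x = dA i j x) -> underlying nu = dA.
Proof.
case: dA => f f0 H; have E : linear_part nu = f by apply: ghomP => i j x; apply: H.
rewrite /underlying; move: (linear_part_sq0 _); rewrite E => p.
by congr Differential; apply: Prop_irrelevance.
Qed.

Lemma ev_is_strict (A B : gmod k) (Q : CC A B 0) :
  is_strict Q -> ev Q = strict_fun (linear_part Q).
Proof.
move=> H; apply: funext => s; apply: functional_extensionality_dep => j.
by case: s => [|[i x] [|y s]] //; rewrite H.
Qed.

Lemma linear_part_strict (A B : gmod k) (q : ghom (Pi A) (Pi B) 0) :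
  linear_part (strict q) = q.
Proof. by apply: ghomP => i j x /=; rewrite -[LHS]/(ev (strict q) [:: hel x] j) ev_strict. Qed.

Lemma comp_axiom (A B C : gmod k) (alpha : cochain A B) (beta : cochain B C) :
  cochain_axiom 0 alpha -> cochain_axiom 0 beta ->
  cochain_axiom 0 (fun s j => comor alpha (beta ^~ j) s).
Proof.
move=> alpha_ax beta_ax; apply: cochain_axiomP => [j|s j Hj|j].
- by rewrite comor_nil (cochain_nil beta_ax).
- by apply: comor_eq0 => w _ _ E; apply: (cochain_shape beta_ax); rewrite E.
- exact: (mlin_comor alpha_ax (cochain_mlin beta_ax j)).
Qed.

Lemma comp_defect (A B C : gmod k) (nuA : cochain A A) (nuB : cochain B B)
    (nuC : cochain C C) (alpha : cochain A B) (beta : cochain B C) :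
  cochain_axiom (-1) nuC -> cochain_axiom 0 alpha -> cochain_axiom 0 beta ->
  (forall s j, defect nuA nuB alpha s j = 0) ->
  (forall s j, defect nuB nuC beta s j = 0) ->
  forall s j, defect nuA nuC (fun s j => comor alpha (beta ^~ j) s) s j = 0.
Proof.
move=> nuC_ax alpha_ax beta_ax Ha Hb s j.
rewrite /defect -comor_comor //; last exact: cochain_mlin nuC_ax j.
rewrite (eq_comor (coder (-1) nuB (beta ^~ j))); last first.
  by move=> w _ _ _; apply/eqP; rewrite -subr_eq0; apply/eqP; apply: Hb.
rewrite (comor_coder_morphism (nuA := nuA) alpha_ax) ?subrr //.
exact: cochain_mlin beta_ax j.
Qed.

Lemma comp_su (A B C : gmod k) (oneA : A 0) (oneB : B 0) (oneC : C 0)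
    (alpha : cochain A B) (beta : cochain B C) :
  cochain_axiom 0 beta ->
  strictly_unital_map oneA oneB alpha -> strictly_unital_map oneB oneC beta ->
  strictly_unital_map oneA oneC (fun s j => comor alpha (beta ^~ j) s).
Proof.
move=> beta_ax sua sub; split.
  by rewrite comor_cons /= comor_nil (su_map_letter sua); case: sub.
move=> s1 s2 j Hs; apply: (comor_almost_unitless sua) (cochain_mlin beta_ax j) _ _ _ _.
  by move=> t1 t2 Ht; apply: su_map_zero sub Ht.
by move=> E; move: Hs; rewrite size_cat /= addnS -size_cat E.
Qed.

Lemma strict_su (A B : gmod k) (oneA : A 0) (oneB : B 0) (q : ghom (Pi A) (Pi B) 0) :
  q 1 1 oneA = oneB -> strictly_unital_map oneA oneB (strict_fun q).
Proof.
by move=> H; split=> // s1 s2 j Hs; apply: strict_fun_ne1 => E; rewrite E in Hs.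
Qed.

Lemma starE_fun (A B C : gmod k) (beta : CC B C 0) (alpha : CC A B 0) :
  star beta alpha = (fun s j => comor alpha ((ev beta) ^~ j) s).
Proof.
apply: funext => s; apply: functional_extensionality_dep => j.
by rewrite starE // (cochain_nil (evP beta)).
Qed.

Section Resolution.
Variables (B : gmod k) (oneB : B 0) (nuB : ainf B).
Hypothesis suB : strictly_unital oneB nuB.

Lemma exists_split_lift (A : gmod k) (u : split_element A) (dA : differential (Pi A))
    (q : ghom (Pi A) (Pi B) 0) :
  split_resolution oneB nuB u dA q -> exists nuA : ainf A, split_lift nuB u dA q nuA.
Proof.
case=> semi qi qs d1 q1.
have [nu [[nu_ax dnu nu_su qnu] nu_sq]] := lift_structure d1 semi qi qs q1
  (evP nuB) (@underlyingE _ nuB) (@ainf_square _ nuB) suB.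
have [N EN] := ainf_of_square nu_ax nu_sq.
exists N; split.
- by move=> i j x; rewrite -dnu -EN.
- by rewrite EN.
- apply/is_morphismP => s j; rewrite /defect EN ev_strict coder_strict //.
  by rewrite qnu subrr.
Qed.

(** The composite of [q] with an augmentation of B is an augmentation of A. *)
Lemma augmented_split_lift (A : gmod k) (u : split_element A) (dA : differential (Pi A))
    (q : ghom (Pi A) (Pi B) 0) (nuA : ainf A) :
  split_resolution oneB nuB u dA q -> split_lift nuB u dA q nuA ->
  augmented oneB nuB -> augmented (split_one u) nuA.
Proof.
move=> [_ _ _ _ q1] [_ _ q_mor] [eps [eps_mor eps_su]].
have ax := comp_axiom (evP (strict q)) (evP eps).
exists (mkCC ax); split.
  apply/is_morphismP; rewrite ev_mkCC_fun.
  apply: comp_defect; [exact: evP|exact: evP|exact: evP| |].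
    exact/is_morphismP.
  exact/is_morphismP.
rewrite ev_mkCC_fun; apply: comp_su eps_su; first exact: evP.
by rewrite ev_strict; apply: strict_su.
Qed.

Section Lifts.
Variables (A C : gmod k) (oneA : A 0) (u : split_element C).
Variables (nuA : ainf A) (nuC : ainf C) (q : CC A B 0) (alpha : CC C B 0).
Hypothesis problem : lifting_problem oneA oneB u nuA nuB nuC q alpha.

Lemma lift_value (delta : CC C A 0) s j : is_strict q ->
  star q delta s j = linear_part q j j (ev delta s j).
Proof.
move=> q_str; rewrite starE ?(cochain_nil (evP q)) // (ev_is_strict q_str).
by rewrite comor_strict //; apply: evP.
Qed.

Lemma exists_lift : exists delta : CC C A 0, is_lift oneA u nuA nuC q alpha delta.
Proof.
have [[[suA _ suC] [q_mor _ q_str] [al_mor al_su] semi [qi qs]]] := problem.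
move=> [delta1 [d1C d1_one d1q]].
have qm s j : linear_part q j j (ev nuA s j) = comor (strict_fun (linear_part q)) ((ev nuB) ^~ j) s.
  have /is_morphismP/(_ s j)/eqP := q_mor; rewrite subr_eq0 (ev_is_strict q_str) => /eqP ->.
  by rewrite coder_strict //; apply: evP.
have [delta [[d_ax d_su qd] d_mor]] := lift_morphism (underlying_one suC) semi qi qs
  (evP nuA) (evP nuB) (evP nuC) (@underlyingE _ nuA) (@underlyingE _ nuC)
  (@ainf_square _ nuA) (@ainf_square _ nuC) suA suC qm (evP alpha) al_su
  ((proj1 (is_morphismP _ _ _)) al_mor) d1C d1_one d1q.
exists (mkCC d_ax); split; rewrite ?ev_mkCC_fun //.
  by apply/is_morphismP; rewrite ev_mkCC_fun.
by move=> s j; rewrite -[RHS]qd -(ev_mkCC_fun d_ax) lift_value.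
Qed.

Lemma lifts_homotopic :
  (forall n : nat, (1 <= n)%N ->
     reduced_H0_vanishes n.+1 (split_one u) (underlying nuC) (underlying nuA)) ->
  forall delta delta' : CC C A 0,
    is_lift oneA u nuA nuC q alpha delta -> is_lift oneA u nuA nuC q alpha delta' ->
    su_homotopic (split_one u) nuC nuA delta delta'.
Proof.
move=> H0 delta delta' [d_mor d_su qd] [d'_mor d'_su qd'].
have [[[suA _ suC] [q_mor _ q_str] [al_mor al_su] semi [qi qs]] _] := problem.
have qe s j : linear_part q j j (ev delta s j) = linear_part q j j (ev delta' s j).
  by rewrite -!lift_value // qd qd'.
have [r [r_ax red Hr]] := lift_homotopy (underlying_one suC) semi qi qs
  (evP nuA) (evP nuC) (@underlyingE _ nuA) (@underlyingE _ nuC)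
  (@ainf_square _ nuA) (@ainf_square _ nuC) suA suC (evP delta) (evP delta') d_su d'_su
  ((proj1 (is_morphismP _ _ _)) d_mor) ((proj1 (is_morphismP _ _ _)) d'_mor) qe H0.
exists (mkCC r_ax); rewrite /is_homotopy ev_mkCC_fun; split=> // s j.
by rewrite hstarE gerstE Hr.
Qed.

End Lifts.

Section Uniqueness.
Variables (A : gmod k) (u : split_element A) (dA : differential (Pi A)).
Variable q : ghom (Pi A) (Pi B) 0.
Hypothesis q_res : split_resolution oneB nuB u dA q.

Lemma split_lifting_problem (nuA nuA' : ainf A) :
  split_lift nuB u dA q nuA -> split_lift nuB u dA q nuA' ->
  lifting_problem (split_one u) oneB u nuA' nuB nuA (strict q) (strict q).
Proof.
move=> [lin su mor] [lin' su' mor']; case: q_res => semi qi qs d1 q1.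
have Eu := underlying_eq lin; have Eu' := underlying_eq lin'.
have q_su : strictly_unital_map (split_one u) oneB (strict q).
  by rewrite ev_strict; apply: strict_su.
split; last first.
  exists (gid (Pi A)); rewrite Eu Eu'; split.
  - by move=> i j x; rewrite !gid_id.
  - exact: gid_id.
  - by move=> i x; rewrite gid_id.
rewrite Eu Eu' linear_part_strict; split=> //; split=> //.
by move=> s j Hs; rewrite ev_strict strict_fun_ne1 // => E; rewrite E in Hs.
Qed.

Lemma comor_id (V : lmodType k) (phi : word A -> V) s : mlin phi ->
  comor (strict_fun (gid (Pi A))) phi s = phi s.
Proof.
move=> Hphi; rewrite comor_strict_map //; congr phi.
by elim: s => //= -[i x] s ->; rewrite /qletter [q in hel q]gid_id.
Qed.

Lemma id_is_lift (nuA : ainf A) :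
  is_lift (split_one u) u nuA nuA (strict q) (strict q) (strict (gid (Pi A))).
Proof.
split.
- apply/is_morphismP => s j; rewrite /defect ev_strict comor_id; last first.
    exact: cochain_mlin (evP nuA) j.
  by rewrite coder_strict ?gid_id ?subrr //; apply: evP.
- by rewrite ev_strict; apply: strict_su; apply: gid_id.
- move=> s j; rewrite starE ?(cochain_nil (evP _)) // ev_strict comor_id //.
  exact: cochain_mlin (evP (strict q)) j.
Qed.

Lemma comp_is_lift (nuA nuA' : ainf A) (f g : CC A A 0)
    (ax : cochain_axiom 0 (fun s j => comor f ((ev g) ^~ j) s)) :
  is_lift (split_one u) u nuA' nuA (strict q) (strict q) f ->
  is_lift (split_one u) u nuA nuA' (strict q) (strict q) g ->
  is_lift (split_one u) u nuA nuA (strict q) (strict q) (mkCC ax).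
Proof.
move=> [f_mor f_su qf] [g_mor g_su qg]; split.
- apply/is_morphismP; rewrite ev_mkCC_fun.
  apply: comp_defect; [exact: evP|exact: evP|exact: evP| |].
    exact/is_morphismP.
  exact/is_morphismP.
- by rewrite ev_mkCC_fun; apply: comp_su g_su => //; apply: evP.
move=> s j; rewrite starE_fun ev_mkCC_fun -comor_comor; last 3 first.
- exact: evP.
- exact: evP.
- exact: cochain_mlin (evP (strict q)) j.
rewrite -[in RHS]qf starE ?(cochain_nil (evP _)) //.
by apply: eq_comor => w _ _ _; rewrite -[RHS]qg starE ?(cochain_nil (evP _)).
Qed.

(** The identity of the complex Pi A lifts [q] along [q], so [exists_lift] gives
    morphisms in both directions; their composites and the identities are lifts of
    the same morphism. *)
Lemma split_lifts_equivalent :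
  (forall n : nat, (1 <= n)%N -> reduced_H0_vanishes n.+1 (split_one u) dA dA) ->
  forall nuA nuA' : ainf A,
    split_lift nuB u dA q nuA -> split_lift nuB u dA q nuA' ->
    su_homotopy_equivalent (split_one u) (split_one u) nuA nuA'.
Proof.
move=> H0 nuA nuA' L L'.
have [f Lf] := exists_lift (split_lifting_problem L L').
have [g Lg] := exists_lift (split_lifting_problem L' L).
have half (nu nu' : ainf A) (f1 g1 : CC A A 0) :
    split_lift nuB u dA q nu -> split_lift nuB u dA q nu' ->
    is_lift (split_one u) u nu' nu (strict q) (strict q) f1 ->
    is_lift (split_one u) u nu nu' (strict q) (strict q) g1 ->
    su_homotopic (split_one u) nu nu (star g1 f1) (strict (gid (Pi A))).
  move=> Ln Ln' L1 L2.
  have ax := comp_axiom (evP f1) (evP g1).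
  rewrite starE_fun -(ev_mkCC_fun ax).
  apply: (lifts_homotopic (split_lifting_problem Ln Ln)).
  - by case: Ln => lin _ _; rewrite (underlying_eq lin).
  - exact: comp_is_lift L1 L2.
  - exact: id_is_lift.
exists f, g; case: (Lf) (Lg) => f_mor f_su _ [g_mor g_su _].
split=> //; [exact: half L L' Lf Lg | exact: half L' L Lg Lf].
Qed.

End Uniqueness.
End Resolution.
End Dictionary.

Theorem theorem3p1 (k : comPzRingType) (B : gmod k) (oneB : B 0) (nuB : ainf B)
    (suB : strictly_unital oneB nuB) :
  (forall (A : gmod k) (u : split_element A) (dA : differential (Pi A))
      (q : ghom (Pi A) (Pi B) 0),
    split_resolution oneB nuB u dA q ->
    (exists nuA : ainf A, split_lift nuB u dA q nuA) /\
    (augmented oneB nuB ->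
     exists nuA : ainf A, split_lift nuB u dA q nuA /\ augmented (split_one u) nuA)) /\
  (forall (A C : gmod k) (oneA : A 0) (u : split_element C)
      (nuA : ainf A) (nuC : ainf C) (q : CC A B 0) (alpha : CC C B 0),
    lifting_problem oneA oneB u nuA nuB nuC q alpha ->
    exists delta : CC C A 0, is_lift oneA u nuA nuC q alpha delta) /\
  (forall (A C : gmod k) (oneA : A 0) (u : split_element C)
      (nuA : ainf A) (nuC : ainf C) (q : CC A B 0) (alpha : CC C B 0),
    lifting_problem oneA oneB u nuA nuB nuC q alpha ->
    (forall n : nat, (1 <= n)%N ->
       reduced_H0_vanishes n.+1 (split_one u) (underlying nuC) (underlying nuA)) ->
    forall delta delta' : CC C A 0,
      is_lift oneA u nuA nuC q alpha delta ->
      is_lift oneA u nuA nuC q alpha delta' ->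
      su_homotopic (split_one u) nuC nuA delta delta') /\
  (forall (A : gmod k) (u : split_element A) (dA : differential (Pi A))
      (q : ghom (Pi A) (Pi B) 0),
    split_resolution oneB nuB u dA q ->
    (forall n : nat, (1 <= n)%N -> reduced_H0_vanishes n.+1 (split_one u) dA dA) ->
    forall nuA nuA' : ainf A,
      split_lift nuB u dA q nuA -> split_lift nuB u dA q nuA' ->
      su_homotopy_equivalent (split_one u) (split_one u) nuA nuA').
Proof.
split; last split; last split.
- move=> A u dA q q_res; have [nuA L] := exists_split_lift suB q_res.
  split; first by exists nuA.
  by move=> aug; exists nuA; split=> //; apply: augmented_split_lift q_res L aug.
- by move=> A C oneA u nuA nuC q alpha; apply: exists_lift.
- by move=> A C oneA u nuA nuC q alpha; apply: lifts_homotopic.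
- by move=> A u dA q; apply: split_lifts_equivalent.
Qed.
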